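(* Let $n\ge 2$ and let $\mathbb{B}^n$ be the open unit ball and $\mathbb{S}^{n-1}$ the unit sphere of $\mathbb{R}^n$. If $f:\mathbb{B}^n\to\mathbb{B}^n$ is a harmonic and $K$-quasiconformal mapping of $\mathbb{B}^n$ onto itself, then $$|f(x)-f(y)|\le L|x-y|,\qquad x,y\in\mathbb{B}^n,$$ where the constant $L<\infty$ depends only on the distortion $K$, the dimension $n$ and $\mathrm{dist}(f(0),\mathbb{S}^{n-1})$.
   Context: A mapping $f=(f^1,\dots,f^n)$ is harmonic if each coordinate function $f^j$ is a real-valued harmonic function. A $K$-quasiconformal mapping $f:\Omega\to\Omega'$ between domains of $\mathbb{R}^n$ is a homeomorphism of $\Omega$ onto $\Omega'$ with $f\in W^{1,n}_{loc}(\Omega;\mathbb{R}^n)$ and $|Df(x)|^n\le K\,|\det Df(x)|$ for almost every $x\in\Omega$, where $|Df(x)|$ is the operator norm (other standard normalizations of $K$ are quantitatively equivalent, with constants depending only on $n$ and $K$). *)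

(* Defs.v *)
From HB Require Import structures.
From mathcomp Require Import all_boot all_order all_algebra.
From mathcomp Require Import all_classical all_reals all_analysis.

Set Implicit Arguments.
Unset Strict Implicit.
Unset Printing Implicit Defensive.

Import Order.TTheory GRing.Theory Num.Theory.
Import numFieldNormedType.Exports.

Local Open Scope classical_set_scope.
Local Open Scope ring_scope.

(* The library norm on ['rV[R]_n] is the sup norm; it is used here only for the
   topology, and all metric notions below are Euclidean. *)
Section euclidean.
Context {R : realType}.

Definition enorm n (v : 'rV[R]_n) : R := Num.sqrt (\sum_i v 0 i ^+ 2).

Definition eball n : set 'rV[R]_n := [set x | enorm x < 1].

Definition esphere n : set 'rV[R]_n := [set x | enorm x = 1].

Definition dist_to n (x : 'rV[R]_n) (A : set 'rV[R]_n) : R :=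
  inf [set enorm (x - y) | y in A].

(* Matrices act on row vectors by right multiplication, as with ['J f x]. *)
Definition opnorm m n (A : 'M[R]_(m, n)) : R :=
  sup [set enorm (v *m A) | v in [set v | enorm v <= 1]].

End euclidean.

Section lebesgue_tuple.
Context {R : realType}.
Local Notation mR := (measurableTypeR R).
Local Open Scope ereal_scope.

Definition tuple_cons n (p : n.-tuple mR * mR) : n.+1.-tuple mR :=
  [tuple of p.2 :: p.1].

Lemma measurable_tuple_cons n : measurable_fun [set: _] (@tuple_cons n).
Proof. exact: (measurable_cons measurable_snd measurable_fst). Qed.

Definition lebesgue_cons n (mu : {measure set (n.-tuple mR) -> \bar R}) :
    set (n.+1.-tuple mR) -> \bar R :=
  pushforward (mu \x lebesgue_measure) (@tuple_cons n).

Section lebesgue_cons_measure.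
Variables (n : nat) (mu : {measure set (n.-tuple mR) -> \bar R}).

Let lebesgue_cons0 : lebesgue_cons mu set0 = 0.
Proof. by rewrite /lebesgue_cons measure0//; exact: measurable_tuple_cons. Qed.

Let lebesgue_cons_ge0 A : 0 <= lebesgue_cons mu A.
Proof. by apply: measure_ge0; exact: measurable_tuple_cons. Qed.

Let lebesgue_cons_sigma_additive : semi_sigma_additive (lebesgue_cons mu).
Proof. by apply: measure_semi_sigma_additive; exact: measurable_tuple_cons. Qed.

HB.instance Definition _ := isMeasure.Build _ _ _ (lebesgue_cons mu)
  lebesgue_cons0 lebesgue_cons_ge0 lebesgue_cons_sigma_additive.

End lebesgue_cons_measure.

Fixpoint lebesgue_tuple n : {measure set (n.-tuple mR) -> \bar R} :=
  if n is m.+1 return {measure set (n.-tuple mR) -> \bar R}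
  then lebesgue_cons (lebesgue_tuple m) else \d_([tuple]).

Lemma measurable_tuple_box n (A : 'I_n -> set mR) :
  (forall i, measurable (A i)) -> measurable [set t | forall i, A i (tnth t i)].
Proof.
move=> mA.
rewrite (_ : mkset _ = \bigcap_(i in [set: 'I_n]) ((@tnth _ _)^~ i @^-1` A i)).
  apply: fin_bigcap_measurable => // i _; rewrite -[X in measurable X]setTI.
  exact: measurable_tnth.
by apply/seteqP; split=> [t h i _|t h i]; exact: h.
Qed.

Lemma lebesgue_tuple_box n (A : 'I_n -> set mR) :
  (forall i, measurable (A i)) ->
  lebesgue_tuple n [set t | forall i, A i (tnth t i)] =
  \prod_(i < n) lebesgue_measure (A i).
Proof.
elim: n A => [|n IH] A mA.
  rewrite big_ord0 /= diracE mem_set//; by case.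
rewrite big_ord_recl /= /lebesgue_cons /pushforward.
rewrite [X in product_measure1 _ _ X](_ : _ =
  [set t | forall i, A (lift ord0 i) (tnth t i)] `*` A ord0); last first.
  apply/seteqP; split=> -[t x]/=.
    move=> h; split; last by have := h ord0.
    by move=> i; have := h (lift ord0 i); rewrite tnthS.
  move=> [h h0] i; case: (unliftP ord0 i) => [j|] -> //.
  by rewrite tnthS.
rewrite product_measure1E//; last first.
  by apply: (@measurable_tuple_box _ (fun i => A (lift ord0 i))) => i; exact: mA.
by rewrite [LHS]muleC; congr (_ * _); exact: (IH (fun i => A (lift ord0 i))).
Qed.

End lebesgue_tuple.

Section lebesgue_rV.
Context {R : realType}.
Local Open Scope ereal_scope.

Definition row_of_tuple n (t : n.-tuple (measurableTypeR R)) : 'rV[R]_n :=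
  \row_i tnth t i.

Section rV_measurable.
Variable n : nat.

(* The product sigma-algebra, that is, the Borel sets of R^n. *)
Definition rV_measurable : set (set 'rV[R]_n) :=
  [set A | measurable (@row_of_tuple n @^-1` A)].

Let rV_measurable0 : rV_measurable set0.
Proof. by rewrite /rV_measurable /= preimage_set0. Qed.

Let rV_measurableC A : rV_measurable A -> rV_measurable (~` A).
Proof. by rewrite /rV_measurable /= preimage_setC; exact: measurableC. Qed.

Let rV_measurable_bigcup (F : (set 'rV[R]_n)^nat) :
  (forall i, rV_measurable (F i)) -> rV_measurable (\bigcup_i F i).
Proof.
by rewrite /rV_measurable /= preimage_bigcup => ?; exact: bigcup_measurable.
Qed.

HB.instance Definition _ := @isMeasurable.Build default_measure_display
  'rV[R]_n rV_measurable rV_measurable0 rV_measurableC rV_measurable_bigcup.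

Lemma measurable_row_of_tuple : measurable_fun [set: _] (@row_of_tuple n).
Proof. by move=> _ A mA; rewrite setTI. Qed.

Definition lebesgue : set 'rV[R]_n -> \bar R :=
  pushforward (@lebesgue_tuple R n) (@row_of_tuple n).

Let lebesgue0 : lebesgue set0 = 0.
Proof. by rewrite /lebesgue measure0//; exact: measurable_row_of_tuple. Qed.

Let lebesgue_ge0 A : 0 <= lebesgue A.
Proof. by apply: measure_ge0; exact: measurable_row_of_tuple. Qed.

Let lebesgue_sigma_additive : semi_sigma_additive lebesgue.
Proof. by apply: measure_semi_sigma_additive; exact: measurable_row_of_tuple. Qed.

HB.instance Definition _ := isMeasure.Build _ _ _ lebesgue
  lebesgue0 lebesgue_ge0 lebesgue_sigma_additive.

End rV_measurable.

Lemma lebesgue_box n (A : 'I_n -> set (measurableTypeR R)) :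
  (forall i, measurable (A i)) ->
  lebesgue [set x : 'rV[R]_n | forall i, A i (x 0%R i)] =
  \prod_(i < n) lebesgue_measure (A i).
Proof.
move=> mA; rewrite -(lebesgue_tuple_box mA) /lebesgue /pushforward.
by congr (lebesgue_tuple n _); apply/seteqP; split => t /= h i;
  have := h i; rewrite mxE.
Qed.

End lebesgue_rV.
Arguments lebesgue {R n}.

Section analysis.
Context {R : realType}.

Definition partial n (i : 'I_n) (u : 'rV[R]_n -> R) : 'rV[R]_n -> R :=
  fun x => 'D_('e_i) u x.

(* Meaningful for open [Omega]: only the values of [u] on [Omega] matter then. *)
Fixpoint Ck n (k : nat) (Omega : set 'rV[R]_n) (u : 'rV[R]_n -> R) : Prop :=
  {within Omega, continuous u} /\
  if k is k'.+1 then
    forall i, (forall x, Omega x -> derivable u x 'e_i) /\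
              Ck k' Omega (partial i u)
  else True.

Definition harmonic_on n (Omega : set 'rV[R]_n) (u : 'rV[R]_n -> R) : Prop :=
  Ck 2 Omega u /\
  forall x, Omega x -> \sum_(i < n) partial i (partial i u) x = 0.

Definition harmonic_map n m (Omega : set 'rV[R]_n) (f : 'rV[R]_n -> 'rV[R]_m) :=
  forall j, harmonic_on Omega (fun x => f x 0 j).

Definition test_function n (Omega : set 'rV[R]_n) (phi : 'rV[R]_n -> R) : Prop :=
  (forall k, Ck k setT phi) /\
  exists C, [/\ compact C, C `<=` Omega & forall x, ~ C x -> phi x = 0].

Definition weak_partial n (Omega : set 'rV[R]_n) (i : 'I_n)
    (u g : 'rV[R]_n -> R) : Prop :=
  forall phi, test_function Omega phi ->
  (\int[lebesgue]_(x in Omega) (u x * partial i phi x)%:E =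
   - \int[lebesgue]_(x in Omega) (g x * phi x)%:E)%E.

Definition Lp_loc n (p : nat) (Omega : set 'rV[R]_n) (u : 'rV[R]_n -> R) : Prop :=
  measurable_fun Omega u /\
  forall C, compact C -> C `<=` Omega ->
    (\int[lebesgue]_(x in C) (`|u x| ^+ p)%:E < +oo)%E.

(* [f] is in W^{1,p}_loc(Omega; R^m) with weak derivative [Df]; row [i] of [Df x]
   is the weak partial derivative of [f] in direction ['e_i]. *)
Definition W1p_loc n m (p : nat) (Omega : set 'rV[R]_n)
    (f : 'rV[R]_n -> 'rV[R]_m) (Df : 'rV[R]_n -> 'M[R]_(n, m)) : Prop :=
  forall j, Lp_loc p Omega (fun x => f x 0 j) /\
    forall i, Lp_loc p Omega (fun x => Df x i j) /\
      weak_partial Omega i (fun x => f x 0 j) (fun x => Df x i j).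

Definition domain n (Omega : set 'rV[R]_n) : Prop :=
  [/\ open Omega, connected Omega & Omega !=set0].

Definition homeomorphism n m (Omega : set 'rV[R]_n) (Omega' : set 'rV[R]_m)
    (f : 'rV[R]_n -> 'rV[R]_m) : Prop :=
  [/\ set_bij Omega Omega' f, {within Omega, continuous f} &
      exists g : 'rV[R]_m -> 'rV[R]_n,
        (forall x, Omega x -> g (f x) = x) /\ {within Omega', continuous g}].

Definition quasiconformal n (K : R) (Omega Omega' : set 'rV[R]_n)
    (f : 'rV[R]_n -> 'rV[R]_n) : Prop :=
  [/\ domain Omega, domain Omega', homeomorphism Omega Omega' f &
      exists Df : 'rV[R]_n -> 'M[R]_n, W1p_loc n Omega f Df /\
        {ae lebesgue, forall x, Omega x ->
           opnorm (Df x) ^+ n <= K * `|\det (Df x)|}].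

End analysis.

(* Main.v *)
(* Put [D x = 1 - |x|^2].  The proof uses neither Poisson integrals nor the modulus of path
   families.  Bump functions show that the weak derivative of [f] is the classical one almost
   everywhere, so that [|Df|^n <= K |det Df|] holds at every point.  The maximum principle
   yields gradient estimates and Harnack's inequality; applied to the positive harmonic
   functions [1 - <f, xi>] they give [|Df x| <= C (1 - |f x|) / (1 - |x|)], and together with
   quasiconformality a Koebe theorem: [f (B (x, r))] contains a ball of radius [c r |Df x|].
   Comparing the volumes of the images of disjoint annuli then forces
   [1 - |f x| <= C (D x)^al] for some [al > 0].  Finally [U = 1 - |f|^2] satisfies
   [- Lap U = 2 sum |grad f_j|^2 <= C U^2 / D^2]; comparing [U] with multiples of [D^(2 al)]
   doubles the exponent until it equals [3/4], and then the barrier [2 D - D^(3/2)] gives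
   [U <= C D], whence [|Df|] is bounded. *)

From HB Require Import structures.
Require Import Defs.
From mathcomp Require Import all_boot all_order all_algebra.
From mathcomp Require Import all_classical all_reals all_analysis measurable_realfun.
From mathcomp Require Import ring lra zify.

Set Implicit Arguments.
Unset Strict Implicit.
Unset Printing Implicit Defensive.

Import Order.TTheory GRing.Theory Num.Theory.
Import numFieldNormedType.Exports.

Local Open Scope classical_set_scope.
Local Open Scope ring_scope.

(** Nothing is known about f at the sphere, so properness replaces boundary values throughout: |f x|
    tends to 1 as |x| does. The annuli work as follows. If the part of f (tent at z) near f z had
    small volume, the Koebe theorem would make |Df| small along tubes, and one could descend through
    ever smaller tents to the sphere with f staying close to f z; properness forbids this. Hence
    each of N disjoint annuli around x contributes volume at least (eps (1 - |f e|))^n near a point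
    f e of the segment from f x to 0. If 1 - |f| stayed below 2 (1 - |f x|) on all of them, these
    disjoint images would lie in a ball of radius 2 (1 - |f x|), which bounds N. So 1 - |f| doubles
    before D grows by a bounded factor. The resulting exponent al may be tiny. From U <= A D^al one
    gets - Lap U <= C A^2 D^(2 al - 2), the order of - Lap D^(2 al) as long as 2 al < 1. The
    exponents are arranged to reach 3/4 exactly and so to skip 1, where this barrier degenerates. *)

Ltac npos := repeat first
  [ assumption | done | apply: mulr_gt0 | apply: divr_gt0 | apply: exprn_gt0
  | rewrite invr_gt0 | (apply: ltr_wpDl; [by rewrite ?ler0n ?mulr_ge0|]) ].
Ltac nneg := repeat first
  [ assumption | done | by apply: ltW | apply: sqrtr_ge0 | apply: mulr_ge0 | apply: addr_ge0
  | apply: divr_ge0 | apply: exprn_ge0 | rewrite invr_ge0 | apply: ler0n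
  | (apply: ltW; by npos) ].

(** * Euclidean norm *)

Section Euclid.
Context {R : realType} {n : nat}.
Implicit Types (u v w x y z : 'rV[R]_n) (a b c : R).

Definition dot u v : R := \sum_i u 0 i * v 0 i.

Lemma dotC u v : dot u v = dot v u.
Proof. by apply: eq_bigr => i _; rewrite mulrC. Qed.

Lemma dotDl u v w : dot (u + v) w = dot u w + dot v w.
Proof. by rewrite -big_split; apply: eq_bigr => i _ /=; rewrite !mxE mulrDl. Qed.

Lemma dotZl a u v : dot (a *: u) v = a * dot u v.
Proof. by rewrite mulr_sumr; apply: eq_bigr => i _ /=; rewrite !mxE mulrA. Qed.

Lemma dotNl u v : dot (- u) v = - dot u v.
Proof. by rewrite -scaleN1r dotZl mulN1r. Qed.

Lemma dotDr u v w : dot u (v + w) = dot u v + dot u w.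
Proof. by rewrite dotC dotDl !(dotC u). Qed.

Lemma dotZr a u v : dot u (a *: v) = a * dot u v.
Proof. by rewrite dotC dotZl dotC. Qed.

Lemma dotNr u v : dot u (- v) = - dot u v.
Proof. by rewrite dotC dotNl dotC. Qed.

Lemma sqr_enorm u : enorm u ^+ 2 = dot u u.
Proof.
rewrite /enorm sqr_sqrtr; last by apply: sumr_ge0 => i _; exact: sqr_ge0.
by apply: eq_bigr => i _; rewrite expr2.
Qed.

Lemma enorm_ge0 u : 0 <= enorm u.
Proof. exact: sqrtr_ge0. Qed.

Lemma enorm0 : enorm (0 : 'rV[R]_n) = 0.
Proof.
by rewrite /enorm big1 ?sqrtr0// => i _; rewrite mxE expr0n.
Qed.

Lemma sqr_enormD u v : enorm (u + v) ^+ 2 = enorm u ^+ 2 + 2 * dot u v + enorm v ^+ 2.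
Proof. by rewrite !sqr_enorm dotDl !dotDr (dotC v u); ring. Qed.

Lemma sqr_enormB u v : enorm (u - v) ^+ 2 = enorm u ^+ 2 - 2 * dot u v + enorm v ^+ 2.
Proof. by rewrite !sqr_enorm dotDl !dotDr dotNl dotNr dotNl dotNr opprK (dotC v u); ring. Qed.

Lemma enormZ a u : enorm (a *: u) = `|a| * enorm u.
Proof.
apply/eqP; rewrite -(eqrXn2 (_ : 0 < 2)%N) ?mulr_ge0 ?enorm_ge0//.
by rewrite sqr_enorm dotZl dotZr exprMn sqr_enorm real_normK ?num_real// mulrA expr2.
Qed.

Lemma enormN u : enorm (- u) = enorm u.
Proof. by rewrite -scaleN1r enormZ normrN1 mul1r. Qed.

Lemma enormBC u v : enorm (u - v) = enorm (v - u).
Proof. by rewrite -enormN opprB. Qed.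

Lemma coord_le_enorm u i : `|u 0 i| <= enorm u.
Proof.
rewrite -(@ler_pXn2r _ 2) ?nnegrE ?enorm_ge0// sqr_enorm real_normK ?num_real//.
rewrite /dot (bigD1 i)//= -expr2 lerDl.
by apply: sumr_ge0 => j _; rewrite -expr2 sqr_ge0.
Qed.

Lemma enorm_eq0 u : enorm u = 0 -> u = 0.
Proof.
move=> u0; apply/rowP => i; rewrite mxE; apply/eqP.
by rewrite -normr_le0 -u0 coord_le_enorm.
Qed.

Lemma enorm_gt0 u : u != 0 -> 0 < enorm u.
Proof.
move=> u0; rewrite lt_neqAle enorm_ge0 andbT eq_sym.
by apply/negP => /eqP/enorm_eq0/eqP; exact/negP.
Qed.

Lemma dot_le u v : dot u v <= enorm u * enorm v.
Proof.
have [->|v0] := eqVneq v 0.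
  by rewrite enorm0 mulr0 /dot big1// => i _; rewrite mxE mulr0.
have [->|u0] := eqVneq u 0.
  by rewrite enorm0 mul0r /dot big1// => i _; rewrite mxE mul0r.
have := enorm_gt0 v0; have := enorm_gt0 u0.
have := sqr_ge0 (enorm (enorm v *: u - enorm u *: v)).
rewrite sqr_enormB !enormZ dotZl dotZr !exprMn !real_normK ?num_real//.
set a := enorm u; set b := enorm v; set d := dot u v => h a0 b0.
have : 0 <= (2 * (a * b)) * (a * b - d) by nra.
by rewrite pmulr_rge0 ?subr_ge0// !mulr_gt0.
Qed.

Lemma enormD u v : enorm (u + v) <= enorm u + enorm v.
Proof.
rewrite -(@ler_pXn2r _ 2) ?nnegrE ?addr_ge0 ?enorm_ge0// sqr_enormD.
have := dot_le u v; nra.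
Qed.

Lemma enormB u v : enorm (u - v) <= enorm u + enorm v.
Proof. by rewrite -(enormN v); exact: enormD. Qed.

Lemma enorm_tri w u v : enorm (u - v) <= enorm (u - w) + enorm (w - v).
Proof. by have := enormD (u - w) (w - v); rewrite addrA subrK. Qed.

Lemma enorm_lerB u v : enorm u - enorm v <= enorm (u - v).
Proof. by rewrite lerBlDr -{1}(subrK v u) enormD. Qed.

Lemma enorm_sum (I : finType) (F : I -> 'rV[R]_n) :
  enorm (\sum_i F i) <= \sum_i enorm (F i).
Proof.
elim/big_ind2 : _ => [|x1 x2 y1 y2 h1 h2|//]; first by rewrite enorm0.
exact/(le_trans (enormD _ _))/lerD.
Qed.

Lemma delta_dot u i : dot u 'e_i = u 0 i.
Proof.
rewrite /dot (bigD1 i)//= mxE !eqxx mulr1 big1 ?addr0// => j ji.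
by rewrite mxE eqxx (negbTE ji) mulr0.
Qed.

Lemma enorm_delta i : enorm ('e_i : 'rV[R]_n) = 1.
Proof.
apply/eqP; rewrite -(eqrXn2 (_ : 0 < 2)%N) ?enorm_ge0//.
by rewrite sqr_enorm delta_dot mxE !eqxx expr1n.
Qed.

Lemma enorm_le_sum u : enorm u <= \sum_i `|u 0 i|.
Proof.
rewrite {1}(row_sum_delta u) (le_trans (enorm_sum _))//.
by apply: ler_sum => i _; rewrite enormZ enorm_delta mulr1.
Qed.

Lemma enorm_le_coord u c : (forall i, `|u 0 i| <= c) -> enorm u <= n%:R * c.
Proof.
move=> uc; apply: (le_trans (enorm_le_sum u)).
rewrite -[X in X%:R](card_ord n) -sum1_card natr_sum mulr_suml.
by apply: ler_sum => i _; rewrite mul1r.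
Qed.

Lemma mxnorm_le_enorm u : `|u| <= enorm u.
Proof.
rewrite [`|u|]/Num.norm /= mx_normrE; apply/bigmax_leP; split; first exact: enorm_ge0.
by move=> [i j] _ /=; rewrite ord1 coord_le_enorm.
Qed.

Lemma coord_le_mxnorm u i : `|u 0 i| <= `|u|.
Proof.
by rewrite [leRHS]/Num.norm /= mx_normrE; apply: (le_bigmax _ (fun ij => `|u ij.1 ij.2|) (0, i)).
Qed.

End Euclid.

(** * The topology of row vectors in terms of Euclidean balls *)

Section EuclidTopology.
Context {R : realType} {n : nat}.
Implicit Types (u v w x y z : 'rV[R]_n) (a b c : R).

Definition eb x r : set 'rV[R]_n := [set y | enorm (y - x) < r].
Definition cb x r : set 'rV[R]_n := [set y | enorm (y - x) <= r].

Lemma nbhs_eb x e : 0 < e -> nbhs x (eb x e).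
Proof.
move=> e0; have n0 : 0 < n%:R + 1 :> R by rewrite ltr_wpDl.
(* The Euclidean norm is at most [n] times the sup norm; dividing by [n + 1] also covers [n = 0]. *)
apply/nbhs_ballP; exists (e / (n%:R + 1)); first by rewrite /= divr_gt0.
move=> y; rewrite mx_norm_ball /ball_ /= => yx; rewrite /eb /=.
apply: (@le_lt_trans _ _ (n%:R * `|x - y|)).
  by rewrite enormBC; apply: enorm_le_coord => i; exact: coord_le_mxnorm.
have : n%:R * `|x - y| <= n%:R * (e / (n%:R + 1)) by rewrite ler_wpM2l// ltW.
move=> /le_lt_trans; apply.
by rewrite mulrA ltr_pdivrMr// mulrC ltr_pM2l// ltrDl.
Qed.

Lemma nbhs_enormP x (A : set 'rV[R]_n) :
  nbhs x A <-> exists2 e, 0 < e & eb x e `<=` A.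
Proof.
split=> [/nbhs_ballP[e /= e0 eA]|[e e0 eA]]; last exact: filterS (nbhs_eb x e0).
exists e => // y; rewrite /eb/= => yx; apply: eA.
by rewrite mx_norm_ball /ball_ /= -normrN opprB (le_lt_trans (mxnorm_le_enorm _)).
Qed.

Lemma open_eb x r : open (eb x r).
Proof.
rewrite openE => y; rewrite /eb /= => yr; apply/nbhs_enormP.
exists (r - enorm (y - x)); first by rewrite subr_gt0.
move=> z; rewrite /eb/= => zy.
by rewrite (le_lt_trans (enorm_tri y z x))// -ltrBrDr.
Qed.

Lemma continuous_enormP (f : 'rV[R]_n -> R) x :
  {for x, continuous f} <->
  forall e, 0 < e -> exists2 d, 0 < d & forall y, enorm (y - x) < d -> `|f y - f x| < e.
Proof.
split=> [fx e e0|fx].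
  have /fx/nbhs_enormP[d d0 dA] := nbhsx_ballx (f x) _ e0.
  by exists d => // y /dA; rewrite /ball/= distrC.
move=> A /nbhs_ballP[e /= e0 eA].
have [d d0 dA] := fx e e0; apply/nbhs_enormP; exists d => // y yd.
by apply: eA; rewrite /ball/= distrC; exact: dA.
Qed.

Lemma continuous_rV_enormP m (f : 'rV[R]_n -> 'rV[R]_m) x :
  (forall e, 0 < e -> exists2 d, 0 < d & forall y, enorm (y - x) < d -> enorm (f y - f x) < e) ->
  {for x, continuous f}.
Proof.
move=> fx A /nbhs_ballP[e /= e0 eA].
have [d d0 dA] := fx e e0; apply/nbhs_enormP; exists d => // y yd.
apply: eA; rewrite mx_norm_ball /ball_ /= -normrN opprB.
exact: (le_lt_trans (mxnorm_le_enorm _) (dA _ yd)).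
Qed.

Lemma enorm_continuous : continuous (fun u => enorm u : R).
Proof.
move=> x; apply/continuous_enormP => e e0; exists e => // y yx.
rewrite ltr_norml (le_lt_trans (enorm_lerB _ _) yx) andbT ltrNl opprB.
by rewrite (le_lt_trans (enorm_lerB _ _))// enormBC.
Qed.

Lemma enormB_continuous x : continuous (fun u => enorm (u - x) : R).
Proof.
move=> u; apply/continuous_enormP => e e0; exists e => // y yu.
rewrite ltr_norml ltrNl opprB; apply/andP; split.
  by rewrite (le_lt_trans (enorm_lerB _ _))// opprB addrA subrK enormBC.
by rewrite (le_lt_trans (enorm_lerB _ _))// opprB addrA subrK.
Qed.

Lemma coord_cont i : continuous (fun u => u 0 i : R).
Proof. exact: coord_continuous. Qed.

Lemma closed_cb x r : closed (cb x r).
Proof.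
rewrite (_ : cb x r = ~` [set y | r < enorm (y - x)]); last first.
  by apply/seteqP; split=> y /=; rewrite /cb/= leNgt => /negP.
apply: open_closedC; rewrite openE => y /= ry; apply/nbhs_enormP.
exists (enorm (y - x) - r); first by rewrite subr_gt0.
move=> z; rewrite /eb/= enormBC ltrBrDl -ltrBrDr => h; apply: (lt_le_trans h).
by have := enorm_tri z y x; rewrite (enormBC x y) (enormBC z y); lra.
Qed.

Lemma compact_cb x r : compact (cb x r).
Proof.
apply: bounded_closed_compact; last exact: closed_cb.
exists (r + enorm x); split; first exact: num_real.
move=> M hM y yr; apply: le_trans (ltW hM); apply: (le_trans (mxnorm_le_enorm _)).
by rewrite -lerBlDr (le_trans (enorm_lerB _ _)).
Qed.

Lemma cb_interior x r y : enorm (y - x) < r -> nbhs y (cb x r).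
Proof.
move=> yr; apply/nbhs_enormP; exists (r - enorm (y - x)); first by rewrite subr_gt0.
move=> z; rewrite /eb/cb/= => zy.
by rewrite (le_trans (enorm_tri y z x))// -lerBrDr ltW.
Qed.

Lemma seg_enorm x y t : 0 <= t -> t <= 1 ->
  enorm (x + t *: (y - x)) <= Num.max (enorm x) (enorm y).
Proof.
move=> t0 t1; rewrite (_ : x + _ = (1 - t) *: x + t *: y); last first.
  by rewrite scalerBl scale1r scalerBr addrA addrAC.
apply: (le_trans (enormD _ _)); rewrite !enormZ !ger0_norm ?subr_ge0//.
have hx : enorm x <= Num.max (enorm x) (enorm y) by rewrite le_max lexx.
have hy : enorm y <= Num.max (enorm x) (enorm y) by rewrite le_max lexx orbT.
nra.
Qed.

Lemma seg_in_cb p r x y t : cb p r x -> cb p r y -> 0 <= t -> t <= 1 ->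
  cb p r (x + t *: (y - x)).
Proof.
rewrite /cb/= => xp yp t0 t1; have := seg_enorm (x - p) (y - p) t0 t1.
rewrite (_ : y - p - (x - p) = y - x); last by rewrite opprB addrA subrK.
by rewrite addrAC => /le_trans; apply; rewrite ge_max xp yp.
Qed.

Lemma seg_in_eb p r x y t : eb p r x -> eb p r y -> 0 <= t -> t <= 1 ->
  eb p r (x + t *: (y - x)).
Proof.
rewrite /eb/= => xp yp t0 t1; have := seg_enorm (x - p) (y - p) t0 t1.
rewrite (_ : y - p - (x - p) = y - x); last by rewrite opprB addrA subrK.
by rewrite addrAC => /le_lt_trans; apply; rewrite gt_max xp yp.
Qed.

Lemma seg_continuous x v : continuous (fun t : R => x + t *: v).
Proof.
move=> t; apply: cvgD; first exact: cvg_cst.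
exact: scalel_continuous.
Qed.

Lemma eball_eb : @eball R n = eb 0 1.
Proof. by apply/seteqP; split=> x; rewrite /eball/eb/= subr0. Qed.

Lemma open_eball : open (@eball R n).
Proof. by rewrite eball_eb; exact: open_eb. Qed.

End EuclidTopology.

(** * Differential calculus *)

Section calculus.
Context {R : realType}.

(** Linear approximation without quotients or punctured neighbourhoods: errors at several points can
    be added, and [t = 0] is no special case. *)
Lemma is_derive_epsP (V : normedModType R) (f : V -> R) x v (l : R) :
  is_derive x v f l <->
  forall e, 0 < e -> exists2 d, 0 < d &
    forall t : R, `|t| < d -> `|f (x + t *: v) - f x - t * l| <= e * `|t|.
Proof.
split=> [[df <-] e e0|H].
  move: df => /cvg_ex[m hm]; rewrite /derive (cvg_lim _ hm)//.
  move/cvgrPdist_lt : hm => /(_ e e0); rewrite near_withinE => /nbhs_ballP[d /= d0 dA].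
  exists d => // t td; have [->|t0] := eqVneq t 0.
    by rewrite scale0r addr0 subrr mul0r subrr normr0 mulr0.
  have /dA/(_ t0) : ball 0 d t by rewrite /ball/= sub0r normrN.
  rewrite /= /GRing.scale/= => /ltW h.
  have -> : f (x + t *: v) - f x - t * m = t * (t^-1 * (f (t *: v + x) - f x) - m).
    by rewrite mulrBr mulrA mulfV// mul1r (addrC x).
  by rewrite normrM mulrC ler_wpM2r// distrC.
have hc : (h^-1 *: (f (h *: v + x) - f x) : R) @[h --> (0 : R)^'] --> (l : R).
  apply/cvgrPdist_le => e e0; have [d d0 dA] := H e e0.
  rewrite near_withinE; apply/nbhs_ballP; exists d => // t /=.
  rewrite /ball/= sub0r normrN => td t0; have := dA t td.
  rewrite /GRing.scale/= [x + _]addrC => h.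
  have tp : 0 < `|t| by rewrite normr_gt0.
  rewrite -(ler_pM2r tp) -normrM (le_trans _ h)// -normrN.
  by rewrite -mulNr opprB mulrBl mulrAC mulVf// mul1r (mulrC t).
by apply: DeriveDef; [apply/cvg_ex; exists l|apply: cvg_lim hc].
Qed.

Lemma is_derive_unique (V : normedModType R) (f : V -> R) x v (l l' : R) :
  is_derive x v f l -> is_derive x v f l' -> l = l'.
Proof. by move=> [_ <-] [_ <-]. Qed.

Lemma is_derive_line (V : normedModType R) (f : V -> R) x v (t l : R) :
  is_derive (x + t *: v) v f l <-> is_derive t 1 (fun s : R => f (x + s *: v)) l.
Proof.
split=> /is_derive_epsP H; apply/is_derive_epsP => e e0;
  have [d d0 dA] := H e e0; exists d => // s sd; have := dA s sd.
  by rewrite [s *: 1]mulr1 scalerDl addrA.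
by rewrite [s *: 1]mulr1 scalerDl addrA.
Qed.

Lemma is_derive_along (V : normedModType R) (f : V -> R) x v (t l : R) :
  is_derive (x + t *: v) v f l -> is_derive t 1 (fun s : R => f (x + s *: v)) l.
Proof. by move/is_derive_line. Qed.

Lemma is_derive_continuous (f : R -> R) (x l : R) : is_derive x 1 f l -> {for x, continuous f}.
Proof. by move=> [/derivable1_diffP/differentiable_continuous]. Qed.

Lemma is_derive_mulr (t c : R) : is_derive t 1 (fun s : R => s * c) c.
Proof.
apply/is_derive_epsP => e e0; exists 1 => // s _.
by rewrite [s *: 1]mulr1 mulrDl [X in X - _]addrAC subrr add0r subrr normr0 mulr_ge0// ltW.
Qed.

Section der1.
Implicit Types (f g : R -> R) (t c l m : R).

Lemma der_cst t c : is_derive t 1 (fun _ : R => c) 0.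
Proof. exact: is_derive_cst. Qed.

Lemma der_id t : is_derive t 1 (fun s : R => s) 1.
Proof. exact: is_derive_id. Qed.

Lemma derD f g t l m : is_derive t 1 f l -> is_derive t 1 g m ->
  is_derive t 1 (fun s => f s + g s) (l + m).
Proof. by move=> ? ?; exact: is_deriveD. Qed.

Lemma derB f g t l m : is_derive t 1 f l -> is_derive t 1 g m ->
  is_derive t 1 (fun s => f s - g s) (l - m).
Proof. by move=> ? ?; exact: is_deriveB. Qed.

Lemma derN f t l : is_derive t 1 f l -> is_derive t 1 (fun s => - f s) (- l).
Proof. by move=> ?; exact: is_deriveN. Qed.

Lemma derM f g t l m : is_derive t 1 f l -> is_derive t 1 g m ->
  is_derive t 1 (fun s => f s * g s) (l * g t + f t * m).
Proof.
move=> df dg; have dfg := @is_deriveM _ _ f g t 1 l m df dg.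
by apply: (is_derive_eq dfg); rewrite /GRing.scale/= addrC (mulrC l).
Qed.

Lemma derZ f t l c : is_derive t 1 f l -> is_derive t 1 (fun s => c * f s) (c * l).
Proof.
move=> df; apply: (is_derive_eq (derM (der_cst t c) df)).
by rewrite mul0r add0r.
Qed.

Lemma derV f t l : f t != 0 -> is_derive t 1 f l ->
  is_derive t 1 (fun s => (f s)^-1) (- (l / f t ^+ 2)).
Proof.
move=> ft0 [df dl]; apply: DeriveDef; first exact: derivableV.
by rewrite deriveV// dl [LHS]mulrC mulrN.
Qed.

Lemma der_comp f g t l m : is_derive t 1 g m -> is_derive (g t) 1 f l ->
  is_derive t 1 (fun s => f (g s)) (l * m).
Proof. by move=> dg df; exact: (@is_derive1_comp _ f g). Qed.

Lemma der_eq f t l m : is_derive t 1 f l -> l = m -> is_derive t 1 f m.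
Proof. by move=> d <-. Qed.

Lemma der_ext f g t l : (\forall s \near t, f s = g s) -> is_derive t 1 f l -> is_derive t 1 g l.
Proof.
move=> /nbhs_ballP[r /= r0 fg] /is_derive_epsP H; apply/is_derive_epsP => e e0.
have [d d0 dA] := H e e0; exists (Num.min d r); first by rewrite lt_min d0.
move=> s; rewrite lt_min => /andP[sd sr]; rewrite -!fg ?dA//.
  exact: ballxx.
by rewrite /ball/= [s *: 1]mulr1 opprD addrA subrr sub0r normrN.
Qed.

End der1.

Lemma continuous_realP (f : R -> R) (x : R) : {for x, continuous f} ->
  forall e, 0 < e -> exists2 d, 0 < d & forall y, `|y - x| < d -> `|f y - f x| < e.
Proof.
move=> fx e e0; have /fx/nbhs_ballP[d /= d0 dA] := nbhsx_ballx (f x) _ e0.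
by exists d => // y yd; rewrite distrC; apply: dA; rewrite /ball/= distrC.
Qed.

Lemma mvt_le (f df : R -> R) (a b M : R) : a <= b ->
  (forall t : R, a <= t <= b -> {for t, continuous f}) ->
  (forall t : R, a < t < b -> is_derive t 1 f (df t)) ->
  (forall t : R, a < t < b -> `|df t| <= M) ->
  `|f b - f a| <= M * (b - a).
Proof.
move=> ab cf fd dM; move: ab; rewrite le_eqVlt => /predU1P[->|ab].
  by rewrite !subrr normr0 mulr0.
have cf' : {within `[a, b], continuous f}.
  by apply: continuous_in_subspaceT => t; rewrite inE/= in_itv/=; exact: cf.
have fd' t : t \in `]a, b[%R -> is_derive t 1 f (df t) by rewrite in_itv/=; exact: fd.
have [c] := MVT ab fd' cf'; rewrite in_itv/= => cab ->.
by rewrite normrM (gtr0_norm (_ : 0 < b - a)) ?subr_gt0// ler_pM2r ?subr_gt0// dM.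
Qed.

End calculus.

(** * Functions with continuous partial derivatives *)

Section C1.
Context {R : realType} {n : nat}.
Implicit Types (u h : 'rV[R]_n -> R) (x y v : 'rV[R]_n).

Definition C1on (Omega : set 'rV[R]_n) u := forall x, Omega x ->
  {for x, continuous u} /\
  forall i, derivable u x 'e_i /\ {for x, continuous (partial i u)}.

Lemma is_derive_partial u x i : derivable u x 'e_i -> is_derive x 'e_i u (partial i u x).
Proof. by move=> du; apply: DeriveDef. Qed.

(* Telescoping along the coordinate axes. *)
Lemma C1_is_derive (Omega : set 'rV[R]_n) u x v : open Omega -> C1on Omega u -> Omega x ->
  is_derive x v u (\sum_i v 0 i * partial i u x).
Proof.
move=> oO Cu Ox.
(* The path from [x] to [x + t v] changes one coordinate at a time; the induction treats the first
   [k] of them. *)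
pose trunc k : 'rV[R]_n := \row_i (if (i < k)%N then v 0 i else 0).
suff H k : (k <= n)%N ->
    is_derive x (trunc k) u (\sum_(i < n | (i < k)%N) v 0 i * partial i u x).
  have := H n (leqnn n); rewrite (_ : trunc n = v).
    by rewrite (eq_bigl xpredT)// => i; rewrite ltn_ord.
  by apply/rowP => i; rewrite mxE ltn_ord.
elim: k => [_|k IH kn].
  rewrite big_pred0// (_ : trunc 0 = 0); last by apply/rowP => i; rewrite !mxE.
  exact: is_derive0.
have := IH (ltnW kn) => /is_derive_epsP IHe.
apply/is_derive_epsP => e e0.
pose j := Ordinal kn; pose a := v 0 j.
have truncS : trunc k.+1 = trunc k + a *: 'e_j.
  apply/rowP => i; rewrite !mxE eqxx /= ltnS leq_eqVlt.
  have [->|ij] := eqVneq i j; first by rewrite eqxx/= ltnn add0r mulr1.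
  rewrite mulr0 addr0 (_ : (i == k :> nat) = false)//.
  by apply/negbTE; apply: contra ij => /eqP ik; apply/eqP/val_inj.
have sumS : \sum_(i < n | (i < k.+1)%N) v 0 i * partial i u x =
    \sum_(i < n | (i < k)%N) v 0 i * partial i u x + a * partial j u x.
  rewrite (bigD1 j)//= addrC; congr (_ + _); apply: eq_bigl => i.
  rewrite ltnS leq_eqVlt andb_orl; have [ij|ij] := eqVneq i j.
    by rewrite ij /= ltnn !andbF.
  by rewrite !andbT (_ : (i == k :> nat) = false)//; apply/negbTE;
     apply: contra ij => /eqP ik; apply/eqP/val_inj.
have e2 : 0 < e / 2 by rewrite divr_gt0.
have [d1 d10 H1] := IHe _ e2.
have a1 : 0 < `|a| + 1 by rewrite ltr_wpDl.
have /(continuous_enormP) /(_ (e / 2 / (`|a| + 1)) (divr_gt0 e2 a1))[d2 d20 H2] :=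
  (((Cu x Ox).2 j).2).
have /nbhs_enormP[d3 d30 H3] : nbhs x Omega by exact: open_nbhs_nbhs.
pose b := enorm (trunc k) + `|a| + 1.
have b0 : 0 < b by rewrite ltr_wpDl// addr_ge0// enorm_ge0.
exists (Num.min d1 (Num.min d2 d3 / b)).
  by rewrite lt_min d10 divr_gt0// lt_min d20.
move=> t; rewrite lt_min => /andP[td1]; rewrite ltr_pdivlMr// lt_min => /andP[td2 td3].
have near (s : R) : `|s| <= `|t * a| -> enorm (x + t *: trunc k + s *: 'e_j - x) < Num.min d2 d3.
  move=> st; rewrite addrAC [x + _]addrC addrK.
  apply: (le_lt_trans (enormD _ _)); rewrite !enormZ enorm_delta mulr1.
  apply: (le_lt_trans (lerD (lexx _) st)); rewrite normrM -mulrDr.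
  apply: (@le_lt_trans _ _ (`|t| * b)); last by rewrite lt_min td2.
  by rewrite ler_wpM2l// lerDl.
have nO (s : R) : `|s| <= `|t * a| -> Omega (x + t *: trunc k + s *: 'e_j).
  by move=> /near; rewrite lt_min => /andP[_ h]; exact: H3.
have nP (s : R) : `|s| <= `|t * a| ->
    `|partial j u (x + t *: trunc k + s *: 'e_j) - partial j u x| <= e / 2 / (`|a| + 1).
  by move=> /near; rewrite lt_min => /andP[h _]; rewrite ltW// H2.
rewrite truncS sumS scalerDr scalerA addrA.
set y := x + t *: trunc k.
rewrite (_ : _ - _ - _ = (u y - u x - t * \sum_(i < n | (i < k)%N) v 0 i * partial i u x)
    + (u (y + (t * a) *: 'e_j) - u y - t * a * partial j u x)); last first.
  rewrite mulrDr; ring.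
apply: (le_trans (ler_normD _ _)).
rewrite (splitr e) mulrDl lerD//; first exact: H1.
(* With the linear part removed, the derivative of [g] is small by continuity of the partial
   derivative, and the mean value theorem bounds the increment. *)
pose g s := u (y + s *: 'e_j) - s * partial j u x.
have gd (s : R) : `|s| <= `|t * a| ->
    is_derive s 1 g (partial j u (y + s *: 'e_j) - partial j u x).
  move=> /nO Os; rewrite /g; apply: is_deriveB.
    apply: (@is_derive_along _ _ u y 'e_j s).
    exact: (is_derive_partial ((Cu _ Os).2 j).1).
  exact: is_derive_mulr.
have mv (p q : R) : p <= q -> `|p| <= `|t * a| -> `|q| <= `|t * a| ->
   `|g q - g p| <= e / 2 / (`|a| + 1) * (q - p).
  move=> pq pt qt.
  have inb (s : R) : p <= s <= q -> `|s| <= `|t * a|.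
    rewrite ler_norml => /andP[ps sq].
    move: pt qt; rewrite !ler_norml => /andP[p1 p2] /andP[q1 q2].
    by rewrite (le_trans p1)//= (le_trans sq).
  have inb' (s : R) : p < s < q -> `|s| <= `|t * a|.
    by move=> /andP[h1 h2]; apply: inb; rewrite !ltW.
  apply: (mvt_le (df := fun s : R => partial j u (y + s *: 'e_j) - partial j u x)) => //.
  - by move=> s /inb/gd/is_derive_continuous.
  - by move=> s /inb'/gd.
  - by move=> s /inb'/nP.
have -> : u (y + (t * a) *: 'e_j) - u y - t * a * partial j u x = g (t * a) - g 0.
  by rewrite /g scale0r addr0 mul0r subr0 addrAC.
have fin (c : R) : 0 <= c -> c = `|t * a| -> e / 2 / (`|a| + 1) * c <= e / 2 * `|t|.
  move=> c0 ->; rewrite normrM -mulrA ler_pM2l//.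
  by rewrite mulrC ler_pdivrMr// mulrDr mulr1 lerDl.
have [ta|ta] := leP 0 (t * a).
  apply: (le_trans (mv 0 (t * a) ta _ _)) => //; first by rewrite normr0.
  by rewrite subr0 fin// ger0_norm.
rewrite distrC; apply: (le_trans (mv (t * a) 0 (ltW ta) _ _)) => //; first by rewrite normr0.
by rewrite sub0r fin ?ltr0_norm// oppr_ge0 ltW.
Qed.

Lemma C1_seg_le (Omega : set 'rV[R]_n) u x y (M : R) : open Omega -> C1on Omega u ->
  (forall t : R, 0 <= t <= 1 -> Omega (x + t *: (y - x))) ->
  (forall t : R, 0 <= t <= 1 -> forall i, `|partial i u (x + t *: (y - x))| <= M) ->
  `|u y - u x| <= n%:R * M * enorm (y - x).
Proof.
move=> oO Cu sO sM.
pose g (t : R) := u (x + t *: (y - x)).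
have gd (t : R) : 0 <= t <= 1 -> is_derive t 1 g
    (\sum_i (y - x) 0 i * partial i u (x + t *: (y - x))).
  move=> /sO Ot; apply: (@is_derive_along _ _ u x (y - x) t).
  exact: (C1_is_derive (y - x) oO Cu Ot).
have -> : u y - u x = g 1 - g 0.
  by rewrite /g scale1r scale0r addr0 [x + _]addrC subrK.
have := @mvt_le R g (fun t : R => \sum_i (y - x) 0 i * partial i u (x + t *: (y - x)))
  0 1 (n%:R * M * enorm (y - x)) ler01.
rewrite subr0 mulr1; apply.
- by move=> t /gd/is_derive_continuous.
- by move=> t /andP[t0 t1]; apply: gd; rewrite !ltW.
move=> t /andP[t0 t1].
apply: (le_trans (ler_norm_sum _ _ _)).
have M0 : forall i : 'I_n, 0 <= M.
  by move=> i; apply: (le_trans _ (sM t _ i)) => //; rewrite !ltW.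
apply: (@le_trans _ _ (\sum_(i < n) M * enorm (y - x))).
  apply: ler_sum => i _; rewrite normrM mulrC ler_pM ?coord_le_enorm//.
  by apply: sM; rewrite !ltW.
by rewrite sumr_const card_ord -[leLHS]mulr_natl mulrA.
Qed.

End C1.

(** * Laplacian and maximum principle *)

Section laplacian.
Context {R : realType} {n : nat}.
Implicit Types (u w h : 'rV[R]_n -> R) (x y z : 'rV[R]_n) (a b c L : R).

(* Second derivatives are relations, which need neither C^2 hypotheses nor the values of
   iterated partial derivatives near [x]. *)
Definition axis2 w x (i : 'I_n) a := exists phi : R -> R,
  (exists2 r : R, 0 < r & forall t : R, `|t| < r ->
     is_derive t 1 (fun s : R => w (x + s *: 'e_i)) (phi t)) /\
  is_derive (0 : R) 1 phi a.

Definition lap w x L := exists2 a : 'I_n -> R,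
  (forall i, axis2 w x i (a i)) & L = \sum_i a i.

(** The first derivative vanishes at the maximum. If [a] were positive, it would be positive just to
    the right, and the mean value theorem would give a larger value of [w]. *)
Lemma axis2_max w x i a r : 0 < r ->
  (forall t : R, `|t| < r -> w (x + t *: 'e_i) <= w x) -> axis2 w x i a -> a <= 0.
Proof.
move=> r0 wmax [phi [[r' r'0 dphi] /is_derive_epsP da]].
pose F (s : R) := w (x + s *: 'e_i).
have F0 : F 0 = w x by rewrite /F scale0r addr0.
have Fmax t : `|t| < r -> F t <= F 0 by rewrite F0; exact: wmax.
have phi0 : phi 0 = 0.
  have /is_derive_epsP dF : is_derive (0 : R) 1 F (phi 0).
    by apply: dphi; rewrite normr0.
  apply/eqP/negPn/negP => p0.
  have e0 : 0 < `|phi 0| / 2 by rewrite divr_gt0// normr_gt0.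
  have [d d0 dA] := dF _ e0.
  (* A small step in the direction in which [F] increases. *)
  pose t := Num.sg (phi 0) * (Num.min d r / 2).
  have m0 : 0 < Num.min d r by rewrite lt_min d0.
  have tE : `|t| = Num.min d r / 2.
    by rewrite /t normrM normr_sg p0 mul1r gtr0_norm// divr_gt0.
  have tm : `|t| < Num.min d r by rewrite tE; lra.
  move: tm; rewrite lt_min => /andP[td tr].
  have := dA t td; have := Fmax t tr.
  rewrite add0r [t *: 1]mulr1 => h1.
  have : t * phi 0 = `|t| * `|phi 0|.
    by rewrite tE /t normrEsg; ring.
  rewrite ler_norml => -> /andP[h2 _].
  have : 0 < `|t| * `|phi 0| by rewrite tE mulr_gt0 ?normr_gt0// divr_gt0.
  move: h1 h2; lra.
rewrite leNgt; apply/negP => a0.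
have [d d0 dA] := da _ (divr_gt0 a0 (ltr0n R 2)).
have m0 : 0 < Num.min d (Num.min r r') by rewrite !lt_min d0 r0.
pose t := Num.min d (Num.min r r') / 2.
have t0 : 0 < t by rewrite divr_gt0.
have : t < Num.min d (Num.min r r') by rewrite /t; lra.
rewrite !lt_min => /and3P[td tr tr'].
have dF s : s \in `]0, t[%R -> is_derive s 1 F (phi s).
  rewrite in_itv/= => /andP[s0 st]; apply: dphi.
  by rewrite gtr0_norm// (lt_trans st).
have cF : {within `[0, t], continuous F}.
  apply: continuous_in_subspaceT => s; rewrite inE/= in_itv/= => /andP[s0 st].
  by apply: (@is_derive_continuous _ _ _ (phi s)); apply: dphi; rewrite ger0_norm// (le_lt_trans st).
have [c] := MVT t0 dF cF; rewrite in_itv/= subr0 => /andP[c0 ct] FE.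
have cd : `|c| < d by rewrite gtr0_norm// (lt_trans ct).
have := dA c cd; rewrite add0r [c *: 1]mulr1 phi0 subr0 (gtr0_norm c0) ler_norml => /andP[h _].
have := Fmax t; rewrite gtr0_norm// => /(_ tr); rewrite -subr_le0 FE.
rewrite leNgt => /negP; apply; rewrite mulr_gt0//.
have : 0 < c * a by rewrite mulr_gt0.
by move: h; rewrite mulrAC; lra.
Qed.

Lemma axis2_cst c x i : axis2 (fun=> c) x i 0.
Proof.
exists (fun=> 0); split; last exact: der_cst.
by exists 1 => // t _; exact: der_cst.
Qed.

Lemma axis2D u w x i a b : axis2 u x i a -> axis2 w x i b ->
  axis2 (fun y => u y + w y) x i (a + b).
Proof.
move=> [f [[r r0 df] da]] [g [[s s0 dg] db]].
exists (fun t => f t + g t); split; last exact: derD.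
exists (Num.min r s); first by rewrite lt_min r0.
by move=> t; rewrite lt_min => /andP[tr ts]; apply: derD; [exact: df|exact: dg].
Qed.

Lemma axis2Z c u x i a : axis2 u x i a -> axis2 (fun y => c * u y) x i (c * a).
Proof.
move=> [f [[r r0 df] da]]; exists (fun t => c * f t); split; last exact: derZ.
by exists r => // t tr; apply: derZ; exact: df.
Qed.

Lemma lap_cst c x : lap (fun=> c) x 0.
Proof. by exists (fun=> 0) => [i|]; [exact: axis2_cst|rewrite big1]. Qed.

Lemma lapD u w x L L' : lap u x L -> lap w x L' -> lap (fun y => u y + w y) x (L + L').
Proof.
move=> [a ha ->] [b hb ->]; exists (fun i => a i + b i); first by move=> i; exact: axis2D.
by rewrite big_split.
Qed.

Lemma lapZ c u x L : lap u x L -> lap (fun y => c * u y) x (c * L).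
Proof.
move=> [a ha ->]; exists (fun i => c * a i); first by move=> i; exact: axis2Z.
by rewrite mulr_sumr.
Qed.

Lemma lap_ext u w x L : (forall y, u y = w y) -> lap u x L -> lap w x L.
Proof. by move=> /funext ->. Qed.

Lemma lapN u x L : lap u x L -> lap (fun y => - u y) x (- L).
Proof.
move=> /(lapZ (-1)); rewrite mulN1r; apply: lap_ext => y; exact: mulN1r.
Qed.

Lemma lapB u w x L L' : lap u x L -> lap w x L' -> lap (fun y => u y - w y) x (L - L').
Proof. by move=> hu /lapN; exact: lapD. Qed.

(** Radial functions are written in the squared distance, which is a quadratic polynomial along each
    axis: no square root is differentiated and the centre is not exceptional. *)
Lemma axis2_sqn (psi dpsi : R -> R) x y i ddpsi r : 0 < r ->
  (forall s : R, `|s - enorm (x - y) ^+ 2| < r -> is_derive s 1 psi (dpsi s)) ->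
  is_derive (enorm (x - y) ^+ 2) 1 dpsi ddpsi ->
  axis2 (fun z => psi (enorm (z - y) ^+ 2)) x i
    (ddpsi * (2 * (x - y) 0 i) ^+ 2 + 2 * dpsi (enorm (x - y) ^+ 2)).
Proof.
move=> r0 d1 d2; set s0 := enorm (x - y) ^+ 2 in d1 d2 *; set b := (x - y) 0 i.
pose q (t : R) := s0 + t * (2 * b) + t * t.
have qE t : enorm (x + t *: 'e_i - y) ^+ 2 = q t.
  rewrite addrAC sqr_enormD dotZr delta_dot enormZ enorm_delta mulr1 real_normK ?num_real//.
  by rewrite /q -/s0 -/b; ring.
have q0 : q 0 = s0 by rewrite /q !mul0r !addr0.
have dq (t : R) : is_derive t 1 q (2 * b + 2 * t).
  apply: (@der_eq _ _ _ (0 + 2 * b + (1 * t + t * 1))); last by ring.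
  exact (derD (derD (der_cst t s0) (is_derive_mulr t (2 * b))) (derM (der_id t) (der_id t))).
exists (fun t => dpsi (q t) * (2 * b + 2 * t)); split.
  have /continuous_realP : {for (0 : R), continuous q} by exact: is_derive_continuous (dq 0).
  move=> /(_ r r0)[d d0 dA]; exists d => // t td.
  have -> : (fun s : R => psi (enorm (x + s *: 'e_i - y) ^+ 2)) = (fun s => psi (q s)).
    by apply/funext => s; rewrite qE.
  have d1' : is_derive (q t) 1 psi (dpsi (q t)) by apply: d1; rewrite -q0 dA// subr0.
  exact (der_comp (dq t) d1').
apply: (@der_eq _ _ _ (ddpsi * (2 * b + 2 * 0) * (2 * b + 2 * 0) + dpsi (q 0) * (0 + 2 * 1))).
  have d2' : is_derive (q 0) 1 dpsi ddpsi by rewrite q0.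
  exact (derM (der_comp (dq 0) d2') (derD (der_cst 0 (2 * b)) (derZ 2 (der_id 0)))).
by rewrite q0; ring.
Qed.

Lemma lap_sqn (psi dpsi : R -> R) x y ddpsi r : 0 < r ->
  (forall s : R, `|s - enorm (x - y) ^+ 2| < r -> is_derive s 1 psi (dpsi s)) ->
  is_derive (enorm (x - y) ^+ 2) 1 dpsi ddpsi ->
  lap (fun z => psi (enorm (z - y) ^+ 2)) x
    (4 * enorm (x - y) ^+ 2 * ddpsi + 2 * n%:R * dpsi (enorm (x - y) ^+ 2)).
Proof.
move=> r0 d1 d2; eexists; first by move=> i; apply: (axis2_sqn i r0 d1 d2).
rewrite big_split/= sumr_const card_ord -mulr_sumr -[X in _ = _ + X]mulr_natl.
rewrite (eq_bigr (fun i => 4 * ((x - y) 0 i * (x - y) 0 i))); last by move=> i _; ring.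
by rewrite -mulr_sumr -/(dot _ _) -sqr_enorm; ring.
Qed.

Lemma lap_coord (psi dpsi : R -> R) x y i ddpsi :
  (forall s : R, is_derive s 1 psi (dpsi s)) ->
  is_derive ((x - y) 0 i) 1 dpsi ddpsi ->
  lap (fun z => psi ((z - y) 0 i)) x ddpsi.
Proof.
move=> d1 d2; exists (fun k => if k == i then ddpsi else 0); last first.
  by rewrite (bigD1 i)//= eqxx big1 ?addr0// => k /negbTE ->.
move=> k; have [->|ki] := eqVneq k i.
  pose q (t : R) := (x - y) 0 i + t.
  have qE t : (x + t *: 'e_i - y) 0 i = q t by rewrite /q addrAC !mxE !eqxx mulr1.
  have dq (t : R) : is_derive t 1 q 1.
    by have := derD (der_cst t ((x - y) 0 i)) (der_id t); rewrite add0r.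
  exists (fun t => dpsi (q t) * 1); split.
    exists 1 => // t _.
    have -> : (fun s : R => psi ((x + s *: 'e_i - y) 0 i)) = (fun s => psi (q s)).
      by apply/funext => s; rewrite qE.
    exact (der_comp (dq t) (d1 (q t))).
  apply: (@der_eq _ _ _ ((ddpsi * 1) * 1 + dpsi (q 0) * 0)); last by ring.
  have d2' : is_derive (q 0) 1 dpsi ddpsi by rewrite /q addr0.
  exact (derM (der_comp (dq 0) d2') (der_cst 0 1)).
exists (fun=> 0); split; last exact: der_cst.
exists 1 => // t _.
have -> : (fun s : R => psi ((x + s *: 'e_k - y) 0 i)) = (fun=> psi ((x - y) 0 i)).
  by apply/funext => s; rewrite addrAC !mxE eqxx (negbTE (_ : i != k)) ?mulr0 ?addr0// eq_sym.
exact: der_cst.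
Qed.

Lemma axis2_derive u x i a : axis2 u x i a -> derivable u x 'e_i ->
  exists phi : R -> R, [/\ (exists2 r : R, 0 < r & forall t : R, `|t| < r ->
     is_derive t 1 (fun s : R => u (x + s *: 'e_i)) (phi t)),
   is_derive (0 : R) 1 phi a & phi 0 = partial i u x].
Proof.
move=> [phi [[r r0 d1] d2]] du; exists phi; split => //; first by exists r.
have h1 : is_derive (0 : R) 1 (fun s : R => u (x + s *: 'e_i)) (phi 0) by apply: d1; rewrite normr0.
apply: is_derive_unique h1 _; apply: (@is_derive_along _ _ u x 'e_i 0).
by rewrite scale0r addr0; exact: is_derive_partial.
Qed.

Lemma lap_sqr u x L : (forall i, derivable u x 'e_i) -> lap u x L ->
  lap (fun y => u y ^+ 2) x (2 * \sum_i partial i u x ^+ 2 + 2 * u x * L).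
Proof.
move=> du [a ha ->]; exists (fun i => 2 * partial i u x ^+ 2 + 2 * u x * a i); last first.
  by rewrite big_split/= !mulr_sumr.
move=> i; have [phi [[r r0 d1] d2 p0]] := axis2_derive (ha i) (du i).
exists (fun t => phi t * u (x + t *: 'e_i) + u (x + t *: 'e_i) * phi t); split.
  by exists r => // t tr; apply: derM; exact: d1.
have d10 : is_derive (0 : R) 1 (fun s : R => u (x + s *: 'e_i)) (phi 0) by apply: d1; rewrite normr0.
apply: (der_eq (derD (derM d2 d10) (derM d10 d2))).
by rewrite /= scale0r addr0 p0; ring.
Qed.

(** A maximum point in the interior cannot have positive Laplacian, by [axis2_max] on every axis.
    The pointwise alternative lets each application name its own boundary; strict positivity is
    supplied by the barriers, so no perturbation is made here. *)
Theorem max_principle (C : set 'rV[R]_n) w : compact C -> {within C, continuous w} ->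
  (forall x, C x -> w x <= 0 \/ (nbhs x C /\ exists2 L, lap w x L & 0 < L)) ->
  forall x, C x -> w x <= 0.
Proof.
move=> cC cw H x Cx.
have [m] := compact_EVT_max (ex_intro _ x Cx) cC cw.
rewrite inE => Cm mmax.
have := mmax x; rewrite inE => /(_ Cx) wxm; apply: (le_trans wxm).
have [//|[/nbhs_enormP[r r0 rC] [L [a ha LE] L0]]] := H m Cm.
exfalso; have : L <= 0; last by rewrite leNgt L0.
rewrite LE; apply: sumr_le0 => i _; apply: axis2_max r0 _ (ha i) => t tr.
apply: mmax; rewrite inE; apply: rC.
by rewrite /eb/= addrAC subrr add0r enormZ enorm_delta mulr1.
Qed.

End laplacian.

Section continuity.
Context {R : realType} {n : nat}.
Implicit Types (u w h : 'rV[R]_n -> R) (x y z : 'rV[R]_n).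

Lemma cont_cst (c : R) x : {for x, continuous (fun=> c : R)}.
Proof. by apply/continuous_enormP => e e0; exists 1 => // y _; rewrite subrr normr0. Qed.

Lemma contD u w x : {for x, continuous u} -> {for x, continuous w} ->
  {for x, continuous (fun y => u y + w y)}.
Proof. by move=> cu cw; exact: continuousD. Qed.

Lemma contM u w x : {for x, continuous u} -> {for x, continuous w} ->
  {for x, continuous (fun y => u y * w y)}.
Proof. by move=> cu cw; exact: continuousM. Qed.

Lemma contN u x : {for x, continuous u} -> {for x, continuous (fun y => - u y)}.
Proof. by move=> cu; exact: continuousN. Qed.

Lemma contB u w x : {for x, continuous u} -> {for x, continuous w} ->
  {for x, continuous (fun y => u y - w y)}.
Proof. by move=> cu /contN; exact: contD. Qed.

Lemma contX u x k : {for x, continuous u} -> {for x, continuous (fun y => u y ^+ k)}.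
Proof.
move=> cu; elim: k => [|k IH]; first exact: cont_cst.
rewrite (_ : (fun _ => _) = (fun y => u y * u y ^+ k)); first exact: contM.
by apply/funext => y; rewrite exprS.
Qed.

Lemma cont_sum (I : finType) (F : I -> 'rV[R]_n -> R) x :
  (forall i, {for x, continuous (F i)}) -> {for x, continuous (fun y => \sum_i F i y)}.
Proof.
move=> cF; rewrite (_ : (fun _ => _) = \sum_i F i); last first.
  by apply/funext => y; rewrite fct_sumE.
elim/big_rec : _ => [|i g _ cg]; first exact: cont_cst.
exact: (contD (cF i) cg).
Qed.

Lemma cont_enormB x y : {for y, continuous (fun z => enorm (z - x) : R)}.
Proof. exact: enormB_continuous. Qed.

Lemma cont_coordB x y i : {for y, continuous (fun z => (z - x) 0 i : R)}.
Proof.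
have -> : (fun z => (z - x) 0 i) = (fun z => z 0 i - x 0 i) by apply/funext => z; rewrite !mxE.
by apply: contB; [exact: coord_cont|exact: cont_cst].
Qed.

Lemma cont_comp (g : R -> R) u x : {for u x, continuous g} -> {for x, continuous u} ->
  {for x, continuous (fun y => g (u y))}.
Proof. by move=> cg cu; exact: continuous_comp cu cg. Qed.

Lemma cont_near u w x : (\forall y \near x, u y = w y) -> {for x, continuous u} ->
  {for x, continuous w}.
Proof.
move=> /nbhs_enormP[r r0 uw] /continuous_enormP cu; apply/continuous_enormP => e e0.
have [d d0 dA] := cu e e0; exists (Num.min d r); first by rewrite lt_min d0.
move=> y; rewrite lt_min => /andP[yd yr].
have uy : u y = w y by apply: uw.
have ux : u x = w x by apply: uw; rewrite /eb/= subrr enorm0.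
by rewrite -uy -ux dA.
Qed.

Lemma within_cont (A : set 'rV[R]_n) u : (forall x, A x -> {for x, continuous u}) ->
  {within A, continuous u}.
Proof. by move=> H; apply: continuous_in_subspaceT => x; rewrite inE; exact: H. Qed.

Lemma open_within_cont (A : set 'rV[R]_n) u x : open A -> {within A, continuous u} -> A x ->
  {for x, continuous u}.
Proof.
move=> oA; rewrite (continuous_open_subspace u oA) => cu Ax.
by apply: cu; rewrite inE.
Qed.

End continuity.

(** * Gradient estimates for harmonic functions *)

Section harmonic.
Context {R : realType} {n : nat}.
Implicit Types (u w h : 'rV[R]_n -> R) (x y z : 'rV[R]_n) (Omega : set 'rV[R]_n).

Lemma C1on_intro Omega u (g : 'I_n -> 'rV[R]_n -> R) : open Omega ->
  (forall x, Omega x -> {for x, continuous u}) ->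
  (forall x, Omega x -> forall i, is_derive x 'e_i u (g i x) /\ {for x, continuous (g i)}) ->
  C1on Omega u /\ (forall x, Omega x -> forall i, partial i u x = g i x).
Proof.
move=> oO cu H.
have pE x : Omega x -> forall i, partial i u x = g i x.
  by move=> Ox i; have [[_ <-] _] := H x Ox i.
split => // x Ox; split; first exact: cu.
move=> i; have [[du _] cg] := H x Ox i; split => //.
apply: cont_near cg; apply: filterS (open_nbhs_nbhs (conj oO Ox)) => y Oy.
by rewrite pE.
Qed.

Lemma C1on_sub Omega Omega' u : Omega' `<=` Omega -> C1on Omega u -> C1on Omega' u.
Proof. by move=> OO Cu x /OO/Cu. Qed.

Lemma C1on_lin Omega u w (a b : R) : open Omega -> C1on Omega u -> C1on Omega w ->
  C1on Omega (fun y => a * u y + b * w y) /\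
  forall x, Omega x -> forall i,
    partial i (fun y => a * u y + b * w y) x = a * partial i u x + b * partial i w x.
Proof.
move=> oO Cu Cw; apply: C1on_intro => // x Ox.
  by apply: contD; apply: contM; [exact: cont_cst|exact: (Cu x Ox).1|exact: cont_cst|exact: (Cw x Ox).1].
move=> i; have [du cu] := (Cu x Ox).2 i; have [dw cw] := (Cw x Ox).2 i; split.
  apply: is_deriveD; apply: is_deriveZ; exact: is_derive_partial.
by apply: contD; apply: contM => //; exact: cont_cst.
Qed.

Lemma C1on_cst Omega (c : R) : open Omega -> C1on Omega (fun=> c).
Proof.
move=> oO; apply: (C1on_intro (g := fun _ _ => 0) oO _ _).1.
  by move=> x _; exact: cont_cst.
by move=> x _ i; split; [exact: is_derive_cst|exact: cont_cst].
Qed.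

(** Keeps from [harmonic_on] only what the maximum principle and the mean value estimates use, in a
    form stable under linear combinations, translations and restriction. *)
Definition harm Omega h := C1on Omega h /\ forall x, Omega x -> lap h x 0.

Lemma harmonic_on_harm Omega h : open Omega -> harmonic_on Omega h -> harm Omega h.
Proof.
move=> oO [[ch H] dh0].
have C1h : C1on Omega h.
  move=> x Ox; split; first exact: open_within_cont ch Ox.
  move=> i; have [d1 [c1 _]] := H i; split; first exact: d1.
  exact: open_within_cont c1 Ox.
split => // x Ox; exists (fun i => partial i (partial i h) x); last by rewrite dh0.
move=> i; exists (fun t => partial i h (x + t *: 'e_i)); split.
  have /nbhs_enormP[r r0 rO] : nbhs x Omega by exact: open_nbhs_nbhs.
  exists r => // t tr; apply: (@is_derive_along _ _ h x 'e_i t).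
  apply: is_derive_partial; apply: (H i).1; apply: rO.
  by rewrite /eb/= addrAC subrr add0r enormZ enorm_delta mulr1.
apply: (@is_derive_along _ _ (partial i h) x 'e_i 0).
rewrite scale0r addr0; apply: is_derive_partial.
by have [_ [_ H2]] := H i; exact: (H2 i).1.
Qed.

Lemma harm_sub Omega Omega' h : Omega' `<=` Omega -> harm Omega h -> harm Omega' h.
Proof. by move=> OO [Ch lh]; split; [exact: C1on_sub OO Ch|move=> x /OO/lh]. Qed.

Lemma harm_lin Omega u w (a b : R) : open Omega -> harm Omega u -> harm Omega w ->
  harm Omega (fun y => a * u y + b * w y) /\
  forall x, Omega x -> forall i,
    partial i (fun y => a * u y + b * w y) x = a * partial i u x + b * partial i w x.
Proof.
move=> oO [Cu lu] [Cw lw]; have [C pE] := C1on_lin a b oO Cu Cw; split => //; split => // x Ox.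
rewrite (_ : 0 = a * 0 + b * 0); last by rewrite !mulr0 addr0.
by apply: lapD; apply: lapZ; [exact: lu|exact: lw].
Qed.

Lemma harm_cst Omega (c : R) : open Omega -> harm Omega (fun=> c).
Proof. by move=> oO; split; [exact: C1on_cst|move=> x _; exact: lap_cst]. Qed.

Lemma partial_cst (c : R) i x : partial i (fun=> c) x = 0.
Proof. by rewrite /partial derive_cst. Qed.

Lemma harm_dot m Omega (f : 'rV[R]_n -> 'rV[R]_m) (xi : 'rV[R]_m) : open Omega ->
  (forall j, harm Omega (fun x => f x 0 j)) ->
  harm Omega (fun x => dot (f x) xi) /\
  forall x, Omega x -> forall i,
    partial i (fun x => dot (f x) xi) x = \sum_j partial i (fun y => f y 0 j) x * xi 0 j.
Proof.
move=> oO hf; rewrite /dot.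
suff H (s : seq 'I_m) : harm Omega (fun x => \sum_(j <- s) f x 0 j * xi 0 j) /\
  forall x, Omega x -> forall i,
    partial i (fun x => \sum_(j <- s) f x 0 j * xi 0 j) x =
    \sum_(j <- s) partial i (fun y => f y 0 j) x * xi 0 j by exact: H.
elim: s => [|j s [IH1 IH2]].
  rewrite (_ : (fun _ => _) = fun=> 0); last by apply/funext => x; rewrite big_nil.
  split; first exact: harm_cst.
  by move=> x _ i; rewrite big_nil partial_cst.
rewrite (_ : (fun _ => _) = fun x => xi 0 j * f x 0 j + 1 * \sum_(j <- s) f x 0 j * xi 0 j).
  have [h1 h2] := harm_lin (xi 0 j) 1 oO (hf j) IH1; split => //.
  by move=> x Ox i; rewrite h2// big_cons IH2// mul1r mulrC.
by apply/funext => x; rewrite big_cons mul1r mulrC.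
Qed.

Lemma harm_shift Omega h v : open Omega -> harm Omega h ->
  harm [set y | Omega (y + v)] (fun y => h (y + v)) /\
  forall y i, partial i (fun y => h (y + v)) y = partial i h (y + v).
Proof.
move=> oO [Ch lh].
have dE y i l : is_derive (y + v) 'e_i h l -> is_derive y 'e_i (fun y => h (y + v)) l.
  move=> /is_derive_epsP H; apply/is_derive_epsP => e e0.
  by have [d d0 dA] := H e e0; exists d => // t /dA; rewrite [y + v + _]addrAC.
have pE y i : partial i (fun y => h (y + v)) y = partial i h (y + v).
  rewrite /partial /derive.
  have -> : (fun y0 => h (y0 + v)) \o shift y = h \o shift (y + v) by apply/funext => z /=; rewrite addrA.
  by [].
split => //; split; last first.
  move=> x Ox; have [a ha La] := lh _ Ox; exists a => // i.
  have [phi [[r r0 d1] d2]] := ha i; exists phi; split => //; exists r => // t tr.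
  have := d1 t tr; congr (is_derive _ _ _ _).
  by apply/funext => s; rewrite addrAC.
have cs (u : 'rV[R]_n -> R) y : {for y + v, continuous u} -> {for y, continuous (fun y => u (y + v))}.
  move=> /continuous_enormP cu; apply/continuous_enormP => e e0; have [d d0 dA] := cu e e0.
  by exists d => // z zd; apply: dA; rewrite opprD addrACA subrr addr0.
move=> x Ox; have [c1 d1] := Ch _ Ox; split; first exact: cs.
move=> i; have [dh ch] := d1 i; split.
  by have [] := dE _ _ _ (is_derive_partial dh).
rewrite (_ : partial i _ = fun y => partial i h (y + v)); last by apply/funext => y; exact: pE.
exact: cs.
Qed.

(** Reflection in the hyperplane through [x] orthogonal to ['e_i]. *)
Definition refl x (i : 'I_n) y := y - (2 * (y - x) 0 i) *: 'e_i.

Lemma refl_sub x i y : refl x i y - x = (y - x) - (2 * (y - x) 0 i) *: 'e_i.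
Proof. by rewrite /refl addrAC. Qed.

Lemma enorm_refl x i y : enorm (refl x i y - x) = enorm (y - x).
Proof.
apply/eqP; rewrite -(eqrXn2 (_ : 0 < 2)%N) ?enorm_ge0//.
rewrite refl_sub sqr_enormB dotZr delta_dot enormZ enorm_delta mulr1 real_normK ?num_real//.
by apply/eqP; ring.
Qed.

Lemma refl_fix x i y : (y - x) 0 i = 0 -> refl x i y = y.
Proof. by rewrite /refl => ->; rewrite mulr0 scale0r subr0. Qed.

Lemma refl_axis x i (t : R) : refl x i (x + t *: 'e_i) = x - t *: 'e_i.
Proof.
rewrite /refl (_ : (x + t *: 'e_i - x) 0 i = t); last first.
  by rewrite addrAC subrr add0r !mxE !eqxx mulr1.
by apply/rowP => j; rewrite !mxE; ring.
Qed.

Lemma refl_step x i y k (t : R) :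
  refl x i (y + t *: 'e_k) = refl x i y + (if k == i then - t else t) *: 'e_k.
Proof.
rewrite /refl.
have -> : (y + t *: 'e_k - x) 0 i = (y - x) 0 i + (if k == i then t else 0).
  rewrite addrAC [LHS]mxE; congr (_ + _); rewrite !mxE eqxx /= eq_sym.
  by case: eqP; rewrite ?mulr1 ?mulr0.
case: eqP => [->|_]; last by rewrite addr0 addrAC.
by apply/rowP => j; rewrite !mxE; ring.
Qed.

(** The reflection reverses only the axis [i], and a second derivative does not see the reversal:
    the two signs cancel. *)
Lemma lap_refl x i h y L : lap h (refl x i y) L -> lap (fun z => h (refl x i z)) y L.
Proof.
move=> [a ha ->]; exists a => // k; have [phi [[r r0 d1] d2]] := ha k.
have [ki|ki] := eqVneq k i; last first.
  exists phi; split => //; exists r => // t tr.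
  have := d1 t tr; congr (is_derive _ _ _ _).
  by apply/funext => s; rewrite refl_step (negbTE ki).
have dN (t : R) : is_derive t 1 (fun s : R => - s) (- 1) by exact (derN (der_id t)).
exists (fun t => phi (- t) * -1); split; last first.
  apply: (@der_eq _ _ _ ((a k * -1) * -1 + phi (- 0) * 0)); last by ring.
  have d2' : is_derive (- 0 : R) 1 phi (a k) by rewrite oppr0.
  exact (derM (der_comp (dN 0) d2') (der_cst 0 (-1))).
exists r => // t tr.
have -> : (fun s : R => h (refl x i (y + s *: 'e_k))) =
    (fun s => (fun s => h (refl x i y + s *: 'e_k)) (- s)).
  by apply/funext => s; rewrite refl_step ki eqxx.
have d1' : is_derive (- t) 1 (fun s : R => h (refl x i y + s *: 'e_k)) (phi (- t)).
  by apply: d1; rewrite normrN.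
exact (der_comp (dN t) d1').
Qed.

Lemma cont_refl x i u y : {for refl x i y, continuous u} ->
  {for y, continuous (fun z => u (refl x i z))}.
Proof.
move=> /continuous_enormP cu; apply/continuous_enormP => e e0; have [d d0 dA] := cu e e0.
(* The crude bound |v - 2 v_i e_i| <= 3 |v| is enough for continuity. *)
exists (d / 3); first by rewrite divr_gt0.
move=> z zd; apply: dA.
have -> : refl x i z - refl x i y = (z - y) - (2 * (z - y) 0 i) *: 'e_i.
  rewrite /refl opprB addrACA [- _ + _ in X in _ + X]addrC -addrA addrC.
  rewrite (_ : (z - x) 0 i = (z - y) 0 i + (y - x) 0 i).
    by rewrite mulrDr scalerDl opprD; set A := _ *: _; set B := _ *: _;
      rewrite [RHS]addrC; apply/rowP => j; rewrite !mxE; ring.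
  by rewrite !mxE; ring.
apply: (le_lt_trans (enormB _ _)); rewrite enormZ enorm_delta mulr1 normrM.
have := coord_le_enorm (z - y) i; rewrite (ger0_norm (_ : 0 <= 2))//.
by move: zd; lra.
Qed.

(* Odd reflection across the hyperplane through [x] orthogonal to [e_i], then the
   maximum principle on the half ball with a quadratic barrier. *)
Lemma gradient_upper Omega h x i (r M : R) : open Omega -> harm Omega h -> 0 < r -> 0 < M ->
  cb x r `<=` Omega -> (forall y, cb x r y -> `|h y| <= M) ->
  partial i h x <= (n%:R + 1) * M / r.
Proof.
move=> oO [Ch lh] r0 M0 rO hM.
pose s y := (y - x) 0 i.
pose C := cb x r `&` [set y | 0 <= s y].
(* One more than [n]: the Laplacian of [b] is 2 M (2 n - 2 N) / r^2 = - 4 M / r^2, so that [w] is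
   strictly subharmonic. *)
pose N : R := n%:R + 1.
pose b y : R := 2 * M * (enorm (y - x) ^+ 2 / r ^+ 2 + N * (s y / r - s y ^+ 2 / r ^+ 2)).
pose w y := h y - h (refl x i y) - b y.
have cbr y : cb x r y -> cb x r (refl x i y) by rewrite /cb/= enorm_refl.
have r2 : 0 < r ^+ 2 by rewrite exprn_gt0.
have cw y : cb x r y -> {for y, continuous w}.
  move=> yr; have cs : {for y, continuous s} by exact: cont_coordB.
  apply: contB; first apply: contB.
  - exact: (Ch _ (rO _ yr)).1.
  - apply: cont_refl; exact: (Ch _ (rO _ (cbr _ yr))).1.
  apply: contM; first exact: cont_cst.
  apply: contD.
    by apply: contM; [apply: contX; exact: cont_enormB|exact: cont_cst].
  apply: contM; first exact: cont_cst.
  apply: contB; apply: contM; try exact: cont_cst; first exact: cs.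
  exact: contX.
have cC : compact C.
  rewrite /C (_ : [set y | _] = s @^-1` [set t | 0 <= t]); last by [].
  apply: compact_closedI; first exact: compact_cb.
  apply: preimage_closed; last exact: closed_ge.
  by move=> y _; exact: cont_coordB.
have lb y : lap b y (2 * M * ((2 * n%:R) / r ^+ 2 - N * 2 / r ^+ 2)).
  apply: lapZ.
  have l1 : lap (fun z => enorm (z - x) ^+ 2) y (2 * n%:R).
    have := @lap_sqn _ _ (fun s => s) (fun=> 1) y x 0 1 ltr01.
    by rewrite mulr0 add0r mulr1; apply => // t _; exact (der_id t).
  have l2 : lap s y 0.
    exact: (@lap_coord _ _ (fun s => s) (fun=> 1) y x i 0 der_id (der_cst _ 1)).
  have l3 : lap (fun z => s z ^+ 2) y 2.
    apply: (@lap_coord _ _ (fun s => s ^+ 2) (fun s => 2 * s)).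
      move=> t; apply: (@der_eq _ _ _ (1 * t + t * 1)); last by ring.
      by have := derM (der_id t) (der_id t); congr (is_derive _ _ _ _); apply/funext => u; rewrite expr2.
    by have := derZ 2 (der_id (s y)); rewrite mulr1.
  apply: (@lap_ext _ _ (fun z => r ^- 2 * enorm (z - x) ^+ 2 + N * (r^-1 * s z - r ^- 2 * s z ^+ 2))).
    by move=> z; rewrite (mulrC (r ^- 2)) (mulrC r^-1) (mulrC (r ^- 2)).
  rewrite (_ : _ - _ = r ^- 2 * (2 * n%:R) + N * (r^-1 * 0 - r ^- 2 * 2)); last by ring.
  by apply: lapD; [exact: lapZ|apply: lapZ; apply: lapB; exact: lapZ].
have wle : forall y, C y -> w y <= 0.
  apply: (max_principle cC); first by apply: within_cont => y [yr _]; exact: cw.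
  move=> y [yr sy0]; rewrite /= in sy0.
  have sle : s y <= r by apply: (le_trans (ler_norm _)); exact: (le_trans (coord_le_enorm _ _) yr).
  have srat : 0 <= s y / r - s y ^+ 2 / r ^+ 2.
    rewrite (_ : _ - _ = s y * (r - s y) / r ^+ 2).
      by rewrite divr_ge0 ?mulr_ge0 ?subr_ge0// ltW.
    by field; rewrite gt_eqF.
  have N0 : 0 <= N by rewrite addr_ge0.
  have [sy|sy] := eqVneq (s y) 0.
    left; rewrite /w refl_fix// subrr sub0r oppr_le0 /b mulr_ge0//; first by rewrite mulr_ge0// ltW.
    by rewrite addr_ge0 ?mulr_ge0 ?invr_ge0 ?exprn_ge0 ?enorm_ge0 ?(ltW r0).
  have [yr'|yr'] := ltP (enorm (y - x)) r.
    right; split.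
      have h1 := cb_interior yr'.
      have h2 : nbhs y [set z | 0 < s z].
        have /continuous_enormP cs : {for y, continuous s} by exact: cont_coordB.
        have sp : 0 < s y by rewrite lt_neqAle eq_sym sy.
        have [d d0 dA] := cs _ sp; apply/nbhs_enormP; exists d => // z /dA.
        by rewrite ltr_norml => /andP[] /=; lra.
      by apply: filterS2 h1 h2 => z z1 z2; split => //; exact: ltW.
    exists (0 - 0 - (2 * M * ((2 * n%:R) / r ^+ 2 - N * 2 / r ^+ 2))).
      apply: lapB; last exact: lb.
      by apply: lapB; [apply: lh; exact: rO|apply: lap_refl; apply: lh; apply: rO; exact: cbr].
    rewrite (_ : _ - _ = 4 * M / r ^+ 2); first by rewrite divr_gt0// mulr_gt0.
    by rewrite /N; ring.
  left; have yE : enorm (y - x) = r by apply/eqP; rewrite eq_le yr'  andbT.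
  have h1 : h y - h (refl x i y) <= 2 * M.
    have := hM _ yr; have := hM _ (cbr _ yr); rewrite !ler_norml => /andP[A1 A2] /andP[A3 A4].
    by lra.
  have h2 : 2 * M <= b y.
    rewrite /b yE divff ?gt_eqF// -[leLHS]mulr1 ler_wpM2l ?mulr_ge0 ?(ltW M0)//.
    by rewrite lerDl mulr_ge0.
  by rewrite /w; lra.
have dh : is_derive (0 : R) 1 (fun t : R => h (x + t *: 'e_i)) (partial i h x).
  apply: (@is_derive_along _ _ h x 'e_i 0); rewrite scale0r addr0; apply: is_derive_partial.
  by apply: ((Ch x _).2 i).1; apply: rO; rewrite /cb/= subrr enorm0 ltW.
have key (t : R) : 0 < t -> t <= r -> h (x + t *: 'e_i) - h (x + (- t) *: 'e_i) <=
    2 * M * (t ^+ 2 / r ^+ 2 + N * (t / r)).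
  move=> t0 tr; have sE : s (x + t *: 'e_i) = t.
    by rewrite /s addrAC subrr add0r !mxE !eqxx mulr1.
  have eE : enorm (x + t *: 'e_i - x) = t.
    by rewrite addrAC subrr add0r enormZ enorm_delta mulr1 gtr0_norm.
  have := wle (x + t *: 'e_i); rewrite /w /b refl_axis sE eE /C/= sE /cb/= eE => h1.
  have := h1 (conj tr (ltW t0)); rewrite subr_le0 scaleNr => /le_trans; apply.
  rewrite ler_wpM2l ?mulr_ge0 ?(ltW M0)// lerD2l ler_wpM2l ?addr_ge0// lerBlDr lerDl.
  by rewrite divr_ge0 ?exprn_ge0 ?ltW.
(* Letting [t] tend to 0 in [key]. If the partial derivative exceeds the bound by [3 e], the excess
   over [2 t] is [6 e t], while the two linearisation errors and the quadratic term cost at most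
   [4 e t]. *)
rewrite -/N leNgt; apply/negP => lt.
pose e := (partial i h x - N * M / r) / 3.
have e0 : 0 < e by rewrite divr_gt0// subr_gt0.
have /is_derive_epsP dh' := dh.
have [d d0 dA] := dh' e e0.
have e1 : 0 < e * r ^+ 2 / M by rewrite divr_gt0// mulr_gt0.
pose t := Num.min (d / 2) (Num.min r (e * r ^+ 2 / M)).
have t0 : 0 < t by rewrite !lt_min divr_gt0// r0.
have : t <= Num.min (d / 2) (Num.min r (e * r ^+ 2 / M)) by [].
rewrite !le_min => /and3P[td tr te].
have td' : t < d by lra.
have := dA t; rewrite gtr0_norm// => /(_ td').
have := dA (- t); rewrite normrN gtr0_norm// => /(_ td').
rewrite !add0r ![_ *: 1]mulr1 scale0r addr0 !ler_norml => /andP[_ A1] /andP[A2 _].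
have A3 := key t t0 tr.
have te' : M * t <= e * r ^+ 2 by rewrite mulrC -ler_pdivlMr.
have tE : M * (t ^+ 2 / r ^+ 2) <= e * t.
  rewrite mulrA ler_pdivrMr//.
  have -> : M * t ^+ 2 = t * (M * t) by ring.
  have -> : e * t * r ^+ 2 = t * (e * r ^+ 2) by ring.
  by rewrite ler_pM2l.
have eE : N * M / r = partial i h x - 3 * e by rewrite /e; set Q := N * M / r; lra.
have A4 : 2 * M * (N * (t / r)) = 2 * t * (N * M / r) by ring.
have et0 : 0 < e * t by rewrite mulr_gt0.
have A5 : 2 * t * (partial i h x - 3 * e) = 2 * (t * partial i h x) - 6 * (e * t) by ring.
by move: A1 A2 A3 tE; rewrite mulrDr A4 eE A5 mulNr -(mulrA 2 M); lra.
Qed.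

Lemma gradient_bound Omega h x i (r M : R) : open Omega -> harm Omega h -> 0 < r ->
  cb x r `<=` Omega -> (forall y, cb x r y -> `|h y| <= M) ->
  `|partial i h x| <= (n%:R + 1) * M / r.
Proof.
move=> oO hh r0 rO hM.
have M0 : 0 <= M by apply: le_trans (hM x _) => //; rewrite /cb/= subrr enorm0 ltW.
have c0 : 0 < (n%:R + 1) / r by rewrite divr_gt0// ltr_wpDl.
(* [gradient_upper] asks for a positive bound on [h]; the slack [e] covers [M = 0]. *)
rewrite -[leRHS]addr0; apply/ler_addgt0Pr => e e0; rewrite addr0.
have M'0 : 0 < M + e / ((n%:R + 1) / r) by rewrite ltr_wpDl// divr_gt0.
have E : (n%:R + 1) * (M + e / ((n%:R + 1) / r)) / r = (n%:R + 1) * M / r + e.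
  by field; rewrite !gt_eqF// ltr_wpDl.
have hM' y : cb x r y -> `|h y| <= M + e / ((n%:R + 1) / r).
  by move=> /hM /le_trans; apply; rewrite lerDl divr_ge0// ltW.
rewrite -E ler_norml; apply/andP; split; last exact: (gradient_upper i oO hh r0 M'0 rO hM').
have [hN pN] := harm_lin (-1) 0 oO hh hh.
have Ox : Omega x by apply: rO; rewrite /cb/= subrr enorm0 ltW.
have := gradient_upper i oO hN r0 M'0 rO; rewrite pN// mul0r addr0 mulN1r => H.
rewrite lerNl; apply: H => y /hM'; rewrite mul0r addr0 mulN1r normrN.
by [].
Qed.

(* [gradient_bound] for the difference quotients of [h] in direction [e_i]. *)
Lemma partial_lipschitz x h i (r M : R) : 0 < r -> harm (eb x (3 * r)) h ->
  (forall y, eb x (3 * r) y -> `|partial i h y| <= M) ->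
  forall y, cb x r y ->
  `|partial i h y - partial i h x| <= n%:R * ((n%:R + 1) * (2 * M) / r) * enorm (y - x).
Proof.
move=> r0 hh hM y yr.
have oO : open (eb x (3 * r)) by exact: open_eb.
have M0 : 0 <= M by apply: le_trans (hM x _) => //; rewrite /eb/= subrr enorm0 mulr_gt0.
set K := _ / r.
have K0 : 0 <= K by rewrite /K divr_ge0 ?mulr_ge0 ?addr_ge0// ltW.
have [_ pd] := hh; have [Ch _] := hh.
have inb z : cb x r z -> eb x (3 * r) z by rewrite /cb/eb/=; lra.
rewrite -[leRHS]addr0; apply/ler_addgt0Pr => e e0; rewrite addr0.
have /is_derive_epsP dy := is_derive_partial ((Ch y (inb y yr)).2 i).1.
have xr : cb x r x by rewrite /cb/= subrr enorm0 ltW.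
have /is_derive_epsP dx := is_derive_partial ((Ch x (inb x xr)).2 i).1.
have e2 : 0 < e / 2 by rewrite divr_gt0.
have [d1 d10 H1] := dy _ e2; have [d2 d20 H2] := dx _ e2.
pose t := Num.min (d1 / 2) (Num.min (d2 / 2) (r / 2)).
have t0 : 0 < t by rewrite !lt_min !divr_gt0.
have : t <= Num.min (d1 / 2) (Num.min (d2 / 2) (r / 2)) by [].
rewrite !le_min => /and3P[t1 t2 tr].
pose v : 'rV[R]_n := t *: 'e_i.
have vn : enorm v = t by rewrite enormZ enorm_delta mulr1 gtr0_norm.
have [hs ps] := harm_shift v oO hh.
(* Since |v| <= r / 2, [q] is harmonic on the ball of radius [2 r], where it is bounded by [M t];
   points of [cb x r] then have room [r / 2] for [gradient_bound]. *)
pose q z := 1 * h (z + v) + (-1) * h z.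
have o2 : open (eb x (2 * r)) by exact: open_eb.
have sub2 : eb x (2 * r) `<=` [set z | eb x (3 * r) (z + v)].
  move=> z; rewrite /eb/= => zr; rewrite addrAC; apply: (le_lt_trans (enormD _ _)).
  by rewrite vn; lra.
have sub1 : eb x (2 * r) `<=` eb x (3 * r) by move=> z; rewrite /eb/=; lra.
have [hq pq] := harm_lin 1 (-1) o2 (harm_sub sub2 hs) (harm_sub sub1 hh).
have qM z : eb x (2 * r) z -> `|q z| <= M * t.
  move=> zr; pose F (s : R) := h (z + s *: 'e_i).
  have inF (s : R) : 0 <= s -> s <= t -> eb x (3 * r) (z + s *: 'e_i).
    move=> s0 st; move: zr; rewrite /eb/= => zr; rewrite addrAC; apply: (le_lt_trans (enormD _ _)).
    by rewrite enormZ enorm_delta mulr1 ger0_norm//; lra.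
  have dF (s : R) : 0 <= s -> s <= t -> is_derive s 1 F (partial i h (z + s *: 'e_i)).
    move=> s0 st; apply: (@is_derive_along _ _ h z 'e_i s); apply: is_derive_partial.
    by apply: ((Ch _ _).2 i).1; exact: inF.
  have -> : q z = F t - F 0 by rewrite /q /F scale0r addr0 mul1r mulN1r.
  rewrite -[in leRHS](subr0 t); apply: (mvt_le (df := fun s : R => partial i h (z + s *: 'e_i))).
  - exact: ltW.
  - by move=> s /andP[s0 st]; apply: is_derive_continuous (dF s s0 st).
  - by move=> s /andP[s0 st]; apply: dF; exact: ltW.
  - by move=> s /andP[s0 st]; apply: hM; apply: inF; exact: ltW.
have r2 : 0 < r / 2 by rewrite divr_gt0.
have pqM z : cb x r z -> forall k, `|partial k q z| <= K * t.
  move=> zr k.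
  have sub : cb z (r / 2) `<=` eb x (2 * r).
    move=> y'; rewrite /cb/eb/= => wz; apply: (le_lt_trans (enorm_tri z y' x)).
    by move: zr; rewrite /cb/=; lra.
  have := gradient_bound k o2 hq r2 sub (fun y' wz => qM y' (sub y' wz)).
  by congr (_ <= _); rewrite /K; field; rewrite gt_eqF.
have := C1_seg_le (M := K * t) o2 hq.1 (x := x) (y := y).
have segin s : 0 <= s <= 1 -> cb x r (x + s *: (y - x)).
  by move=> /andP[s0 s1]; exact: seg_in_cb.
have segin2 (s : R) : 0 <= s <= 1 -> eb x (2 * r) (x + s *: (y - x)).
  by move=> /segin; rewrite /cb/eb/=; lra.
move=> /(_ segin2 (fun s hs k => pqM _ (segin s hs) k)) h3.
have := H1 t; have := H2 t; rewrite gtr0_norm//.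
have td1 : t < d1 by lra. have td2 : t < d2 by lra.
move=> /(_ td2) h2 /(_ td1) h1.
rewrite -(ler_pM2l t0) -[X in X * `|_|](gtr0_norm t0) -normrM.
have -> : t * (partial i h y - partial i h x) = (q y - q x)
   - (h (y + v) - h y - t * partial i h y) + (h (x + v) - h x - t * partial i h x).
  by rewrite /q; ring.
apply: (le_trans (ler_normD _ _)).
apply: (le_trans (lerD (ler_normB _ _) (lexx _))).
have -> : t * (n%:R * K * enorm (y - x) + e) =
    n%:R * (K * t) * enorm (y - x) + (e / 2 * t) + (e / 2 * t) by field.
by rewrite !lerD.
Qed.

(** Mean value theorem for [h] minus its linear part along the segment; the derivative of that
    difference is small by [partial_lipschitz]. It gives a quadratic remainder without second
    derivatives. *)
Lemma harm_taylor x h (r M : R) : 0 < r -> 0 <= M -> harm (eb x (3 * r)) h ->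
  (forall y, eb x (3 * r) y -> forall i, `|partial i h y| <= M) ->
  forall y, cb x r y ->
  `|h y - h x - \sum_i (y - x) 0 i * partial i h x| <=
     n%:R * (n%:R * ((n%:R + 1) * (2 * M) / r)) * enorm (y - x) ^+ 2.
Proof.
move=> r0 M0 hh hM y yr; set K := _ / r.
have [Ch _] := hh.
have inb z : cb x r z -> eb x (3 * r) z by rewrite /cb/eb/=; lra.
pose F (s : R) := h (x + s *: (y - x)) - s * \sum_i (y - x) 0 i * partial i h x.
have segin (s : R) : 0 <= s -> s <= 1 -> cb x r (x + s *: (y - x)).
  by move=> s0 s1; apply: seg_in_cb => //; rewrite /cb/= subrr enorm0 ltW.
have dF (s : R) : 0 <= s -> s <= 1 -> is_derive s 1 F
    (\sum_i (y - x) 0 i * partial i h (x + s *: (y - x)) - \sum_i (y - x) 0 i * partial i h x).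
  move=> s0 s1; have xs := inb _ (segin s s0 s1).
  have d1 := is_derive_along (C1_is_derive (y - x) (@open_eb _ _ x (3 * r)) Ch xs).
  exact (derB d1 (is_derive_mulr s _)).
have -> : h y - h x - \sum_i (y - x) 0 i * partial i h x = F 1 - F 0.
  by rewrite /F scale1r scale0r addr0 mul0r mul1r subr0 [x + _]addrC subrK addrAC.
have K0 : 0 <= K by rewrite /K; nneg.
have := @mvt_le R F (fun s : R => \sum_i (y - x) 0 i * partial i h (x + s *: (y - x)) -
    \sum_i (y - x) 0 i * partial i h x) 0 1
  (n%:R * (n%:R * K) * enorm (y - x) ^+ 2) ler01.
rewrite subr0 mulr1; apply.
- by move=> s /andP[s0 s1]; apply: is_derive_continuous (dF s s0 s1).
- by move=> s /andP[s0 s1]; apply: dF; exact: ltW.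
move=> s /andP[s0 s1].
rewrite -sumrB (le_trans (ler_norm_sum _ _ _))//.
apply: (@le_trans _ _ (\sum_(i < n) n%:R * K * enorm (y - x) ^+ 2)); last first.
  by rewrite sumr_const card_ord -[leLHS]mulr_natl !mulrA.
apply: ler_sum => i _; rewrite -mulrBr normrM expr2 mulrA mulrC.
apply: ler_pM => //; last exact: coord_le_enorm.
have := partial_lipschitz (i := i) r0 hh (fun z hz => hM z hz i) (segin s (ltW s0) (ltW s1)).
move=> /le_trans; apply; apply: ler_wpM2l; first by nneg.
rewrite addrAC subrr add0r enormZ gtr0_norm// ler_piMl ?enorm_ge0//.
exact: ltW.
Qed.

End harmonic.

(** * Harnack's inequality *)

Section inverse_powers.
Context {R : realType}.

Lemma derXn (k : nat) (s : R) : is_derive s 1 (fun s : R => s ^+ k) (k%:R * s ^+ k.-1).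
Proof.
have [d1 d2] : is_derive s 1 (fun s : R => s ^+ k) ('D_1 (@GRing.exp R ^~ k) s).
  by apply: DeriveDef => //; exact: exprn_derivable.
by apply: DeriveDef => //; rewrite d2 exp_derive /GRing.scale/= mulr1.
Qed.

Lemma der_invX (k : nat) (s : R) : 0 < s ->
  is_derive s 1 (fun s : R => (s ^+ k)^-1) (- (k%:R * (s ^+ k.+1)^-1)).
Proof.
move=> s0; have sk : s ^+ k != 0 by rewrite expf_neq0// gt_eqF.
have d := @derV _ (fun s : R => s ^+ k) s _ sk (derXn k s).
apply: (der_eq d) => /=; congr (- _).
case: k {sk d} => [|k] /=; first by rewrite !mul0r.
rewrite -mulrA; congr (_ * _).
have -> : (s ^+ k.+1) ^+ 2 = s ^+ k * s ^+ k.+2 by rewrite -exprM -exprD; congr (_ ^+ _); rewrite muln2 -addnn; lia.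
by rewrite invfM mulrA divff ?mul1r// expf_neq0// gt_eqF.
Qed.

End inverse_powers.

Section harnack.
Context {R : realType} {n : nat}.
Implicit Types (u h : 'rV[R]_n -> R) (x y z : 'rV[R]_n) (Omega : set 'rV[R]_n).

(* A point maximising [(r - |y - x|)^(2n) h y] controls [h] on a ball whose radius is
   comparable to its distance to the sphere, and the radial barrier
   [|z - y|^(-2n)] carries the resulting lower bound back to the centre. *)
Lemma harnack (hn : (0 < n)%N) : exists2 C : R, 1 <= C &
  forall Omega h x (r : R), open Omega -> harm Omega h -> 0 < r -> cb x (3 * r) `<=` Omega ->
  (forall y, Omega y -> 0 < h y) -> forall y, cb x (r / 2) y -> h y <= C * h x.
Proof.
pose N := (2 * n)%N.
(* Within distance [th * rho] of the maximum point [p], the gradient bound lets [h] drop by at most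
   [h p / 2]. *)
pose th : R := (8 * n%:R * (n%:R + 1) * 2 ^+ N)^-1.
have n0 : 0 < n%:R :> R by rewrite ltr0n.
have n1 : 1 <= n%:R :> R by rewrite ler1n.
have N1 : 1 <= 2 ^+ N :> R by rewrite exprn_ege1// ler1n.
have N0 : 0 < 2 ^+ N :> R by rewrite exprn_gt0.
have thi : 8 <= 8 * n%:R * (n%:R + 1) * 2 ^+ N :> R.
  have h1 : 8 <= 8 * n%:R :> R by lra.
  have h2 : 8 <= 8 * n%:R * (n%:R + 1) :> R by nra.
  by nra.
have th0 : 0 < th by rewrite invr_gt0; lra.
have th8 : th <= 1 / 8 by rewrite /th div1r lef_pV2 ?posrE//; lra.
exists (4 * (2 / th) ^+ N).
  have : 1 <= (2 / th) ^+ N; last by lra.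
  by rewrite exprn_ege1// ler_pdivlMr//; lra.
move=> Omega h x r oO hh r0 rO hpos.
have [Ch lh] := hh.
have inO y : cb x r y -> Omega y by move=> h1; apply: rO; move: h1; rewrite /cb/=; lra.
(* The weight has the exponent with which the barrier below decays; this makes the unknown [rho]
   cancel from the final inequality. *)
pose Phi y := (r - enorm (y - x)) ^+ N * h y.
have cPhi : {within cb x r, continuous Phi}.
  apply: within_cont => y /inO Oy; apply: contM; last exact: (Ch y Oy).1.
  by apply: contX; apply: contB; [exact: cont_cst|exact: cont_enormB].
have xx : cb x r x by rewrite /cb/= subrr enorm0 ltW.
have [p] := compact_EVT_max (ex_intro _ x xx) (@compact_cb _ _ x r) cPhi.
rewrite inE => px pmax.
have {}pmax y : cb x r y -> Phi y <= Phi p by move=> yr; apply: pmax; rewrite inE.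
have hp : 0 < h p by apply/hpos/inO.
pose rho := r - enorm (p - x).
have rho0 : 0 < rho.
  have rho_ge0 : 0 <= rho by rewrite subr_ge0.
  rewrite lt_neqAle rho_ge0 andbT; apply/eqP => rho0.
  have := pmax x xx; rewrite /Phi -/rho -rho0 expr0n muln_eq0/= (gtn_eqF hn) mul0r.
  by rewrite leNgt => /negP; apply; rewrite subrr enorm0 subr0 mulr_gt0 ?exprn_gt0//; exact/hpos/inO.
have rhor : rho <= r by rewrite /rho gerBl enorm_ge0.
have inr y e : e <= rho -> cb p e y -> cb x r y.
  rewrite /cb/= => he hy; apply: (le_trans (enorm_tri p y x)).
  by rewrite /rho in he; lra.
have hle y : cb p (rho / 2) y -> h y <= 2 ^+ N * h p.
  move=> yp; have yx : cb x r y by apply: (inr y (rho / 2)) yp; lra.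
  have := pmax y yx; rewrite /Phi -/rho.
  have rh2 : 0 < (rho / 2) ^+ N by rewrite exprn_gt0// divr_gt0.
  have h1 : (rho / 2) ^+ N <= (r - enorm (y - x)) ^+ N.
    rewrite lerXn2r ?nnegrE ?subr_ge0 ?divr_ge0 ?(ltW rho0)//.
    have := enorm_tri p y x; rewrite /cb/= in yp; rewrite /rho in yp *; lra.
  have hy : 0 < h y by apply/hpos/inO.
  move=> h2; have {h2} : (rho / 2) ^+ N * h y <= rho ^+ N * h p.
    by apply: le_trans h2; rewrite ler_pM2r.
  have -> : rho ^+ N = (rho / 2) ^+ N * 2 ^+ N by rewrite -exprMn; congr (_ ^+ _); field.
  by rewrite -mulrA ler_pM2l.
have rho4 : 0 < rho / 4 by rewrite divr_gt0.
have grad z : cb p (rho / 4) z -> forall i, `|partial i h z| <= (n%:R + 1) * (2 ^+ N * h p) / (rho / 4).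
  move=> zp i; have sub : cb z (rho / 4) `<=` cb p (rho / 2).
    move=> y; rewrite /cb/= => yz; apply: (le_trans (enorm_tri z y p)).
    by rewrite /cb/= in zp; lra.
  apply: (gradient_bound i oO hh rho4) => y /sub yp.
    by apply: inO; apply: (inr y (rho / 2)) yp; lra.
  by rewrite gtr0_norm ?hle//; apply/hpos/inO; apply: (inr y (rho / 2)) yp; lra.
have hge z : cb p (th * rho) z -> h p / 2 <= h z.
  move=> zp.
  have pp e : 0 <= e -> cb p e p by move=> e0; rewrite /cb/= subrr enorm0.
  have z4 : cb p (rho / 4) z by move: zp; rewrite /cb/=; nra.
  have seg4 (t : R) : 0 <= t <= 1 -> cb p (rho / 4) (p + t *: (z - p)).
    by move=> /andP[t0 t1]; apply: seg_in_cb => //; apply: pp; exact: ltW.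
  have seg := C1_seg_le oO Ch (x := p) (y := z)
    (M := (n%:R + 1) * (2 ^+ N * h p) / (rho / 4)).
  have := seg (fun t ht => inO _ (inr _ (rho / 4) ltac:(lra) (seg4 t ht)))
    (fun t ht => grad _ (seg4 t ht)).
  have : n%:R * ((n%:R + 1) * (2 ^+ N * h p) / (rho / 4)) * enorm (z - p) <= h p / 2.
    have c0 : 0 <= n%:R * ((n%:R + 1) * (2 ^+ N * h p) / (rho / 4)).
      by nneg.
    apply: (le_trans (ler_wpM2l c0 zp)).
    rewrite le_eqVlt; apply/orP; left; apply/eqP; rewrite /th; field.
    by rewrite !gt_eqF//; nra.
  by move=> A B; have := le_trans B A; rewrite ler_norml => /andP[]; lra.
have key : (h p / 4) * (th * rho / r) ^+ N <= h x.
  have thr : th * rho <= r / 8 by nra.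
  have thr0 : 0 < th * rho by rewrite mulr_gt0.
  have c1 : th * rho / r <= 1 by rewrite ler_pdivrMr//; lra.
  have c0 : 0 <= th * rho / r by rewrite divr_ge0 ?ltW.
  have c2 : (th * rho / r) ^+ N <= 1 by rewrite exprn_ile1.
  have [xp|xp] := leP (enorm (x - p)) (th * rho).
    have := hge x xp; have := exprn_ge0 N c0; nra.
  (* The power |z|^(-2n) decays faster than the fundamental solution, so it is strictly subharmonic,
     with Laplacian 2 n (n + 2) / s^(n+1) at s = |z|^2, and dimension 2 needs no logarithm. *)
  pose psi (s : R) := (s ^+ n)^-1.
  pose c := (th * rho) ^+ N * (h p / 2).
  have cp : 0 < c by rewrite mulr_gt0 ?exprn_gt0// divr_gt0.
  pose b z := c * (psi (enorm (z - p) ^+ 2) - psi ((2 * r) ^+ 2)).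
  have psi2 (s : R) : psi (s ^+ 2) = (s ^+ N)^-1 by rewrite /psi -exprM.
  pose C := cb p (2 * r) `&` [set z | th * rho <= enorm (z - p)].
  have CO z : C z -> Omega z.
    move=> [zp _]; apply: rO; move: zp px; rewrite /cb/= => zp px.
    by apply: (le_trans (enorm_tri p z x)); lra.
  have cC : compact C.
    rewrite /C (_ : [set z | _] = (fun z => enorm (z - p)) @^-1` [set t | th * rho <= t]); last by [].
    apply: compact_closedI; first exact: compact_cb.
    apply: preimage_closed; last exact: closed_ge.
    by move=> y _; exact: cont_enormB.
  have w0 : forall z, C z -> b z - h z <= 0.
    apply: (max_principle cC).
      apply: within_cont => z Cz; have [_ /= zth] := Cz.
      apply: contB; last exact: (Ch _ (CO z Cz)).1.
      apply: contM; first exact: cont_cst.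
      apply: contB; last exact: cont_cst.
      have -> : (fun y => psi (enorm (y - p) ^+ 2)) = (fun y => (fun s : R => (s ^+ N)^-1) (enorm (y - p))).
        by apply/funext => y; rewrite psi2.
      apply: (@cont_comp _ _ (fun s : R => (s ^+ N)^-1) (fun y => enorm (y - p))); last exact: cont_enormB.
      apply: cvgV; first by rewrite expf_neq0// gt_eqF// (lt_le_trans thr0).
      exact: exprn_continuous.
    move=> z Cz; have [zr /= zth] := Cz; rewrite /cb/= in zr.
    have z0 : 0 < enorm (z - p) by apply: lt_le_trans zth.
    have [zth'|zth'] := leP (enorm (z - p)) (th * rho).
      left; rewrite subr_le0; apply: le_trans (hge z zth').
      have ze : enorm (z - p) = th * rho by apply/eqP; rewrite eq_le zth' zth.
      rewrite /b psi2 ze /c mulrBr mulrAC divff ?mul1r; last by rewrite expf_neq0// gt_eqF.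
      by rewrite gerBl; apply: mulr_ge0; [exact: ltW|rewrite psi2 invr_ge0; nneg].
    have [zr'|zr'] := ltP (enorm (z - p)) (2 * r); last first.
      left; rewrite subr_le0; apply: le_trans (ltW (hpos z (CO z Cz))).
      have ze : enorm (z - p) = 2 * r by apply/eqP; rewrite eq_le zr' zr.
      by rewrite /b ze subrr mulr0.
    right; split.
      have h1 := cb_interior zr'.
      have h2 : nbhs z [set y | th * rho <= enorm (y - p)].
        have /continuous_enormP cs := @cont_enormB _ _ p z.
        have sp : 0 < enorm (z - p) - th * rho by rewrite subr_gt0.
        have [d d0 dA] := cs _ sp; apply/nbhs_enormP; exists d => // y /dA.
        by rewrite ltr_norml => /andP[/= hy _]; clear -hy; lra.
      by apply: filterS2 h1 h2.
    set s0 := enorm (z - p) ^+ 2.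
    have s00 : 0 < s0 by rewrite exprn_gt0.
    have d1 (s : R) : `|s - s0| < s0 -> is_derive s 1 psi (- (n%:R * (s ^+ n.+1)^-1)).
      by rewrite ltr_norml => /andP[hs _]; apply: der_invX; clear -hs; lra.
    have d2 := derN (derZ n%:R (der_invX n.+1 s00)).
    have lp := lapB (lapZ c (lapB (lap_sqn s00 d1 d2) (lap_cst (psi ((2 * r) ^+ 2)) z))) (lh z (CO z Cz)).
    eexists; first exact: lp.
    rewrite !subr0 -/s0 mulr_gt0//.
    rewrite (_ : _ + _ = 2 * n%:R * (n%:R + 2) / s0 ^+ n.+1).
      by npos.
    rewrite (exprS s0 n.+1) -[in n.+1%:R]natr1; field.
    by rewrite expf_neq0 ?gt_eqF.
  have xC : C x.
    by split; rewrite /=; [rewrite /cb/= enormBC; move: px; rewrite /cb/=; lra|exact: ltW].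
  have := w0 x xC; rewrite subr_le0; apply: le_trans.
  rewrite /b !psi2 /c.
  have ex : enorm (x - p) <= r by rewrite enormBC.
  have x0 : 0 < enorm (x - p) by apply: lt_trans xp.
  have i1 : (r ^+ N)^-1 <= (enorm (x - p) ^+ N)^-1.
    rewrite lef_pV2 ?posrE ?exprn_gt0//.
    by rewrite lerXn2r ?nnegrE ?enorm_ge0// ltW.
  have i2 : ((2 * r) ^+ N)^-1 <= (r ^+ N)^-1 / 2.
    rewrite exprMn invfM mulrC ler_wpM2l ?invr_ge0 ?exprn_ge0 ?(ltW r0)//.
    rewrite lef_pV2 ?posrE//.
    have : 2 ^+ 1 <= 2 ^+ N :> R by rewrite ler_eXn2l ?ltr1n// /N muln_gt0.
    by rewrite expr1.
  have th1 : 0 < (th * rho) ^+ N by rewrite exprn_gt0.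
  rewrite exprMn exprVn.
  set A := (r ^+ N)^-1 in i1 i2 *; set B := (enorm _ ^+ N)^-1 in i1 *.
  set D := (_ ^+ N)^-1 in i2 *; set T := (th * rho) ^+ N in th1 *.
  have : A / 2 <= B - D by lra.
  move=> hAB; have : 0 <= (T * (h p / 2)) * (B - D - A / 2) by apply: mulr_ge0; [nneg|lra].
  by lra.
move=> y yx.
have yr : cb x r y by move: yx; rewrite /cb/=; lra.
have := pmax y yr; rewrite /Phi -/rho => h1.
have h2 : (r / 2) ^+ N * h y <= rho ^+ N * h p.
  apply: le_trans h1; rewrite ler_pM2r; last exact/hpos/inO.
  by rewrite lerXn2r ?nnegrE ?subr_ge0 ?divr_ge0 ?(ltW r0)//; move: yx; rewrite /cb/=; lra.
have rN : 0 < (r / 2) ^+ N by npos.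
rewrite -(ler_pM2l rN); apply: (le_trans h2).
have -> : (r / 2) ^+ N * (4 * (2 / th) ^+ N * h x) = 4 * (r / th) ^+ N * h x.
  rewrite (_ : r / th = r / 2 * (2 / th)); last by field; rewrite gt_eqF.
  by rewrite [in RHS]exprMn; ring.
have -> : rho ^+ N * h p = 4 * (r / th) ^+ N * (h p / 4 * (th * rho / r) ^+ N).
  have -> : rho = r / th * (th * rho / r) by field; rewrite !gt_eqF.
  rewrite [in LHS]exprMn.
  have -> : th * (r / th * (th * rho / r)) / r = th * rho / r by field; rewrite !gt_eqF.
  by field.
by rewrite ler_pM2l//; npos.
Qed.

End harnack.

(** * Images of balls under harmonic quasiconformal maps *)

Section hqc.
Context {R : realType} {n : nat}.
Implicit Types (x y z v p q xi : 'rV[R]_n) (f g : 'rV[R]_n -> 'rV[R]_n).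

Definition jac f x : 'M[R]_n := \matrix_(i, j) partial i (fun y => f y 0 j) x.

(** The sum of the entries dominates each partial derivative and is visibly continuous; it differs
    from the operator norm by factors depending on [n] only. *)
Definition jnorm f x : R := \sum_i \sum_j `|jac f x i j|.

(* [g] is the inverse of [f]; row [i] of [jac f x] is the derivative along [e_i], so
   [xi *m (jac f x)^T] is the gradient of [<f, xi>]. *)
Record hqc (K : R) f g : Prop := Hqc {
  hqc_harm : forall j, harm (@eball R n) (fun x => f x 0 j);
  hqc_in : forall x, eball x -> eball (f x);
  hqc_inv_in : forall y, eball y -> eball (g y);
  hqc_fK : forall x, eball x -> g (f x) = x;
  hqc_gK : forall y, eball y -> f (g y) = y;
  hqc_cont : forall x, eball x -> {for x, continuous f};
  hqc_inv_cont : forall y, eball y -> {for y, continuous g};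
  hqc_dist : forall x v, eball x -> jnorm f x * enorm v <= K * enorm (v *m jac f x);
  hqc_codist : forall x xi, eball x -> jnorm f x * enorm xi <= K * enorm (xi *m (jac f x)^T)
}.

Lemma jnorm_ge0 f x : 0 <= jnorm f x.
Proof. by apply: sumr_ge0 => i _; apply: sumr_ge0 => j _. Qed.

Lemma jac_le_jnorm f x i j : `|partial i (fun y => f y 0 j) x| <= jnorm f x.
Proof.
rewrite /jnorm (bigD1 i)//= (bigD1 j)//= mxE -addrA lerDl addr_ge0//.
  by apply: sumr_ge0.
by apply: sumr_ge0 => k _; apply: sumr_ge0.
Qed.

Lemma unit_dir (hn : (0 < n)%N) v : exists2 xi, enorm xi = 1 & dot v xi = enorm v.
Proof.
have [->|v0] := eqVneq v 0.
  exists 'e_(Ordinal hn); first exact: enorm_delta.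
  by rewrite enorm0 /dot big1// => i _; rewrite mxE mul0r.
have e0 := enorm_gt0 v0; exists ((enorm v)^-1 *: v).
  by rewrite enormZ ger0_norm ?invr_ge0 ?enorm_ge0// mulVf// gt_eqF.
by rewrite dotZr -sqr_enorm expr2 mulrA mulVf ?mul1r// gt_eqF.
Qed.

Lemma cb_eball x (r : R) : r < 1 - enorm x -> cb x r `<=` @eball R n.
Proof.
move=> rx y; rewrite /cb/eball/= => yx.
by have := enorm_lerB y x; lra.
Qed.

Lemma row_coord_dot m (A : 'M[R]_(m, n)) (v : 'rV[R]_n) i :
  (v *m A^T) 0 i = \sum_j A i j * v 0 j.
Proof. by rewrite mxE; apply: eq_bigr => j _; rewrite mxE mulrC. Qed.


(* With [xi] the direction of [f x], [1 - <f, xi>] is a positive harmonic function whose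
   value at [x] is [1 - |f x|]; quasiconformality makes all directional derivatives comparable. *)
Lemma gradient_and_harnack (hn : (0 < n)%N) (K : R) : 1 <= K -> exists2 C : R, 1 <= C & forall f g, hqc K f g ->
  forall x, eball x -> jnorm f x * (1 - enorm x) <= C * (1 - enorm (f x)) /\
  forall y, enorm (y - x) <= (1 - enorm x) / 8 -> 1 - enorm (f y) <= C * (1 - enorm (f x)).
Proof.
move=> K1; have [C C1 HC] := @harnack R n hn.
have n1 : 1 <= n%:R :> R by rewrite ler1n.
exists (K * n%:R * (n%:R + 1) * 8 * C).
  have h1 : 1 <= K * n%:R by nra.
  have h2 : 1 <= K * n%:R * (n%:R + 1) by nra.
  have h3 : 1 <= K * n%:R * (n%:R + 1) * 8 by nra.
  by nra.
move=> f g H x xB.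
have [xi xi1 xid] := unit_dir hn (f x).
have oB := @open_eball R n.
have [hd pd] := harm_dot xi oB (hqc_harm H).
have [hh ph] := harm_lin 1 (-1) oB (harm_cst 1 oB) hd.
pose h y := 1 * 1 + -1 * dot (f y) xi.
have hE y : h y = 1 - dot (f y) xi by rewrite /h mul1r mulN1r.
have hge y : eball y -> 1 - enorm (f y) <= h y.
  by move=> yB; rewrite hE lerD2l lerN2; have := dot_le (f y) xi; rewrite xi1 mulr1.
have hpos y : eball y -> 0 < h y.
  move=> yB; apply: lt_le_trans (hge y yB).
  by rewrite subr_gt0; exact: hqc_in H _ yB.
have hx : h x = 1 - enorm (f x) by rewrite hE xid.
have dx : 0 < 1 - enorm x by rewrite subr_gt0.
pose r := (1 - enorm x) / 4.
have r0 : 0 < r by rewrite divr_gt0.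
have rB : cb x (3 * r) `<=` @eball R n by apply: cb_eball; rewrite /r; lra.
have har := HC _ h x r oB hh r0 rB hpos.
have ax : 0 < 1 - enorm (f x) by rewrite -hx; exact: hpos.
have CK : C <= K * n%:R * (n%:R + 1) * 8 * C.
  have h1 : 1 <= K * n%:R by nra.
  have h2 : 1 <= K * n%:R * (n%:R + 1) by nra.
  have h3 : 1 <= K * n%:R * (n%:R + 1) * 8 by nra.
  by nra.
split; last first.
  move=> y yx; have yr : cb x (r / 2) y by rewrite /cb/= /r; lra.
  have yB : eball y by apply: rB; move: yr; rewrite /cb/=; lra.
  apply: (le_trans (hge y yB)); apply: (le_trans (har y yr)); rewrite hx.
  by rewrite ler_pM2r.
have r2 : 0 < r / 2 by rewrite divr_gt0.
have sub : cb x (r / 2) `<=` @eball R n by move=> y yr; apply: rB; move: yr; rewrite /cb/=; lra.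
have hM y : cb x (r / 2) y -> `|h y| <= C * h x.
  by move=> yr; rewrite gtr0_norm ?har//; apply/hpos/sub.
have gr i : `|(xi *m (jac f x)^T) 0 i| <= (n%:R + 1) * (C * h x) / (r / 2).
  have := gradient_bound i oB hh r2 sub hM.
  rewrite ph// partial_cst mulr0 add0r mulN1r normrN pd// row_coord_dot.
  by congr (`|_| <= _); apply: eq_bigr => j _; rewrite mxE.
have := hqc_codist H xi xB; rewrite xi1 mulr1.
have := enorm_le_coord gr => h1 h2.
have h3 : jnorm f x <= K * (n%:R * ((n%:R + 1) * (C * h x) / (r / 2))).
  by apply: (le_trans h2); rewrite ler_wpM2l//; lra.
apply: (le_trans (ler_wpM2r (ltW dx) h3)).
rewrite hx /r le_eqVlt; apply/orP; left; apply/eqP; field.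
by rewrite gt_eqF.
Qed.

(** Inside the ball, the image of [T] is the preimage of [T] under the continuous inverse [g]. *)
Lemma open_image (K : R) f g (T : set 'rV[R]_n) : hqc K f g -> open T -> T `<=` @eball R n ->
  open (f @` T).
Proof.
move=> H oT TB; rewrite openE => _ [x Tx <-].
have xB := TB _ Tx.
have nT : nbhs (g (f x)) T by rewrite (hqc_fK H)//; exact: open_nbhs_nbhs.
have h1 : nbhs (f x) (g @^-1` T) by exact: (hqc_inv_cont H (hqc_in H xB) nT).
have h2 : nbhs (f x) (@eball R n).
  apply: open_nbhs_nbhs; split; [exact: open_eball|exact: hqc_in H _ xB].
apply/nbhs_enormP.
have /nbhs_enormP[e1 e10 eT] := h1; have /nbhs_enormP[e2 e20 eB] := h2.
exists (Num.min e1 e2); first by rewrite lt_min e10.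
move=> y; rewrite /eb/= lt_min => /andP[/eT Ty /eB yB].
by exists (g y) => //; exact: hqc_gK H _ yB.
Qed.

(** Connectedness instead of degree: along the segment from [f y] to [q], membership in the image of
    the open ball is an open condition, and also a closed one, because the points of the sphere go
    outside [eb (f y) t]. *)
Lemma image_ball (K : R) f g y (s t : R) : hqc K f g -> cb y s `<=` @eball R n -> 0 < s ->
  (forall z, enorm (z - y) = s -> t <= enorm (f z - f y)) ->
  eb (f y) t `<=` f @` eb y s.
Proof.
move=> H sB s0 st q qt.
have ebB : eb y s `<=` @eball R n by move=> z zs; apply: sB; exact: ltW.
have yE : eb y s y by rewrite /eb/= subrr enorm0.
have t0 : 0 < t by apply: le_lt_trans qt; exact: enorm_ge0.
pose c (u : R) := f y + u *: (q - f y).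
have cc : continuous c by exact: seg_continuous.
have oI := open_image H (@open_eb _ _ y s) ebB.
have cI : closed (f @` cb y s).
  apply: compact_closed; first exact: norm_hausdorff.
  apply: continuous_compact; last exact: compact_cb.
  by apply: continuous_in_subspaceT => z; rewrite inE => /sB; exact: hqc_cont H _.
have cin (u : R) : 0 <= u <= 1 -> eb (f y) t (c u).
  by move=> /andP[u0 u1]; apply: seg_in_eb => //; rewrite /eb/= subrr enorm0.
have sub (w : 'rV[R]_n) : (f @` eb y s) w -> (f @` cb y s) w.
  by move=> [z zs <-]; exists z => //; exact: ltW.
have sub2 (w : 'rV[R]_n) : eb (f y) t w -> (f @` cb y s) w -> (f @` eb y s) w.
  move=> wt [z zs zw]; exists z => //; rewrite /eb/= lt_neqAle; apply/andP; split => //.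
  by apply/eqP => /st; rewrite zw; apply/negP; rewrite -ltNge.
pose B := `[0 : R, 1]%classic `&` c @^-1` (f @` eb y s).
have BE : B = `[0 : R, 1]%classic.
  apply: (@segment_connected R 0 1).
  - exists 0; split; first by rewrite /= in_itv/= lexx ler01.
    by rewrite /= /c scale0r addr0; exists y.
  - by exists (c @^-1` (f @` eb y s)) => //; apply: open_comp => // u _; exact: cc.
  - exists (c @^-1` (f @` cb y s)); first by apply: preimage_closed => // u _; exact: cc.
    apply/seteqP; split=> u [u01 hu]; split => //; first exact: sub.
    by apply: sub2 => //; apply: cin; move: u01; rewrite /= in_itv.
have : B 1 by rewrite BE /= in_itv/= lexx ler01.
by move=> [_ /=]; rewrite /c scale1r addrC subrK.
Qed.

(* Maximising [(r - |y - x|) * jnorm f y] produces a point near which [f] is close to its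
   linearisation at a scale comparable to the distance to the sphere. *)
Lemma image_contains_ball (hn : (0 < n)%N) (K : R) : 1 <= K -> exists2 c : R, 0 < c & forall f g, hqc K f g ->
  forall x (r : R), 0 < r -> cb x r `<=` @eball R n ->
  exists p, eb p (c * (r * jnorm f x)) `<=` f @` eb x r.
Proof.
move=> K1; have n1 : 1 <= n%:R :> R by rewrite ler1n.
(* From [harm_taylor] with bound [2 * Np] and radius [rho / 6], times [n] for the passage from
   coordinates to the norm. *)
pose C : R := 24 * (n%:R ^+ 3 * (n%:R + 1)).
have C1 : 24 <= C.
  have : 1 <= n%:R ^+ 3 :> R by rewrite exprn_ege1.
  by rewrite /C => h; nra.
(* At distance [s = th * rho] the Taylor error is [Np * s / (2 * K)], half of the lower bound
   [Np * s / K] for the linear part. *)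
pose th : R := (2 * K * C)^-1.
have th0 : 0 < th by rewrite invr_gt0; nra.
have th6 : th <= 1 / 6.
  by rewrite /th div1r lef_pV2 ?posrE//; nra.
have thE : th * (2 * K * C) = 1 by rewrite /th mulVf// gt_eqF//; nra.
have K0 : 0 < K by lra.
exists (th / (2 * K)); first by npos.
move=> f g H x r r0 rB.
have [Nx|Nx] := eqVneq (jnorm f x) 0.
  (* The ball of radius 0 is empty, so any centre serves. *)
  exists 0; rewrite Nx !mulr0 => y; rewrite /eb/= => h.
  by have := le_lt_trans (enorm_ge0 _) h; rewrite ltxx.
have Nx0 : 0 < jnorm f x by rewrite lt_neqAle eq_sym Nx jnorm_ge0.
pose Phi y := (r - enorm (y - x)) * jnorm f y.
have cN y : eball y -> {for y, continuous (jnorm f)}.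
  move=> yB; apply: cont_sum => i; apply: cont_sum => j.
  have -> : (fun y => `|jac f y i j|) = (fun y => (fun t : R => `|t|) (partial i (fun z => f z 0 j) y)).
    by apply/funext => z; rewrite mxE.
  apply: cont_comp; first exact: norm_continuous.
  exact: (((hqc_harm H j).1 y yB).2 i).2.
have cPhi : {within cb x r, continuous Phi}.
  apply: within_cont => y /rB yB; apply: contM; last exact: cN.
  by apply: contB; [exact: cont_cst|exact: cont_enormB].
have xx : cb x r x by rewrite /cb/= subrr enorm0 ltW.
have [p] := compact_EVT_max (ex_intro _ x xx) (@compact_cb _ _ x r) cPhi.
rewrite inE => px pmax.
have {}pmax y : cb x r y -> Phi y <= Phi p by move=> yr; apply: pmax; rewrite inE.
pose rho := r - enorm (p - x); pose Np := jnorm f p.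
have rN : r * jnorm f x <= rho * Np by have := pmax x xx; rewrite /Phi subrr enorm0 subr0.
have rN0 : 0 < rho * Np by apply: lt_le_trans rN; exact: mulr_gt0.
have rho_ge0 : 0 <= rho by rewrite subr_ge0.
have Np_ge0 : 0 <= Np by exact: jnorm_ge0.
have rho0 : 0 < rho by rewrite lt_neqAle rho_ge0 andbT; apply: contraTneq rN0 => <-; rewrite mul0r ltxx.
have Np0 : 0 < Np by rewrite lt_neqAle Np_ge0 andbT; apply: contraTneq rN0 => <-; rewrite mulr0 ltxx.
have inr y : eb p (rho / 2) y -> cb x r y /\ rho / 2 <= r - enorm (y - x).
  rewrite /eb/cb/= => yp; have := enorm_tri p y x; rewrite /rho in yp rho0 *; split; lra.
have Nle y : eb p (rho / 2) y -> jnorm f y <= 2 * Np.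
  move=> /inr[yr rr]; have := pmax y yr; rewrite /Phi -/rho -/Np => h.
  have h2 : (rho / 2) * jnorm f y <= rho * Np by apply: le_trans h; rewrite ler_wpM2r// jnorm_ge0.
  by rewrite -(ler_pM2l (_ : 0 < rho / 2)) ?divr_gt0//; apply: (le_trans h2); lra.
have pB : eball p by exact: rB.
pose r' := rho / 6.
have r'0 : 0 < r' by rewrite divr_gt0.
have sub3 : eb p (3 * r') `<=` eb p (rho / 2) by move=> y; rewrite /eb/= /r'; lra.
have taylor j y := @harm_taylor _ _ p (fun z => f z 0 j) r' (2 * Np) r'0 (ltac:(nneg))
  (harm_sub (fun z hz => rB z (inr z (sub3 z hz)).1) (hqc_harm H j))
  (fun z hz i => le_trans (jac_le_jnorm f z i j) (Nle z (sub3 z hz))) y.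
pose s := th * rho.
have s0 : 0 < s by exact: mulr_gt0.
have sr' : s <= r' by rewrite /s /r'; nra.
have sB : cb p s `<=` cb x r.
  move=> y; rewrite /cb/= => yp; apply: (inr y _).1; rewrite /eb/=; apply: (le_lt_trans yp).
  by rewrite /r' in sr'; lra.
exists (f p); pose t := s * Np / (2 * K).
have tE : th / (2 * K) * (r * jnorm f x) <= t.
  rewrite /t /s (_ : th * rho * Np / (2 * K) = th / (2 * K) * (rho * Np)); last by ring.
  by rewrite ler_pM2l//; npos.
have sBB : cb p s `<=` @eball R n by move=> y /sB/rB.
have lower z : enorm (z - p) = s -> t <= enorm (f z - f p).
  move=> zs; have zr' : cb p r' z by rewrite /cb/= zs.
  have hl := hqc_dist H (z - p) pB; rewrite -/Np zs in hl.
  have hd : enorm (f z - f p - (z - p) *m jac f p) <= C * Np * s ^+ 2 / rho.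
    have hj j : `|(f z - f p - (z - p) *m jac f p) 0 j| <= C * Np * s ^+ 2 / rho / n%:R.
      have := taylor j z zr'; rewrite !mxE zs => h.
      apply: (le_trans _ (le_trans h _)).
        rewrite le_eqVlt; apply/orP; left; apply/eqP; congr (`|_ - _|).
        by apply: eq_bigr => i _; congr (_ * _); rewrite mxE.
      rewrite le_eqVlt; apply/orP; left; apply/eqP; rewrite /r' /C; field.
      by rewrite !gt_eqF//; lra.
    apply: (le_trans (enorm_le_coord hj)).
    by rewrite mulrC divfK// gt_eqF//; lra.
  have e1 : C * Np * s ^+ 2 / rho = s * Np / (2 * K).
    rewrite -(mulrA (C * Np)); have -> : s ^+ 2 / rho = th * s by rewrite /s; field; rewrite gt_eqF.
    have -> : s * Np / (2 * K) = s * Np * (th * (2 * K * C)) / (2 * K) by rewrite thE mulr1.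
    by field; rewrite gt_eqF.
  have h3 : Np * s / K <= enorm ((z - p) *m jac f p).
    by rewrite ler_pdivrMr// (mulrC _ K).
  have h4 := enorm_lerB ((z - p) *m jac f p) ((z - p) *m jac f p - (f z - f p)).
  rewrite subKr in h4.
  rewrite enormBC in hd; rewrite e1 in hd.
  have e2 : Np * s / K = 2 * t by rewrite /t; field; rewrite gt_eqF.
  by move: hd; rewrite -/t; lra.
have := image_ball H sBB s0 lower.
move=> sub y yt; have [] := sub y; first by move: yt; rewrite /eb/=; lra.
move=> z zs zy; exists z => //; apply: (_ : eb x r z).
have := enorm_tri p z x; move: zs; rewrite /eb/= /s /rho in rho0 sr' *.
by move=> h1 h2; nra.
Qed.

End hqc.

(** * Volumes of images and the boundary Hoelder estimate *)

Section volume.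
Context {R : realType} {n : nat}.
Implicit Types (x y z p q c : 'rV[R]_n) (S T : set 'rV[R]_n).

Definition box c (r : R) : set 'rV[R]_n := [set x | forall i, `|x 0 i - c 0 i| < r].

Lemma boxE c (r : R) :
  box c r = [set x | forall i, `]c 0 i - r, c 0 i + r[%classic (x 0 i)].
Proof.
apply/seteqP; split=> x h i; have := h i; rewrite /= in_itv/= ltr_norml => /andP[h1 h2];
  apply/andP; split; lra.
Qed.

Lemma measurable_rV_box (A : 'I_n -> set (measurableTypeR R)) :
  (forall i, measurable (A i)) -> measurable [set x : 'rV[R]_n | forall i, A i (x 0 i)].
Proof.
move=> mA; rewrite /measurable /= /rV_measurable /=.
have := measurable_tuple_box mA; congr (measurable _).
by apply/seteqP; split=> t h i; have := h i; rewrite mxE.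
Qed.

Lemma measurable_box c (r : R) : measurable (box c r).
Proof.
rewrite boxE; apply: (@measurable_rV_box (fun i => `]c 0 i - r, c 0 i + r[%classic)) => i.
exact: measurable_itv.
Qed.

Lemma lebesgue_boxE c (r : R) : 0 <= r -> lebesgue (box c r) = ((2 * r) ^+ n)%:E.
Proof.
move=> r0; rewrite boxE.
have := @lebesgue_box R n (fun i => `]c 0 i - r, c 0 i + r[%classic) (fun i => measurable_itv _).
move=> /= ->.
rewrite (eq_bigr (fun=> (2 * r)%:E)); last first.
  move=> i _; rewrite lebesgue_measure_itv /= lte_fin.
  case: ltP => h; first by rewrite -EFinD; congr (_%:E); lra.
  by congr (_%:E); lra.
rewrite -(big_morph EFin (fun a b : R => EFinM a b) erefl).
by rewrite prodr_const card_ord.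
Qed.

Lemma eb_sub_box p (r : R) : eb p r `<=` box p r.
Proof.
move=> x xp i; apply: le_lt_trans xp.
by have := coord_le_enorm (x - p) i; rewrite !mxE.
Qed.

Lemma box_sub_eb p (r : R) : 0 < r -> box p (r / (n%:R + 1)) `<=` eb p r.
Proof.
move=> r0 x xp; rewrite /eb/=.
have n0 : 0 < n%:R + 1 :> R by rewrite ltr_wpDl.
apply: (@le_lt_trans _ _ (n%:R * (r / (n%:R + 1)))).
  by apply: enorm_le_coord => i; have := xp i; rewrite !mxE => /ltW.
by rewrite mulrA ltr_pdivrMr// mulrC ltr_pM2l// ltrDl.
Qed.

(** The sigma-algebra was defined through coordinates, so openness and measurability must be
    related: an open set is the union of the countably many boxes with rational centre and half-side
    1 / (m + 1) that it contains. *)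
Lemma open_measurable_rV S : open S -> measurable S.
Proof.
move=> oS.
pose F (k : {ffun 'I_n -> rat} * nat) : set 'rV[R]_n :=
  let b := box (\row_i ratr (k.1 i)) (k.2.+1%:R^-1) in if pselect (b `<=` S) then b else set0.
have -> : S = \bigcup_k F k.
  apply/seteqP; split=> [x Sx|x [k _]]; last first.
    by rewrite /F; case: pselect => // h; exact: h.
  have /nbhs_enormP[e e0 eS] : nbhs x S by exact: open_nbhs_nbhs.
  have n0 : 0 < n%:R + 1 :> R by rewrite ltr_wpDl.
  have e'0 : 0 < e / (n%:R + 1) / 2 by rewrite !divr_gt0.
  pose m := Num.trunc ((e / (n%:R + 1) / 2)^-1).
  have mE : m.+1%:R^-1 < e / (n%:R + 1) / 2 :> R.
    rewrite invf_plt ?posrE ?ltr0n//.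
    exact: truncnS_gt.
  have m0 : 0 < m.+1%:R^-1 :> R by rewrite invr_gt0 ltr0n.
  have ex (r : R) (r0 : 0 < r) (u : R) : exists q : rat, `|u - ratr q| < r.
    have [q] : exists q : rat, ratr q \in `](u - r), (u + r)[ by apply: rat_in_itvoo; lra.
    by rewrite in_itv/= => /andP[h1 h2]; exists q; rewrite ltr_norml; apply/andP; split; lra.
  have [q hq] := choice (fun i => ex _ m0 (x 0 i)).
  exists ([ffun i => q i], m) => //; rewrite /F /=; case: pselect => [_ i|].
    by rewrite mxE ffunE.
  case; move=> y hy; apply: eS; apply: box_sub_eb => // i.
  have := hy i; have := hq i; rewrite mxE ffunE => h1 h2.
  have := ler_normB (y 0 i - ratr (q i)) (x 0 i - ratr (q i)).
  rewrite opprB addrA subrK => /le_lt_trans; apply.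
  by rewrite (lt_le_trans (ltrD h2 h1))// -[leRHS](divfK (lt0r_neq0 (ltr0Sn R 1))) mulr_natr mulr2n lerD// ltW.
apply: countable_bigcupT_measurable; first exact: countableP.
move=> k; rewrite /F /=; case: pselect => h; [exact: measurable_box|exact: measurable0].
Qed.

(** [fine] sends an infinite measure to 0, which is why the lemmas comparing volumes ask for
    containment in some [eb p l]. *)
Definition vol S : R := fine (lebesgue S).

Lemma lebesgue_fin S p (l : R) : 0 <= l -> open S -> S `<=` eb p l -> lebesgue S \is a fin_num.
Proof.
move=> l0 oS Sl; rewrite ge0_fin_numE//; apply: (@le_lt_trans _ _ (lebesgue (box p l))).
  apply: le_measure; rewrite ?inE.
  - exact: open_measurable_rV.
  - exact: measurable_box.
  - by move=> x /Sl; exact: eb_sub_box.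
by rewrite lebesgue_boxE// ltry.
Qed.

Lemma vol_ge0 S : 0 <= vol S.
Proof. exact: fine_ge0. Qed.

Lemma vol_le S T p (l : R) : 0 <= l -> open S -> open T -> T `<=` eb p l -> S `<=` T -> vol S <= vol T.
Proof.
move=> l0 oS oT Tl ST; apply: fine_le.
- exact: (lebesgue_fin l0 oS (subset_trans ST Tl)).
- exact: (lebesgue_fin l0 oT Tl).
- by apply: le_measure; rewrite ?inE//; exact: open_measurable_rV.
Qed.

Lemma vol_upper S p (l : R) : 0 <= l -> open S -> S `<=` eb p l -> vol S <= (2 * l) ^+ n.
Proof.
move=> l0 oS Sl; rewrite -[leRHS]/(fine ((2 * l) ^+ n)%:E) -(lebesgue_boxE p l0); apply: fine_le.
- exact: (lebesgue_fin l0 oS Sl).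
- by rewrite lebesgue_boxE.
- apply: le_measure; rewrite ?inE; [exact: open_measurable_rV|exact: measurable_box|].
  by move=> x /Sl; exact: eb_sub_box.
Qed.

Lemma vol_lower S p q (t l : R) : 0 <= l -> open S -> S `<=` eb q l -> eb p t `<=` S ->
  0 <= t -> (0 < n)%N -> (2 * t / (n%:R + 1)) ^+ n <= vol S.
Proof.
move=> l0 oS Sl tS t0 hn.
have [->|t1] := eqVneq t 0; first by rewrite mulr0 mul0r expr0n gtn_eqF ?vol_ge0.
have t2 : 0 < t by rewrite lt_neqAle eq_sym t1.
have r0 : 0 <= t / (n%:R + 1) by nneg.
have -> : (2 * t / (n%:R + 1)) ^+ n = fine (lebesgue (box p (t / (n%:R + 1)))).
  by rewrite lebesgue_boxE// mulrA.
apply: fine_le.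
- by rewrite lebesgue_boxE.
- exact: (lebesgue_fin l0 oS Sl).
- apply: le_measure; rewrite ?inE; [exact: measurable_box|exact: open_measurable_rV|].
  by move=> x /(box_sub_eb t2)/tS.
Qed.

Lemma vol_sum (N : nat) (F : nat -> set 'rV[R]_n) T p (l : R) : 0 <= l ->
  (forall k, open (F k)) -> open T -> T `<=` eb p l ->
  (forall k, (k < N)%N -> F k `<=` T) ->
  (forall j k x, (j < N)%N -> (k < N)%N -> F j x -> F k x -> j = k) ->
  \sum_(k < N) vol (F k) <= vol T.
Proof.
move=> l0 oF oT Tl FT disj.
pose G k := if (k < N)%N then F k else set0.
have oG k : open (G k) by rewrite /G; case: ifP => // _; exact: open0.
have mG k : measurable (G k) by exact: open_measurable_rV.
have GT k : G k `<=` T by rewrite /G; case: ifP => [/FT//|_ x []].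
have tG : trivIset setT G.
  move=> j k _ _ [x []]; rewrite /G; case: ifP => // jN; case: ifP => // kN.
  exact: disj.
have E : lebesgue (\big[setU/set0]_(k < N) G k) = (\sum_(k < N) lebesgue (G k))%E.
  exact: measure_bigsetU.
have fG k : lebesgue (G k) \is a fin_num.
  exact: (lebesgue_fin l0 (oG k) (subset_trans (GT k) Tl)).
have -> : \sum_(k < N) vol (F k) = fine (\sum_(k < N) lebesgue (G k))%E.
  rewrite (eq_bigr (fun k : 'I_N => (vol (F k))%:E)); first by rewrite sumEFin.
  by move=> k _; have := fG k; rewrite /G ltn_ord /vol => /fineK ->.
have oU : open (\big[setU/set0]_(k < N) G k).
  by rewrite -bigcup_mkord; apply: bigcup_open => k _.
have UT : \big[setU/set0]_(k < N) G k `<=` T.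
  by rewrite -bigcup_mkord => x [k _]; exact: GT.
rewrite -E; exact: (vol_le l0 oU oT Tl UT).
Qed.

Lemma vol_disjoint S1 S2 T p (l : R) : 0 <= l -> open S1 -> open S2 -> open T ->
  T `<=` eb p l -> S1 `<=` T -> S2 `<=` T -> (forall x, S1 x -> S2 x -> False) ->
  vol S1 + vol S2 <= vol T.
Proof.
move=> l0 o1 o2 oT Tl s1 s2 dj.
have := @vol_sum 2 (fun k => if k == 0%N then S1 else S2) T p l l0.
rewrite !big_ord_recl big_ord0 addr0 /=; apply=> //.
- by case.
- by case.
by move=> [|[|j]] [|[|k]] x //= _ _ h1 h2; exfalso; eapply dj; eauto.
Qed.

End volume.

(** * Points of the ball near the sphere *)

Section geometry.
Context {R : realType} {n : nat}.
Implicit Types (x y z v w : 'rV[R]_n).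

(** Comparable with the distance to the sphere up to a factor 2, but polynomial in [x], hence suited
    to barriers. *)
Definition defect x : R := 1 - enorm x ^+ 2.

Lemma defect_bounds x : eball x ->
  [/\ 0 < defect x, defect x <= 1, 1 - enorm x <= defect x & defect x <= 2 * (1 - enorm x)].
Proof.
rewrite /eball/= /defect => x1; have x0 := enorm_ge0 x.
split; nra.
Qed.

Lemma eball_defect x : eball x <-> 0 < defect x.
Proof.
split=> [/defect_bounds[]//|]; rewrite /defect /eball/= => h.
have x0 := enorm_ge0 x; rewrite ltNge; apply/negP => x1; nra.
Qed.

Lemma defect_lip x y : eball x -> eball y -> defect y <= defect x + 2 * enorm (y - x).
Proof.
rewrite /eball/= /defect => x1 y1; have x0 := enorm_ge0 x; have y0 := enorm_ge0 y.
have := enorm_lerB x y; rewrite enormBC => h; have := enorm_ge0 (y - x); nra.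
Qed.

Lemma orth_dir w : (1 < n)%N -> exists2 v, enorm v = 1 & dot w v = 0.
Proof.
move=> n2; have n1 : (0 < n)%N by exact: ltnW.
pose i := Ordinal n1; pose j := Ordinal n2.
pose v : 'rV[R]_n := w 0 j *: 'e_i - w 0 i *: 'e_j.
have [v0|v0] := eqVneq v 0; last first.
  exists ((enorm v)^-1 *: v).
    by rewrite enormZ ger0_norm ?invr_ge0 ?enorm_ge0// mulVf// gt_eqF// enorm_gt0.
  by rewrite dotZr [dot w v]dotDr dotNr !dotZr !delta_dot [w 0 i * _]mulrC subrr mulr0.
exists 'e_i; first exact: enorm_delta.
rewrite delta_dot; have /rowP/(_ j) := v0; rewrite !mxE !eqxx /=.
by rewrite /= mulr0 sub0r mulr1 => /eqP; rewrite oppr_eq0 => /eqP.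
Qed.

Lemma polar z : (0 < n)%N -> exists2 w, enorm w = 1 & z = enorm z *: w.
Proof.
move=> n1; have [->|z0] := eqVneq z 0.
  by exists 'e_(Ordinal n1); rewrite ?enorm_delta// enorm0 scale0r.
have e0 := enorm_gt0 z0; exists ((enorm z)^-1 *: z).
  by rewrite enormZ ger0_norm ?invr_ge0 ?enorm_ge0// mulVf// gt_eqF.
by rewrite scalerA mulfV ?scale1r// gt_eqF.
Qed.

(** In the plane spanned by the direction of [z] and an orthogonal one, take a w + b v and a w - b
    v: [b = D / 2] fixes their mutual distance and [a] then fixes the defect. Two dimensions are
    needed for the orthogonal direction. *)
Lemma children z : (1 < n)%N -> eball z -> exists z1 z2,
  [/\ defect z1 = defect z / 12, defect z2 = defect z / 12,
      enorm (z1 - z) <= 5 / 2 * defect z, enorm (z2 - z) <= 5 / 2 * defect z &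
      enorm (z1 - z2) = defect z].
Proof.
move=> n2 zB; have [w w1 zw] := polar z (ltnW n2).
have [v v1 wv] := orth_dir w n2.
have [D0 D1 _ _] := defect_bounds zB.
set D := defect z in D0 D1 *; pose rho := enorm z.
have rho0 : 0 <= rho by exact: enorm_ge0.
have rhoD : rho ^+ 2 = 1 - D by rewrite /D /defect /rho; lra.
pose b := D / 2.
have s0 : 1 / 4 <= 1 - b ^+ 2 - D / 12 by rewrite /b; nra.
pose a := Num.sqrt (1 - b ^+ 2 - D / 12).
have a0 : 0 <= a by exact: sqrtr_ge0.
have a2 : a ^+ 2 = 1 - b ^+ 2 - D / 12 by rewrite sqr_sqrtr//; lra.
have ah : 1 / 2 <= a by nra.
have zE : z = rho *: w by [].
have comb (s t : R) : enorm (s *: w + t *: v) ^+ 2 = s ^+ 2 + t ^+ 2.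
  by rewrite sqr_enormD dotZl dotZr wv !mulr0 addr0 !enormZ w1 v1 !mulr1 !real_normK ?num_real.
have bb : (- b) ^+ 2 = b ^+ 2 by rewrite sqrrN.
have dE (t : R) : t ^+ 2 = b ^+ 2 -> defect (a *: w + t *: v) = D / 12.
  by move=> tb; rewrite /defect comb tb a2; ring.
have arho : 0 <= a - rho <= 2 * D.
  have h : (a - rho) * (a + rho) = D * (11 / 12 - D / 4) by rewrite -subr_sqr a2 rhoD /b; field.
  have h2 : 0 <= D * (11 / 12 - D / 4) by rewrite mulr_ge0; lra.
  have h3 : D * (11 / 12 - D / 4) <= D by nra.
  have h4 : 1 / 2 <= a + rho by lra.
  apply/andP; split; last by nra.
  by rewrite -(pmulr_lge0 _ (_ : 0 < a + rho)) ?h//; lra.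
have dist (t : R) : `|t| = b -> enorm (a *: w + t *: v - z) <= 5 / 2 * D.
  move=> tb; rewrite {1}zE addrAC -scalerBl.
  apply: (le_trans (enormD _ _)); rewrite !enormZ w1 v1 !mulr1 tb.
  by case/andP: arho => h1 h2; rewrite ger0_norm// /b; lra.
have b0 : 0 <= b by rewrite /b; lra.
exists (a *: w + b *: v), (a *: w + (- b) *: v); split.
- exact: dE.
- exact: dE.
- by apply: dist; rewrite ger0_norm.
- by apply: dist; rewrite normrN ger0_norm.
rewrite opprD addrACA subrr add0r -scalerBl enormZ v1 mulr1 opprK ger0_norm; rewrite /b; lra.
Qed.

End geometry.

(** Continuity argument: as long as the bound [m] holds up to time [t], it improves to [b < m] at
    [t], so the supremum of the times up to which it holds cannot be an exit time. *)
Lemma first_exit {R : realType} (phi : R -> R) (m b : R) : b < m -> phi 0 <= m ->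
  (forall t : R, 0 <= t <= 1 -> {for t, continuous phi}) ->
  (forall t : R, 0 <= t <= 1 -> (forall u : R, 0 <= u <= t -> phi u <= m) -> phi t <= b) ->
  forall t : R, 0 <= t <= 1 -> phi t <= m.
Proof.
move=> bm phi0 cphi H t0 /andP[t00 t01]; rewrite leNgt; apply/negP => t0m.
pose S := [set t : R | 0 <= t <= t0 /\ forall u : R, 0 <= u <= t -> phi u <= m].
have S0 : S 0.
  split; first by rewrite lexx.
  by move=> u /andP[u0 u1]; have -> : u = 0 by apply/eqP; rewrite eq_le u0 u1.
have hS : has_sup S.
  by split; [exists 0|exists t0 => t [/andP[_ h] _]].
pose s := sup S.
have s0 : 0 <= s by apply: sup_upper_bound.
have st0 : s <= t0 by apply: ge_sup; [exists 0|move=> t [/andP[_ h] _]].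
have s01 : 0 <= s <= 1 by rewrite s0 (le_trans st0).
have below (u : R) : 0 <= u -> u < s -> phi u <= m.
  move=> u0 us; have e0 : 0 < s - u by rewrite subr_gt0.
  have [t [_ tm]] := sup_adherent e0 hS; rewrite -/s subKr => ut.
  by apply: tm; rewrite u0 ltW.
have sm : phi s <= m.
  rewrite leNgt; apply/negP => sm.
  have e0 : 0 < phi s - m by rewrite subr_gt0.
  have [d d0 dA] := continuous_realP (cphi s s01) e0.
  have sp : 0 < s.
    rewrite lt_neqAle s0 andbT; apply/eqP => sE; move: sm; rewrite -sE; lra.
  pose u := s - Num.min (d / 2) s.
  have m0 : 0 < Num.min (d / 2) s by rewrite lt_min sp divr_gt0.
  have m1 : Num.min (d / 2) s <= d / 2 by rewrite ge_min lexx.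
  have m2 : Num.min (d / 2) s <= s by rewrite ge_min lexx orbT.
  have us : u < s by rewrite /u; lra.
  have u0 : 0 <= u by rewrite /u; lra.
  have := below u u0 us; have := dA u.
  rewrite {1}/u addrAC subrr sub0r normrN gtr0_norm// => /(_ ltac:(lra)).
  by rewrite ltr_norml => /andP[]; lra.
have sb : phi s <= b.
  apply: (H s s01) => u /andP[u0]; rewrite le_eqVlt => /predU1P[->//|]; exact: below.
have e0 : 0 < m - phi s by lra.
have [d d0 dA] := continuous_realP (cphi s s01) e0.
have st : s < t0.
  by rewrite lt_neqAle st0 andbT; apply/eqP => sE; move: t0m; rewrite -sE; lra.
pose u := s + Num.min (d / 2) (t0 - s).
have m0 : 0 < Num.min (d / 2) (t0 - s) by rewrite lt_min subr_gt0 st divr_gt0.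
have m1 : Num.min (d / 2) (t0 - s) <= d / 2 by rewrite ge_min lexx.
have m2 : Num.min (d / 2) (t0 - s) <= t0 - s by rewrite ge_min lexx orbT.
have Su : S u.
  split; first by apply/andP; rewrite /u; split; lra.
  move=> v /andP[v0 vu]; have [vs|vs] := ltP v s; first exact: below.
  have := dA v; rewrite ger0_norm ?subr_ge0// => /(_ ltac:(rewrite /u in vu; lra)).
  by rewrite ltr_norml => /andP[]; lra.
have : u <= s by apply: sup_upper_bound.
by rewrite /u; lra.
Qed.

(** * Image volume controls the oscillation along a segment *)

Section tents.
Context {R : realType} {n : nat}.
Implicit Types (x y z p q e : 'rV[R]_n) (f g : 'rV[R]_n -> 'rV[R]_n) (A T : set 'rV[R]_n).

(* The volume of the image near [p] replaces the conformal modulus of the path family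
   filling [T]; it is superadditive over disjoint sets. *)
Definition mu f p T : R := vol (f @` T `&` eb p ((1 - enorm p) / 2)).

Lemma hqc_seg_le (K : R) f g x y (M : R) : hqc K f g ->
  (forall t : R, 0 <= t <= 1 -> eball (x + t *: (y - x))) ->
  (forall t : R, 0 <= t <= 1 -> jnorm f (x + t *: (y - x)) <= M) ->
  enorm (f y - f x) <= n%:R * (n%:R * M * enorm (y - x)).
Proof.
move=> H sB sM; apply: enorm_le_coord => j; rewrite !mxE.
apply: (C1_seg_le open_eball (hqc_harm H j).1 sB) => t /sM h i.
exact: le_trans (jac_le_jnorm f _ i j) h.
Qed.

Lemma eb_eball x (r : R) : r <= 1 - enorm x -> eb x r `<=` @eball R n.
Proof.
move=> rx y; rewrite /eb/eball/= => yx.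
by have := enorm_lerB y x; lra.
Qed.

Lemma mu_open (K : R) f g p T : hqc K f g -> open T -> T `<=` @eball R n ->
  open (f @` T `&` eb p ((1 - enorm p) / 2)).
Proof. by move=> H oT TB; apply: openI; [exact: open_image H oT TB|exact: open_eb]. Qed.

Lemma mu_mono (K : R) f g p A T : hqc K f g -> eball p -> open A -> open T ->
  T `<=` @eball R n -> A `<=` T -> mu f p A <= mu f p T.
Proof.
move=> H pB oA oT TB AT; have AB := subset_trans AT TB.
apply: (vol_le (p := p) (l := (1 - enorm p) / 2)).
- by rewrite divr_ge0// subr_ge0 ltW.
- exact: mu_open H oA AB.
- exact: mu_open H oT TB.
- by move=> x [].
by move=> _ [[x Ax <-] xp]; split => //; exists x => //; exact: AT.
Qed.

Lemma mu_disjoint (K : R) f g p A1 A2 T : hqc K f g -> eball p -> open A1 -> open A2 -> open T ->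
  T `<=` @eball R n -> A1 `<=` T -> A2 `<=` T -> (forall x, A1 x -> A2 x -> False) ->
  mu f p A1 + mu f p A2 <= mu f p T.
Proof.
move=> H pB o1 o2 oT TB T1 T2 dj.
have B1 := subset_trans T1 TB; have B2 := subset_trans T2 TB.
apply: (vol_disjoint (p := p) (l := (1 - enorm p) / 2)).
- by rewrite divr_ge0// subr_ge0 ltW.
- exact: mu_open H o1 B1.
- exact: mu_open H o2 B2.
- exact: mu_open H oT TB.
- by move=> x [].
- by move=> _ [[x Ax <-] xp]; split => //; exists x => //; exact: T1.
- by move=> _ [[x Ax <-] xp]; split => //; exists x => //; exact: T2.
move=> _ [[x Ax <-] _] [[y Ay yx] _]; apply: (dj x) => //.
suff -> : x = y by [].
by rewrite -(hqc_fK H (B1 _ Ax)) -(hqc_fK H (B2 _ Ay)) yx.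
Qed.

(** The volume comes from [image_contains_ball]. Harnack and the gradient bound keep the image of
    the whole ball inside the region around [p] in which [mu] measures. *)
Lemma local_volume (hn : (0 < n)%N) (K : R) : 1 <= K -> exists c5 c6 : R,
  [/\ 0 < c5, c5 <= 1 / 16, 0 < c6 & forall f g, hqc K f g -> forall p y (r : R),
    eball p -> eball y -> enorm (f y - p) <= (1 - enorm p) / 4 ->
    0 < r -> r <= c5 * (1 - enorm y) ->
    (c6 * (r * jnorm f y)) ^+ n <= mu f p (eb y r)].
Proof.
move=> K1; have n1 : 1 <= n%:R :> R by rewrite ler1n.
have [C C1 HC] := @gradient_and_harnack R n hn K K1.
have [c c0 Hc] := @image_contains_ball R n hn K K1.
have C0 : 0 <= C by lra.
have nC : 1 <= n%:R ^+ 2 * C ^+ 2 by rewrite mulr_ege1// exprn_ege1.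
(* With this radius [f] moves by at most (1 - |p|) / 8 on the ball, and 1/4 + 1/8 < 1/2. *)
exists (1 / (32 * (n%:R ^+ 2 * C ^+ 2))), (2 * c / (n%:R + 1)); split.
- by rewrite divr_gt0//; lra.
- by rewrite ler_pdivrMr; lra.
- by npos.
move=> f g H p y r pB yB fyp r0 rle.
have dy : 0 < 1 - enorm y by rewrite subr_gt0.
have a0 : 0 < 1 - enorm p by rewrite subr_gt0.
have cc : 1 / (32 * (n%:R ^+ 2 * C ^+ 2)) <= 1 / 32.
  by rewrite !div1r lef_pV2 ?posrE//; lra.
have r16 : r <= (1 - enorm y) / 8 by apply: (le_trans rle); nra.
have sB : cb y r `<=` @eball R n by apply: cb_eball; lra.
have ebB : eb y r `<=` @eball R n by move=> w wr; apply: sB; exact: ltW.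
have Nw w : eb y r w -> jnorm f w <= 4 * C ^+ 2 * (1 - enorm p) / (1 - enorm y).
  move=> wr; have wB := ebB _ wr.
  have [_ h1] := HC f g H y yB; have [h2 _] := HC f g H w wB.
  have wr8 : enorm (w - y) <= (1 - enorm y) / 8 by apply: le_trans r16; exact: ltW.
  have h3 := h1 w wr8.
  have h4 : 1 - enorm (f y) <= 2 * (1 - enorm p).
    by have := enorm_lerB p (f y); rewrite enormBC; lra.
  have h5 : (1 - enorm y) / 2 <= 1 - enorm w by have := enorm_lerB w y; lra.
  have N0 := jnorm_ge0 f w.
  rewrite ler_pdivlMr//.
  have h6 : jnorm f w * ((1 - enorm y) / 2) <= C * (C * (2 * (1 - enorm p))).
    apply: (le_trans (ler_wpM2l N0 h5)); apply: (le_trans h2); apply: ler_wpM2l; first by lra.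
    by apply: (le_trans h3); apply: ler_wpM2l => //; lra.
  by move: h6; set A := jnorm f w; move=> h6; lra.
have [q Hq] := Hc f g H y r r0 sB.
apply: le_trans (@vol_lower _ _ _ q p (c * (r * jnorm f y)) ((1 - enorm p) / 2) _ _ _ _ _ hn).
- rewrite le_eqVlt; apply/orP; left; apply/eqP; congr (_ ^+ _).
  by field; rewrite gt_eqF//; lra.
- by lra.
- exact: mu_open H (@open_eb _ _ y r) ebB.
- by move=> w [].
- move=> w /Hq[w' w'r <-]; split; first by exists w'.
  have seg (t : R) : 0 <= t <= 1 -> eb y r (y + t *: (w' - y)).
    by move=> /andP[t0 t1]; apply: seg_in_eb => //; rewrite /eb/= subrr enorm0.
  have h := hqc_seg_le H (fun t ht => ebB _ (seg t ht)) (fun t ht => Nw _ (seg t ht)).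
  rewrite /eb/=; apply: (le_lt_trans (enorm_tri (f y) _ _)).
  suff : enorm (f w' - f y) <= (1 - enorm p) / 8 by lra.
  apply: (le_trans h).
  have hM : 0 <= n%:R * (n%:R * (4 * C ^+ 2 * (1 - enorm p) / (1 - enorm y))).
    by nneg.
  have h' : enorm (w' - y) <= 1 / (32 * (n%:R ^+ 2 * C ^+ 2)) * (1 - enorm y).
    by apply: le_trans rle; exact: ltW.
  rewrite mulrA mulrA -(mulrA n%:R).
  apply: (le_trans (ler_wpM2l hM h')).
  rewrite le_eqVlt; apply/orP; left; apply/eqP; field.
  by rewrite !gt_eqF//; lra.
- by apply: mulr_ge0; [exact: ltW|apply: mulr_ge0; [exact: ltW|exact: jnorm_ge0]].
Qed.

Lemma root_le (a b : R) : (0 < n)%N -> 0 <= a -> 0 <= b -> a ^+ n <= b ^+ n -> a <= b.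
Proof. by move=> hn a0 b0; rewrite ler_pXn2r. Qed.

(* [f] moves little along a segment if a tube around it has small image near [p]. *)
Definition path_estimate (K c5 C8 : R) :=
  forall f g, hqc K f g -> forall p z z' A (s eta : R),
  eball p -> open A -> A `<=` @eball R n -> 0 < s -> 0 <= eta ->
  s <= 1 - enorm z -> s <= 1 - enorm z' ->
  (forall t : R, 0 <= t <= 1 -> eb (z + t *: (z' - z)) (c5 * s) `<=` A) ->
  mu f p A <= (eta * (1 - enorm p)) ^+ n ->
  enorm (f z - p) + C8 * (enorm (z' - z) / s) * (eta * (1 - enorm p)) < (1 - enorm p) / 4 ->
  enorm (f z' - f z) <= C8 * (enorm (z' - z) / s) * (eta * (1 - enorm p)).

(** Small image volume bounds [jnorm] through [local_volume], but only while [f] stays within (1 -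
    |p|) / 4 of [p]; integrating that bound shows that it does stay there. [first_exit] closes the
    circle, and the strict inequality in [path_estimate] is its margin. *)
Lemma path_small (hn : (0 < n)%N) (K : R) : 1 <= K -> exists c5 C8 : R,
  [/\ 0 < c5, c5 <= 1 / 16, 0 < C8 & path_estimate K c5 C8].
Proof.
move=> K1; have n1 : 1 <= n%:R :> R by rewrite ler1n.
have [c5 [c6 [c50 c51 c60 Hv]]] := local_volume hn K1.
have n0 : 0 < n%:R :> R by lra.
exists c5, (n%:R ^+ 2 / (c6 * c5)); split => //; first by npos.
move=> f g H p z z' A s eta pB oA AB s0 eta0 sz sz' sA muA.
set a := 1 - enorm p in muA *; set b := _ * (eta * a) => hb.
have a0 : 0 < a by rewrite subr_gt0.
pose c (t : R) := z + t *: (z' - z).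
have zB : eball z by rewrite /eball/=; lra.
have z'B : eball z' by rewrite /eball/=; lra.
have cd (t : R) : 0 <= t <= 1 -> s <= 1 - enorm (c t).
  move=> /andP[t0 t1]; have := seg_enorm z z' t0 t1; rewrite -/(c t) le_max => /orP[] h; lra.
have cB (t : R) : 0 <= t <= 1 -> eball (c t) by move=> /cd; rewrite /eball/=; lra.
pose M := eta * a / (c6 * (c5 * s)).
have cs0 : 0 < c5 * s by npos.
have M0 : 0 <= M by apply: divr_ge0; [apply: mulr_ge0 => //; exact: ltW|nneg].
have Nt (t : R) : 0 <= t <= 1 -> enorm (f (c t) - p) <= a / 4 -> jnorm f (c t) <= M.
  move=> t01 ft; have cst : c5 * s <= c5 * (1 - enorm (c t)) by rewrite ler_pM2l// cd.
  have h1 := Hv f g H p (c t) (c5 * s) pB (cB t t01) ft cs0 cst.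
  have h2 : mu f p (eb (c t) (c5 * s)) <= mu f p A.
    by apply: (mu_mono H pB _ oA AB (sA t t01)); exact: open_eb.
  have h3 : c6 * (c5 * s * jnorm f (c t)) <= eta * a.
    apply: root_le => //.
    - by apply: mulr_ge0; [exact: ltW|apply: mulr_ge0; [exact: ltW|exact: jnorm_ge0]].
    - by apply: mulr_ge0 => //; exact: ltW.
    - exact: le_trans h1 (le_trans h2 muA).
  by rewrite /M ler_pdivlMr ?mulr_gt0// mulrC -mulrA.
have bE : b = n%:R * (n%:R * M * enorm (z' - z)).
  by rewrite /b /M; field; rewrite !gt_eqF.
have step (t : R) : 0 <= t <= 1 ->
    (forall u : R, 0 <= u <= t -> enorm (f (c u) - p) <= a / 4) -> enorm (f (c t) - f z) <= b.
  move=> /andP[t0 t1] hu.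
  have segE (u : R) : z + u *: (c t - z) = c (u * t).
    by rewrite /c addrAC subrr add0r scalerA.
  have ut (u : R) : 0 <= u <= 1 -> 0 <= u * t <= t by move=> /andP[u0 u1]; apply/andP; split; nra.
  have ut1 (u : R) : 0 <= u <= 1 -> 0 <= u * t <= 1.
    by move=> /ut/andP[h1 h2]; rewrite h1 (le_trans h2).
  have := @hqc_seg_le K f g z (c t) M H.
  move=> /(_ (fun u hu' => ltac:(rewrite segE; exact: cB (ut1 u hu')))).
  move=> /(_ (fun u hu' => ltac:(rewrite segE; exact: Nt (ut1 u hu') (hu _ (ut u hu'))))).
  move=> /le_trans; apply; rewrite bE; apply: ler_wpM2l => //; apply: ler_wpM2l; first by nneg.
  by rewrite /c addrAC subrr add0r enormZ ger0_norm// ler_piMl ?enorm_ge0.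
have c0E : c 0 = z by rewrite /c scale0r addr0.
have c1E : c 1 = z' by rewrite /c scale1r addrC subrK.
have b0 : 0 <= b by rewrite bE; apply: mulr_ge0 => //; apply: mulr_ge0; [nneg|exact: enorm_ge0].
rewrite -c1E; apply: (step 1); first by rewrite ler01 lexx.
have ccont (t : R) : 0 <= t <= 1 -> {for t, continuous (fun t => enorm (f (c t) - p))}.
  move=> t01; have cf := hqc_cont H (cB t t01).
  have h1 : {for t, continuous (fun t => f (c t))}.
    by apply: (@continuous_comp _ _ _ c f) => //; exact: seg_continuous.
  apply: (@continuous_comp _ _ _ (fun t => f (c t)) (fun y => enorm (y - p))) => //.
  exact: enormB_continuous.
apply: (@first_exit _ (fun t => enorm (f (c t) - p)) (a / 4) (enorm (f z - p) + b)).
- exact: hb.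
- by rewrite c0E; lra.
- exact: ccont.
move=> t t01 hu; have := step t t01 hu; have := enorm_tri (f z) (f (c t)) p; lra.
Qed.

End tents.

(** * Lower bounds for the image volumes of tents and annuli *)

Section modulus.
Context {R : realType} {n : nat}.
Implicit Types (x y z p q e : 'rV[R]_n) (f g : 'rV[R]_n -> 'rV[R]_n) (A T : set 'rV[R]_n).

(** [q] is the ratio of scales in [tent_volume]: q^n >= 1/2 matches a halving of volume, and the
    series of the q^k sums to 2 n. *)
Lemma bernoulli_half (hn : (0 < n)%N) : let q : R := 1 - (2 * n%:R)^-1 in
  [/\ 1 / 2 <= q, q < 1 & 1 / 2 <= q ^+ n].
Proof.
move=> q; have n1 : 1 <= n%:R :> R by rewrite ler1n.
have i0 : 0 < (2 * n%:R)^-1 :> R by rewrite invr_gt0; lra.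
have i1 : (2 * n%:R)^-1 <= 1 / 2 :> R by rewrite div1r lef_pV2 ?posrE; lra.
have q0 : 1 / 2 <= q by rewrite /q; lra.
split => //; first by rewrite /q; lra.
have H k : 1 - k%:R * (1 - q) <= q ^+ k.
  elim: k => [|k IH]; first by rewrite mul0r subr0.
  rewrite exprS -natr1; have k0 : 0 <= k%:R :> R by [].
  have : q * (1 - k%:R * (1 - q)) <= q * q ^+ k by rewrite ler_wpM2l//; lra.
  have : 0 <= k%:R * (1 - q) ^+ 2 by rewrite mulr_ge0// sqr_ge0.
  by move: (q ^+ k) k0 => Q; move: (k%:R : R) => M; move: (q) => r; nra.
apply: le_trans (H n); rewrite /q subKr le_eqVlt; apply/orP; left; apply/eqP; field.
by rewrite gt_eqF//; lra.
Qed.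

(** The factor 3 suits [children]: the child tents have radius D / 4 and centres at distance D, so
    they are disjoint, and 5/2 + 1/4 < 3, so they lie in the parent tent. *)
Definition tent z : set 'rV[R]_n := @eball R n `&` eb z (3 * defect z).

Lemma tent_open z : open (tent z).
Proof. by apply: openI; [exact: open_eball|exact: open_eb]. Qed.

Lemma tent_eball z : tent z `<=` @eball R n.
Proof. by move=> y []. Qed.

(** [g] is continuous on the compact ball of radius [r], so the defect attains a positive minimum on
    its image. *)
Lemma hqc_proper (K : R) f g (r : R) : hqc K f g -> r < 1 ->
  exists2 d : R, 0 < d & forall x, eball x -> enorm (f x) <= r -> d <= defect x.
Proof.
move=> H r1.
have rB : cb 0 r `<=` @eball R n by move=> y; rewrite /cb/eball/= subr0 => h; lra.
have [[y0 y0r]|noy] := pselect (exists y : 'rV[R]_n, cb 0 r y); last first.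
  exists 1 => // x xB fx; exfalso; apply: noy; exists (f x).
  by rewrite /cb/= subr0.
have cg : {within cb 0 r, continuous (fun y => defect (g y))}.
  apply: within_cont => y /rB yB; apply: contB; first exact: cont_cst.
  apply: contX; apply: (@continuous_comp _ _ _ g (fun x => enorm x)).
    exact: hqc_inv_cont H _ yB.
  exact: enorm_continuous.
have [y1] := compact_EVT_min (ex_intro _ y0 y0r) (@compact_cb _ _ 0 r) cg.
rewrite inE => y1r ymin; exists (defect (g y1)).
  by apply/eball_defect; apply: (hqc_inv_in H); exact: rB.
move=> x xB fx; have := ymin (f x); rewrite inE (hqc_fK H xB); apply.
by rewrite /cb/= subr0.
Qed.

(* If the tent over [z] had small image volume, then, descending each time to the child tent
   carrying at most half of the volume, [f] would converge along a sequence tending to the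
   sphere to a point of the open ball. *)
Lemma tent_volume (hn : (1 < n)%N) (K : R) : 1 <= K -> exists c5 C8 eps : R,
  [/\ 0 < c5, c5 <= 1 / 16, 0 < C8 & @path_estimate R n K c5 C8] /\
  [/\ 0 < eps, 60 * C8 * eps <= 1 / 16 &
    (forall f g, hqc K f g -> forall p z, eball p -> eball z ->
      enorm (f z - p) <= (1 - enorm p) / 8 -> (eps * (1 - enorm p)) ^+ n < mu f p (tent z))].
Proof.
move=> K1; have hn0 := ltnW hn; have n1 : 1 <= n%:R :> R by rewrite ler1n.
have [c5 [C8 [c50 c51 C80 Hp]]] := path_small hn0 K1.
pose N : R := 2 * n%:R.
(* Each move is at most 60 [s] long and [N] is the sum of the powers of [q]; this [eps] limits the
   total drift of [f] to [a / 16]. *)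
pose eps : R := (16 * 60 * C8 * N)^-1.
have N0 : 2 <= N by rewrite /N; lra.
have eps0 : 0 < eps by rewrite /eps invr_gt0; npos; lra.
have epsE : 60 * C8 * eps * N = 1 / 16 by rewrite /eps; field; rewrite !gt_eqF//; lra.
have c0 : 0 < 60 * C8 * eps by npos.
exists c5, C8, eps; split; [by split|split => //; first by nra].
move=> f g H p z pB zB fzp; rewrite ltNge; apply/negP => muz.
set a := 1 - enorm p in fzp muz *.
have a0 : 0 < a by rewrite subr_gt0.
have [q0 q1 qn] := bernoulli_half hn0.
set q : R := 1 - (2 * n%:R)^-1 in q0 q1 qn.
have qN : (1 - q) * N = 1 by rewrite /q subKr -/N mulVf// gt_eqF//; lra.
(* One descent. Of two disjoint child tents, one carries at most half of the volume, within the
   allowed ratio q^n; the drift so far is the partial sum N (1 - q^k) of the geometric series. *)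
have step k (w : 'rV[R]_n) : eball w -> mu f p (tent w) <= (eps * q ^+ k * a) ^+ n ->
    enorm (f w - p) <= a / 8 + 60 * C8 * eps * a * (N * (1 - q ^+ k)) ->
    exists w', [/\ eball w', defect w' = defect w / 12,
      mu f p (tent w') <= (eps * q ^+ k.+1 * a) ^+ n &
      enorm (f w' - p) <= a / 8 + 60 * C8 * eps * a * (N * (1 - q ^+ k.+1))].
  move=> wB muw fw.
  have [D0 D1 Dl Du] := defect_bounds wB.
  have [w1 [w2 [d1 d2 e1 e2 e12]]] := children hn wB.
  set D := defect w in D0 D1 Dl Du d1 d2 e1 e2 e12 *.
  have w1B : eball w1 by apply/eball_defect; lra.
  have w2B : eball w2 by apply/eball_defect; lra.
  have qk0 : 0 < q ^+ k by rewrite exprn_gt0//; lra.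
  have qk1 : q ^+ k <= 1 by rewrite exprn_ile1//; clear -q0 q1; lra.
  have sub w' : defect w' = D / 12 -> enorm (w' - w) <= 5 / 2 * D -> tent w' `<=` tent w.
    move=> dw' ew' y [yB yw']; split => //; move: yw'; rewrite /eb/= dw' -/D.
    by have := enorm_tri w' y w; lra.
  have dj y : tent w1 y -> tent w2 y -> False.
    move=> [_ h1] [_ h2]; move: h1 h2; rewrite /eb/= d1 d2.
    by have := enorm_tri y w1 w2; rewrite e12 (enormBC w1 y); lra.
  have msum := mu_disjoint H pB (@tent_open w1) (@tent_open w2) (@tent_open w) (@tent_eball w)
    (sub w1 d1 e1) (sub w2 d2 e2) dj.
  have Enn : 0 <= (eps * q ^+ k * a) ^+ n by rewrite exprn_ge0//; apply: ltW; npos.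
  have half : (eps * q ^+ k * a) ^+ n / 2 <= (eps * q ^+ k.+1 * a) ^+ n.
    rewrite (_ : eps * q ^+ k.+1 * a = q * (eps * q ^+ k * a)); last by rewrite exprS; ring.
    by rewrite [leRHS]exprMn [leLHS]mulrC ler_wpM2r//; lra.
  have [w' [w'B dw' ew' mw']] : exists w', [/\ eball w', defect w' = D / 12,
      enorm (w' - w) <= 5 / 2 * D & mu f p (tent w') <= (eps * q ^+ k.+1 * a) ^+ n].
    have [h|h] := leP (mu f p (tent w1)) ((eps * q ^+ k * a) ^+ n / 2).
      by exists w1; split => //; exact: le_trans half.
    by exists w2; split => //; apply: le_trans half; clear -msum muw h; lra.
  exists w'; split => //.
  have [D0' D1' Dl' Du'] := defect_bounds w'B.
  (* The child has defect [D / 12], hence distance at least [D / 24] from the sphere; its distance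
     to [w], at most [5 / 2 * D], is then at most [60 * s]. *)
  pose s := D / 24.
  have s0 : 0 < s by rewrite /s; clear -D0; lra.
  have sw : s <= 1 - enorm w by rewrite /s; clear -D0 Du; lra.
  have sw' : s <= 1 - enorm w' by rewrite /s; clear -D0 dw' Du'; lra.
  have c5s : c5 * s <= D / 24 / 16 by rewrite /s; clear -c50 c51 D0; nra.
  have segA (t : R) : 0 <= t <= 1 -> eb (w + t *: (w' - w)) (c5 * s) `<=` tent w.
    move=> /andP[t0 t1] y yt; move: (yt); rewrite /eb/= => yt'; split.
      have c5s' : c5 * s <= s by clear -c51 s0; nra.
      by apply: eb_eball yt; have := seg_enorm w w' t0 t1; rewrite le_max => /orP[] h; clear -h c5s' sw sw'; lra.
    rewrite /eb/= -/D; apply: (le_lt_trans (enorm_tri (w + t *: (w' - w)) _ _)).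
    rewrite addrAC subrr add0r enormZ ger0_norm//.
    by have := enorm_ge0 (w' - w); clear -t0 t1 ew' D0 yt' c5s; nra.
  have rat : enorm (w' - w) / s <= 60 by rewrite ler_pdivrMr// /s; clear -ew' D0; lra.
  have rat0 : 0 <= enorm (w' - w) / s by rewrite divr_ge0 ?enorm_ge0// ltW.
  have eta0 : 0 <= eps * q ^+ k by apply: ltW; npos.
  have bd : C8 * (enorm (w' - w) / s) * (eps * q ^+ k * a) <= 60 * C8 * eps * a * q ^+ k.
    have h0 : 0 <= C8 * (eps * q ^+ k * a) by nneg.
    have := ler_wpM2l h0 rat.
    by congr (_ <= _); ring.
  have key : 60 * C8 * eps * a * (N * (1 - q ^+ k)) + 60 * C8 * eps * a * q ^+ k <=
      60 * C8 * eps * a * (N * (1 - q ^+ k.+1)).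
    rewrite -mulrDr; apply: ler_wpM2l; first by nneg.
    rewrite exprS; have : (1 - q) * N * q ^+ k = q ^+ k by rewrite qN mul1r.
    by set Q := q ^+ k; move=> h; clear -h; lra.
  have top : 60 * C8 * eps * a * (N * (1 - q ^+ k.+1)) <= a / 16.
    have -> : 60 * C8 * eps * a * (N * (1 - q ^+ k.+1)) = (60 * C8 * eps * N) * a * (1 - q ^+ k.+1) by ring.
    rewrite epsE; have : 0 < q ^+ k.+1 by rewrite exprn_gt0//; clear -q0; lra.
    by set Q := q ^+ k.+1; clear -a0; nra.
  have hlt : enorm (f w - p) + C8 * (enorm (w' - w) / s) * (eps * q ^+ k * a) < a / 4 by clear -fw bd key top a0; lra.
  have := Hp f g H p w w' (tent w) s (eps * q ^+ k) pB (@tent_open w) (@tent_eball w) s0 eta0 sw sw'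
    segA muw hlt.
  have := enorm_tri (f w) (f w') p; rewrite -/a => h1 h2; clear -h1 h2 fw bd key; lra.
have seqn k : exists w, [/\ eball w, defect w = defect z / 12 ^+ k,
      mu f p (tent w) <= (eps * q ^+ k * a) ^+ n &
      enorm (f w - p) <= a / 8 + 60 * C8 * eps * a * (N * (1 - q ^+ k))].
  elim: k => [|k [w [wB dw mw fw]]].
    by exists z; rewrite !expr0 divr1 mulr1 subrr !mulr0 addr0.
  have [w' [w'B dw' mw' fw']] := step k w wB mw fw; exists w'; split => //.
  by rewrite dw' dw exprS invfM; ring.
(* The images of all these points stay in the ball of radius |p| + a / 4, although their defects
   tend to 0: a contradiction with properness. *)
have r1 : enorm p + a / 4 < 1 by rewrite /a in a0 *; lra.
have [d d0 Hd] := hqc_proper H r1.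
have [D0 D1 _ _] := defect_bounds zB.
pose k := Num.trunc (d^-1).
have kd : k.+1%:R^-1 < d :> R by rewrite invf_plt ?posrE ?ltr0n//; exact: truncnS_gt.
have [w [wB dw _ fw]] := seqn k.+1.
have qk0 : 0 < q ^+ k.+1 by rewrite exprn_gt0//; lra.
have : d <= defect w.
  apply: Hd => //; have := enorm_lerB (f w) p.
  have top : 60 * C8 * eps * a * (N * (1 - q ^+ k.+1)) <= a / 16.
    have -> : 60 * C8 * eps * a * (N * (1 - q ^+ k.+1)) = (60 * C8 * eps * N) * a * (1 - q ^+ k.+1) by ring.
    by rewrite epsE; set Q := q ^+ k.+1 in qk0 *; nra.
  by lra.
rewrite dw leNgt => /negP; apply; apply: le_lt_trans kd.
have h12 : k.+1%:R <= 12 ^+ k.+1 :> R.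
  by rewrite -natrX ler_nat ltnW// ltn_expl.
apply: (@le_trans _ _ (1 / 12 ^+ k.+1)).
  by rewrite ler_pM2r// invr_gt0 exprn_gt0.
by rewrite div1r lef_pV2 ?posrE ?exprn_gt0 ?ltr0n.
Qed.

(** If [e] is near the sphere compared with its distance [t] to [x], the tent over [e] lies in the
    annulus. Otherwise a child [w] of [e] is used: were the image of the annulus small,
    [path_estimate] would keep [f w] close to [f e], and [tent_volume] at [w] would contradict the
    smallness. *)
Lemma annulus_volume_gen (hn : (1 < n)%N) (K : R) : 1 <= K -> exists2 eps : R, 0 < eps &
  forall f g, hqc K f g -> forall x e (tau ups : R), eball x -> eball e ->
  defect x <= tau -> 10 * tau <= enorm (e - x) / 96 -> 20 * enorm (e - x) <= ups ->
  (eps * (1 - enorm (f e))) ^+ n < mu f (f e) (@eball R n `&`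
    [set y | tau < enorm (y - x) < ups]).
Proof.
move=> K1; have [c5 [C8 [eps [[c50 c51 C80 Hp] [eps0 epsC Ht]]]]] := tent_volume hn K1.
exists eps => // f g H x e tau ups xB eB; set t := enorm (e - x) => xtau taut tups.
set A := _ `&` _.
have [D0 D1 Dl Du] := defect_bounds eB; have [d0 d1 dl du] := defect_bounds xB.
set D := defect e in D0 D1 Dl Du *.
have pB := hqc_in H eB; set p := f e in pB *.
have a0 : 0 < 1 - enorm p by rewrite subr_gt0.
have t0 : 0 < t by lra.
have tau0 : 0 < tau by lra.
have oA : open A.
  apply: openI; first exact: open_eball.
  rewrite (_ : [set y | _] = ((fun y => enorm (y - x)) @^-1` [set u | tau < u]) `&`
     ((fun y => enorm (y - x)) @^-1` [set u | u < ups])); last first.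
    by apply/seteqP; split=> y /= => [/andP[]|[h1 h2]]//; apply/andP.
  by apply: openI; apply: open_comp => // y _; exact: cont_enormB.
have AB : A `<=` @eball R n by move=> y [].
have [Dt|Dt] := leP D (t / 4).
  have ee : enorm (f e - p) <= (1 - enorm p) / 8 by rewrite subrr enorm0; lra.
  apply: (lt_le_trans (Ht f g H p e pB eB ee)).
  apply: (mu_mono H pB (@tent_open e) oA AB) => y [yB ye]; split => //; apply/andP.
  move: ye; rewrite /eb/= -/D => ye.
  have := enorm_tri y e x; have := enorm_tri e y x; rewrite (enormBC e y) -/t => h1 h2.
  by split; lra.
have Dle : D <= defect x + 2 * t by exact: defect_lip.
have [w1 [w2 [d1' d2' e1 e2 e12]]] := children hn eB.
rewrite -/D in d1' d2' e1 e2 e12.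
(* The child tents are more than [2 * tau] apart, so at most one of them meets the small ball around
   [x]. *)
have [w [wB dw ew far]] : exists w, [/\ eball w, defect w = D / 12,
    enorm (w - e) <= 5 / 2 * D & forall y, tent w y -> tau < enorm (y - x)].
  have [h|/existsNP[y /not_implyP[y1 /negP]]] :=
    pselect (forall y, tent w1 y -> tau < enorm (y - x)).
    by exists w1; split => //; apply/eball_defect; lra.
  rewrite -leNgt => yx; exists w2; split => //; first by apply/eball_defect; lra.
  move=> y' y2; rewrite ltNge; apply/negP => y'x.
  move: y1 y2 => [_ y1] [_ y2]; move: y1 y2; rewrite /eb/= d1' d2' => y1 y2.
  have h1 := enorm_tri y w1 w2; have h2 := enorm_tri x y w2; have h3 := enorm_tri y' x w2.
  rewrite e12 (enormBC w1 y) in h1; rewrite (enormBC x y') in h3.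
  by clear -h1 h2 h3 y1 y2 y'x yx Dt D0 taut xtau t0 tau0; lra.
rewrite ltNge; apply/negP => muA.
have [D0' D1' Dl' Du'] := defect_bounds wB.
pose s := D / 24.
have s0 : 0 < s by rewrite /s; clear -D0; lra.
have se : s <= 1 - enorm e by rewrite /s; clear -D0 Du; lra.
have sw : s <= 1 - enorm w by rewrite /s; clear -D0 dw Du'; lra.
have c5s : c5 * s <= D / 24 / 16 by rewrite /s; clear -c50 c51 D0; nra.
(* The tube avoids [x] because its axis is at least [D / 24] from the sphere while [x] is within
   [tau] of it. As [D > t / 4], this gives [t / 96], whence the 96 in the hypothesis. *)
have segA (u : R) : 0 <= u <= 1 -> eb (e + u *: (w - e)) (c5 * s) `<=` A.
  move=> /andP[u0 u1] y yt; move: (yt); rewrite /eb/= => yt'.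
  have su : s <= 1 - enorm (e + u *: (w - e)).
    by have := seg_enorm e w u0 u1; rewrite le_max => /orP[] h; clear -h se sw; lra.
  split; first by apply: eb_eball yt; rewrite /s in su; clear -su c5s D0; lra.
  have h1 : enorm (e + u *: (w - e) - x) <= t + 5 / 2 * D.
    apply: (le_trans (enorm_tri e _ _)); rewrite addrAC subrr add0r enormZ ger0_norm//.
    by have := enorm_ge0 (w - e); rewrite -/t; clear -u0 u1 ew D0; nra.
  have h2 : s - (1 - enorm x) <= enorm (e + u *: (w - e) - x).
    by have := enorm_lerB x (e + u *: (w - e)); rewrite enormBC; clear -su; lra.
  have h3 := enorm_tri (e + u *: (w - e)) y x.
  have h4 := enorm_tri y (e + u *: (w - e)) x; rewrite (enormBC _ y) in h4.
  by apply/andP; rewrite /s in h2; clear -h1 h2 h3 h4 yt' taut tups xtau tau0 t0 Dt Dle D0 dl du d0 c5s c50; split; lra.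
have rat : enorm (w - e) / s <= 60 by rewrite ler_pdivrMr// /s; clear -ew D0; lra.
have bd : C8 * (enorm (w - e) / s) * (eps * (1 - enorm p)) <= (1 - enorm p) / 16.
  have h0 : 0 <= C8 * (eps * (1 - enorm p)) by nneg.
  have := ler_wpM2l h0 rat.
  have -> : C8 * (eps * (1 - enorm p)) * (enorm (w - e) / s) =
     C8 * (enorm (w - e) / s) * (eps * (1 - enorm p)) by ring.
  have -> : C8 * (eps * (1 - enorm p)) * 60 = (60 * C8 * eps) * (1 - enorm p) by ring.
  by move=> h; clear -h epsC a0; nra.
have hlt : enorm (f e - p) + C8 * (enorm (w - e) / s) * (eps * (1 - enorm p)) < (1 - enorm p) / 4.
  by rewrite subrr enorm0; clear -bd a0; lra.
have few := Hp f g H p e w A s eps pB oA AB s0 (ltW eps0) se sw segA muA hlt.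
have few' : enorm (f w - p) <= (1 - enorm p) / 8 by rewrite -/p in few; clear -few bd a0; lra.
have := Ht f g H p w pB wB few'.
rewrite ltNge => /negP; apply; apply: le_trans muA.
apply: (mu_mono H pB (@tent_open w) oA AB) => y yw; split; first exact: tent_eball yw.
have h1 := far y yw; move: yw => [_]; rewrite /eb/= dw => h2.
apply/andP; split => //.
have := enorm_tri w y x; have := enorm_tri e w x; rewrite -/t; clear -h2 ew Dt Dle D0 D1 d0 d1 dl du t0 tups taut xtau; lra.
Qed.

Lemma annulus_volume (hn : (1 < n)%N) (K : R) : 1 <= K -> exists L eps : R,
  [/\ 2 <= L, 0 < eps & forall f g, hqc K f g -> forall x e, eball x -> eball e ->
  L * defect x <= enorm (e - x) ->
  (eps * (1 - enorm (f e))) ^+ n < mu f (f e) (@eball R n `&`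
    [set y | enorm (e - x) / L < enorm (y - x) < L * enorm (e - x)])].
Proof.
(* The two radius conditions ask for 1000 >= 10 * 96 and 1000 >= 20. *)
move=> K1; have [eps eps0 He] := annulus_volume_gen hn K1; exists 1000, eps.
split=> //; first by rewrite ler_nat.
move=> f g H x e xB eB tx; have := enorm_ge0 (e - x) => t0.
by apply: (He f g H) => //; clear He; move: (enorm (e - x)) (defect x) t0 tx => t d t0 tx; clear -t0 tx; lra.
Qed.

End modulus.

(** * Counting annuli *)

Section holder.
Context {R : realType} {n : nat}.
Implicit Types (x y z p q e : 'rV[R]_n) (f g : 'rV[R]_n -> 'rV[R]_n) (A T : set 'rV[R]_n).

Lemma powR_le (a b al : R) : 0 < al -> 0 <= a -> a <= b -> a `^ al <= b `^ al.
Proof.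
move=> al0 a0 ab; apply: (@ge0_ler_powR _ al (ltW al0)) => //; rewrite nnegrE//.
exact: le_trans ab.
Qed.

(** Intermediate value theorem along the preimage of the segment from [f x] to [f y0]. Points lying
    over a segment are chosen because the norm is convex on it, which controls [1 - |f e|]. *)
Lemma lifted_segment_hits (K : R) f g x y0 (t : R) : hqc K f g -> eball x -> eball y0 ->
  0 <= t -> t <= enorm (y0 - x) -> exists e, [/\ eball e, enorm (e - x) = t &
    exists2 u : R, 0 <= u <= 1 & f e = f x + u *: (f y0 - f x)].
Proof.
move=> H xB yB t0 ty; pose c (u : R) := f x + u *: (f y0 - f x).
have fxB : eb 0 1 (f x) by rewrite -eball_eb; exact: hqc_in H _ xB.
have fyB : eb 0 1 (f y0) by rewrite -eball_eb; exact: hqc_in H _ yB.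
have cB (u : R) : 0 <= u <= 1 -> eball (c u).
  by move=> /andP[u0 u1]; rewrite eball_eb; exact: seg_in_eb.
pose phi (u : R) := enorm (g (c u) - x).
have cphi : {within `[0, 1], continuous phi}.
  apply: continuous_in_subspaceT => u; rewrite inE/= in_itv/= => u01.
  apply: (@continuous_comp _ _ _ (fun u => g (c u)) (fun y => enorm (y - x))); last exact: enormB_continuous.
  apply: (@continuous_comp _ _ _ c g); first exact: seg_continuous.
  exact: hqc_inv_cont H _ (cB _ u01).
have phi0 : phi 0 = 0 by rewrite /phi /c scale0r addr0 (hqc_fK H xB) subrr enorm0.
have phi1 : phi 1 = enorm (y0 - x).
  by rewrite /phi /c scale1r [f x + _]addrC subrK (hqc_fK H yB).
have [] := @IVT R phi 0 1 t ler01 cphi.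
  by rewrite phi0 phi1 ge_min le_max t0 ty orbT.
move=> u; rewrite in_itv/= => u01 pu.
exists (g (c u)); split => //; first exact: hqc_inv_in H _ (cB _ u01).
by exists u => //; rewrite (hqc_gK H (cB _ u01)).
Qed.

(** The [N] annuli around [x] with radii in ratio [L ^+ 2] are disjoint and so are their images;
    each image takes at least (eps m)^n from the volume of [eb p l], which is at most (2 l)^n. *)
Lemma annuli_count (hn : (1 < n)%N) (K : R) : 1 <= K -> exists L eps : R,
  [/\ 2 <= L, 0 < eps & forall f g, hqc K f g -> forall x y0 p (N : nat) (m l : R),
  eball x -> eball y0 -> 0 <= m -> 0 <= l ->
  L ^+ (2 * N) * defect x <= enorm (y0 - x) ->
  (forall e, eball e -> (exists2 u : R, 0 <= u <= 1 & f e = f x + u *: (f y0 - f x)) ->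
    enorm (e - x) <= L ^+ (2 * N) * defect x ->
    m <= 1 - enorm (f e) /\ eb (f e) ((1 - enorm (f e)) / 2) `<=` eb p l) ->
  N%:R * (eps * m) ^+ n <= (2 * l) ^+ n].
Proof.
move=> K1; have [L [eps [L2 eps0 Hv]]] := annulus_volume hn K1.
exists L, eps; split => // f g H x y0 p N m l xB yB m0 l0 far Hseg.
have [D0 _ _ _] := defect_bounds xB; set D := defect x in D0 far Hseg *.
have L1 : 1 <= L by lra.
have L0 : 0 < L by lra.
(* The geometric mean of the two radii of the annulus with index [k]. *)
pose t k := L ^+ (2 * k).+1 * D.
have tN k : (k < N)%N -> t k <= L ^+ (2 * N) * D.
  by move=> kN; rewrite ler_pM2r//; apply: ler_weXn2l => //; lia.
have ex k : exists e, (k < N)%N -> [/\ eball e, enorm (e - x) = t k &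
    exists2 u : R, 0 <= u <= 1 & f e = f x + u *: (f y0 - f x)].
  have [kN|kN] := boolP (k < N)%N; last by exists 0.
  have tk0 : 0 <= t k by rewrite /t; nneg.
  have [e he] := lifted_segment_hits H xB yB tk0 (le_trans (tN k kN) far).
  by exists e.
have [e he] := choice ex.
pose A k := @eball R n `&` [set y | L ^+ (2 * k) * D < enorm (y - x) < L ^+ (2 * k.+1) * D].
have oA k : open (A k).
  apply: openI; first exact: open_eball.
  rewrite (_ : [set y | _] = ((fun y => enorm (y - x)) @^-1` [set u | L ^+ (2 * k) * D < u]) `&`
     ((fun y => enorm (y - x)) @^-1` [set u | u < L ^+ (2 * k.+1) * D])); last first.
    by apply/seteqP; split=> y /= => [/andP[]|[h1 h2]]//; apply/andP.
  by apply: openI; apply: open_comp => // y _; exact: cont_enormB.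
have AB k : A k `<=` @eball R n by move=> y [].
have hk k : (k < N)%N -> [/\ m <= 1 - enorm (f (e k)),
    eb (f (e k)) ((1 - enorm (f (e k))) / 2) `<=` eb p l &
    (eps * (1 - enorm (f (e k)))) ^+ n < mu f (f (e k)) (A k)].
  move=> kN; have [eB et eu] := he k kN.
  have ekN : enorm (e k - x) <= L ^+ (2 * N) * D by rewrite et tN.
  have [mk lk] := Hseg _ eB eu ekN; split => //.
  have := Hv f g H x (e k) xB eB; rewrite -/D et.
  have -> : t k / L = L ^+ (2 * k) * D by rewrite /t exprS; field; rewrite gt_eqF.
  have -> : L * t k = L ^+ (2 * k.+1) * D by rewrite /t mulrA -exprS mulnS.
  apply; rewrite /t exprS -mulrA ler_pM2l// ler_peMl ?(ltW D0)//.
  exact: exprn_ege1.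
pose F k := if (k < N)%N then f @` (A k) `&` eb (f (e k)) ((1 - enorm (f (e k))) / 2) else set0.
have oF k : open (F k).
  by rewrite /F; case: ifP => _; [exact: mu_open H (oA k) (@AB k)|exact: open0].
have FT k : (k < N)%N -> F k `<=` eb p l.
  by move=> kN; rewrite /F kN => y [_]; have [_ + _] := hk k kN; apply.
have dj j k y : (j < N)%N -> (k < N)%N -> F j y -> F k y -> j = k.
  move=> jN kN; rewrite /F jN kN => -[[y1 A1 <-] _] [[y2 A2 y21] _].
  have y12 : y1 = y2 by rewrite -(hqc_fK H (AB _ _ A1)) -(hqc_fK H (AB _ _ A2)) y21.
  rewrite -y12 in A2; move: A1 A2 => [_ /= /andP[h1 h2]] [_ /= /andP[h3 h4]].
  have aux i i' : (i < i')%N -> L ^+ (2 * i.+1) * D <= L ^+ (2 * i') * D.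
    by move=> ii'; rewrite ler_pM2r//; apply: ler_weXn2l => //; rewrite leq_mul2l.
  have [jk|kj|//] := ltngtP j k.
    by exfalso; have := aux _ _ jk; move: h2 h3; clear; lra.
  by exfalso; have := aux _ _ kj; move: h1 h4; clear; lra.
have vs := vol_sum l0 oF (@open_eb _ _ p l) (fun y h => h) FT dj.
have vu := vol_upper l0 (@open_eb _ _ p l) (fun y (h : eb p l y) => h).
apply: le_trans vu; apply: le_trans vs.
rewrite -[X in X%:R * _](card_ord N) -sum1_card natr_sum mulr_suml.
apply: ler_sum => k _; rewrite mul1r.
have [mk _ vk] := hk k (ltn_ord k).
rewrite /F ltn_ord; apply: le_trans (ltW vk).
rewrite lerXn2r ?nnegrE//; [nneg|apply: mulr_ge0; lra|].
by rewrite ler_pM2l.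
Qed.

(* A chain of points along which [1 - |f|] at least doubles while the distance to the sphere
   is multiplied by a bounded factor gives the Hoelder bound. *)
Lemma boundary_holder (hn : (1 < n)%N) (K d : R) : 1 <= K -> 0 < d ->
  exists C al : R, [/\ 0 < C, 0 < al &
  forall f g, hqc K f g -> d <= 1 - enorm (f 0) ->
  forall x, eball x -> 1 - enorm (f x) <= C * defect x `^ al].
Proof.
move=> K1 d0; have [L [eps [L2 eps0 Hc]]] := annuli_count hn K1.
have L1 : 1 <= L by lra.
have L0 : 0 < L by lra.
have B0 : @eball R n 0 by rewrite /eball/= enorm0.
have large (c : R) : 0 < c -> forall b : R, exists N : nat, b < N%:R * c.
  move=> c0 b; exists (Num.trunc (b / c)).+1; rewrite -ltr_pdivrMr//; exact: truncnS_gt.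
(* Here [d] enters: on the segment from [f x] to [f 0] one has 1 - |.| >= min (1/2) d, so too many
   annuli would overfill the unit ball. *)
have [c00 c0p base] : exists2 c0 : R, 0 < c0 & forall f g, hqc K f g -> d <= 1 - enorm (f 0) ->
    forall x, eball x -> enorm (f x) <= 1 / 2 -> c0 <= defect x.
  pose m : R := Num.min (1 / 2) d.
  have m0 : 0 < m by rewrite lt_min d0 divr_gt0.
  have e0 : 0 < (eps * m) ^+ n by npos.
  have [N hN] := large _ e0 ((2 * 1) ^+ n).
  exists ((L ^+ (2 * N))^-1 / 2); first by rewrite divr_gt0// invr_gt0 exprn_gt0.
  move=> f g H fd x xB fx; rewrite leNgt; apply/negP => xs.
  have [D0 D1 Dl Du] := defect_bounds xB.
  have LN : 1 <= L ^+ (2 * N) by exact: exprn_ege1.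
  have LN0 : 0 < L ^+ (2 * N) by lra.
  have LD : L ^+ (2 * N) * defect x < 1 / 2.
    by move: xs; rewrite -(ltr_pM2l LN0) mulrA mulfV ?gt_eqF// div1r mul1r.
  have xh : 1 / 2 <= enorm x.
    have : defect x <= L ^+ (2 * N) * defect x by rewrite ler_peMl// ltW.
    by move: Dl LD; clear; lra.
  have far : L ^+ (2 * N) * defect x <= enorm (0 - x) by rewrite sub0r enormN; lra.
  have := Hc f g H x 0 0 N m 1 xB B0 (ltW m0) ler01 far.
  have Hseg e : eball e -> (exists2 u : R, 0 <= u <= 1 & f e = f x + u *: (f 0 - f x)) ->
    enorm (e - x) <= L ^+ (2 * N) * defect x ->
    m <= 1 - enorm (f e) /\ eb (f e) ((1 - enorm (f e)) / 2) `<=` eb 0 1.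
    move=> eB [u /andP[u0 u1] fe] _; split.
      have := seg_enorm (f x) (f 0) u0 u1; rewrite -fe le_max => /orP[] h.
        by rewrite ge_min; apply/orP; left; lra.
      by rewrite ge_min; apply/orP; right; lra.
    move=> q; rewrite /eb/= subr0 => qe.
    have := enorm_lerB q (f e); have := hqc_in H eB; rewrite /eball/=; lra.
  by move=> /(_ Hseg); rewrite leNgt hN.
have e0 : 0 < eps ^+ n by npos.
have [N hN] := large _ e0 ((2 * 2) ^+ n).
(* By [defect_lip], points within [L ^+ (2 * N) * defect x] of [x] have defect at most
   [M * defect x]. *)
pose M : R := 1 + 2 * L ^+ (2 * N).
have LN : 1 <= L ^+ (2 * N) by exact: exprn_ege1.
have M1 : 3 <= M by rewrite /M; lra.
have double f g : hqc K f g -> forall x, eball x -> 1 - enorm (f x) <= 1 / 2 ->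
    exists e, [/\ eball e, defect e <= M * defect x & 2 * (1 - enorm (f x)) <= 1 - enorm (f e)].
  move=> H x xB fx; apply: contrapT => no.
  have small e : eball e -> defect e <= M * defect x -> 1 - enorm (f e) < 2 * (1 - enorm (f x)).
    by move=> eB de; rewrite ltNge; apply/negP => fe; apply: no; exists e.
  have [D0 D1 Dl Du] := defect_bounds xB.
  have gB : eball (g 0) by exact: hqc_inv_in H _ B0.
  have fg : f (g 0) = 0 by exact: hqc_gK H _ B0.
  (* [f (g 0) = 0] and 1 - |f x| <= 1/2, so [g 0] would itself be a doubling point if its defect
     were small. *)
  have dg : M * defect x < defect (g 0).
    rewrite ltNge; apply/negP => /(small _ gB); rewrite fg enorm0; lra.
  have far : L ^+ (2 * N) * defect x <= enorm (g 0 - x).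
    have := defect_lip xB gB; move: dg; rewrite /M; lra.
  have a0 : 0 < 1 - enorm (f x) by rewrite subr_gt0; exact: hqc_in H _ xB.
  have l0 : 0 <= 2 * (1 - enorm (f x)) by lra.
  have := Hc f g H x (g 0) (f x) N (1 - enorm (f x)) (2 * (1 - enorm (f x))) xB gB (ltW a0) l0 far.
  have Hseg e : eball e -> (exists2 u : R, 0 <= u <= 1 & f e = f x + u *: (f (g 0) - f x)) ->
    enorm (e - x) <= L ^+ (2 * N) * defect x ->
    1 - enorm (f x) <= 1 - enorm (f e) /\
    eb (f e) ((1 - enorm (f e)) / 2) `<=` eb (f x) (2 * (1 - enorm (f x))).
    move=> eB [u /andP[u0 u1]]; rewrite fg sub0r => fe ex.
    have de : defect e <= M * defect x by have := defect_lip xB eB; rewrite /M; lra.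
    have se := small e eB de.
    have fn : enorm (f e) = (1 - u) * enorm (f x).
      rewrite fe scalerN -[X in X - _]scale1r -scalerBl enormZ ger0_norm//; lra.
    have fxn := enorm_ge0 (f x).
    have fd : enorm (f e - f x) = u * enorm (f x).
      by rewrite fe addrAC subrr add0r scalerN enormN enormZ ger0_norm.
    split; first by nra.
    move=> q; rewrite /eb/= => qe; have := enorm_tri (f e) q (f x); nra.
  move=> /(_ Hseg); rewrite (mulrA 2 2) !(exprMn _ _ (_ - _)) mulrA.
  by rewrite ler_pM2r ?exprn_gt0// leNgt hN.
have lnM : 0 < ln M by apply: ln_gt0; lra.
have ln2 : 0 < ln 2 :> R by apply: ln_gt0; lra.
(* The exponent with M^al = 2: one doubling of [1 - |f|] pays for one factor [M] in the defect. *)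
pose al : R := ln 2 / ln M.
have al0 : 0 < al by exact: divr_gt0.
have Mal : M `^ al = 2.
  rewrite /powR gt_eqF; last by lra.
  by rewrite /al divfK ?lnK ?posrE// gt_eqF.
pose C : R := (c00 `^ al)^-1.
have cal0 : 0 < c00 `^ al by exact: powR_gt0.
have C0 : 0 < C by rewrite invr_gt0.
exists C, al; split => // f g H fd.
(* [m] bounds the number of doublings still possible; [base] ends the chain once |f x| <= 1/2. *)
have ind (m : nat) : forall x, eball x -> 1 <= 2 ^+ m * (1 - enorm (f x)) ->
    1 - enorm (f x) <= C * defect x `^ al.
  elim: m => [|m IH] x xB hx.
    have := enorm_ge0 (f x); rewrite expr0 mul1r in hx => h.
    have fx0 : enorm (f x) <= 1 / 2 by lra.
    have := base f g H fd x xB fx0 => cD.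
    have : c00 `^ al <= defect x `^ al by apply: powR_le => //; exact: ltW.
    rewrite -(ler_pM2l C0) /C mulVf ?gt_eqF//; lra.
  have [fx|fx] := leP (1 - enorm (f x)) (1 / 2); last first.
    have fx0 : enorm (f x) <= 1 / 2 by lra.
    have := base f g H fd x xB fx0 => cD.
    have : c00 `^ al <= defect x `^ al by apply: powR_le => //; exact: ltW.
    rewrite -(ler_pM2l C0) /C mulVf ?gt_eqF//; have := enorm_ge0 (f x); lra.
  have [e [eB de fe]] := double f g H x xB fx.
  have [De0 _ _ _] := defect_bounds eB; have [Dx0 _ _ _] := defect_bounds xB.
  have he : 1 <= 2 ^+ m * (1 - enorm (f e)).
    apply: (le_trans hx); rewrite exprS mulrAC -mulrA [2 * _]mulrC -mulrA mulrC.
    by rewrite -mulrA ler_pM2l ?exprn_gt0.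
  have h1 := IH e eB he.
  have h2 : defect e `^ al <= 2 * defect x `^ al.
    rewrite -Mal -powRM; [|lra|lra].
    by apply: powR_le => //; exact: ltW.
  have h3 : C * defect e `^ al <= C * (2 * defect x `^ al) by rewrite ler_pM2l.
  by clear -fe h1 h3; lra.
move=> x xB; have a0 : 0 < 1 - enorm (f x) by rewrite subr_gt0; exact: hqc_in H _ xB.
have [m hm] : exists m : nat, 1 <= 2 ^+ m * (1 - enorm (f x)).
  exists (Num.trunc ((1 - enorm (f x))^-1)).+1; set k := (Num.trunc _).+1.
  have kb : (1 - enorm (f x))^-1 < k%:R by exact: truncnS_gt.
  have k2 : k%:R <= 2 ^+ k :> R by rewrite -natrX ler_nat ltnW// ltn_expl.
  by rewrite -ler_pdivrMr// div1r (le_trans (ltW kb)).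
exact: ind m x xB hm.
Qed.

End holder.

(** * From Hoelder to Lipschitz *)

Section bootstrap.
Context {R : realType} {n : nat}.
Implicit Types (x y z p q e : 'rV[R]_n) (f g : 'rV[R]_n -> 'rV[R]_n).

(** Normalised to be the negative Laplacian of 1 - |f|^2. *)
Definition grad2 f x : R := 2 * \sum_j \sum_i partial i (fun y => f y 0 j) x ^+ 2.

Lemma lap_sum (I : finType) (F : I -> 'rV[R]_n -> R) x (L : I -> R) :
  (forall i, lap (F i) x (L i)) -> lap (fun y => \sum_i F i y) x (\sum_i L i).
Proof.
move=> hF.
suff H (s : seq I) : lap (fun y => \sum_(i <- s) F i y) x (\sum_(i <- s) L i) by exact: H.
elim: s => [|i s IH].
  rewrite big_nil; apply: (lap_ext _ (lap_cst 0 x)) => y; by rewrite big_nil.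
by rewrite big_cons; apply: (lap_ext _ (lapD (hF i) IH)) => y; rewrite big_cons.
Qed.

Lemma lap_defect (K : R) f g x : hqc K f g -> eball x ->
  lap (fun y => defect (f y)) x (- grad2 f x).
Proof.
move=> H xB.
have hj j : lap (fun y => f y 0 j ^+ 2) x (2 * \sum_i partial i (fun y => f y 0 j) x ^+ 2).
  have [Cj lj] := hqc_harm H j.
  have := lap_sqr (fun i => ((Cj x xB).2 i).1) (lj x xB).
  by rewrite mulr0 addr0.
have := lapB (lap_cst 1 x) (lap_sum hj).
rewrite sub0r -mulr_sumr; apply: lap_ext => y.
by rewrite /defect sqr_enorm; congr (_ - _).
Qed.

Lemma grad2_bound (hn : (0 < n)%N) (K : R) : 1 <= K -> exists2 C : R, 0 < C & forall f g, hqc K f g ->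
  forall x, eball x -> jnorm f x <= C * (defect (f x) / defect x) /\
    grad2 f x <= C * (defect (f x) / defect x) ^+ 2.
Proof.
move=> K1; have n1 : 1 <= n%:R :> R by rewrite ler1n.
have [C C1 HC] := @gradient_and_harnack R n hn K K1.
have C0 : 0 <= C by lra.
exists (2 * C + 2 * (n%:R * (n%:R * (2 * C) ^+ 2))).
  have : 0 <= 2 * (n%:R * (n%:R * (2 * C) ^+ 2)) by nneg.
  by lra.
move=> f g H x xB.
have [D0 D1 Dl Du] := defect_bounds xB.
have [U0 U1 Ul Uu] := defect_bounds (hqc_in H xB).
set Q := defect (f x) / defect x.
have Q0 : 0 <= Q by rewrite /Q; nneg.
have N0 := jnorm_ge0 f x.
have hN : jnorm f x <= 2 * C * Q.
  have [h _] := HC f g H x xB.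
  rewrite /Q mulrA ler_pdivlMr//.
  have h1 : jnorm f x * defect x <= jnorm f x * (2 * (1 - enorm x)) by rewrite ler_wpM2l.
  have h2 : C * (1 - enorm (f x)) <= C * defect (f x) by rewrite ler_wpM2l.
  by move: h h1 h2; clear; nra.
have rest : 0 <= 2 * (n%:R * (n%:R * (2 * C) ^+ 2)) by nneg.
split; first by apply: (le_trans hN); rewrite ler_wpM2r//; lra.
have hg : grad2 f x <= 2 * (n%:R * (n%:R * (2 * C * Q) ^+ 2)).
  rewrite /grad2 ler_pM2l//.
  have hj (j : 'I_n) : \sum_i partial i (fun y => f y 0 j) x ^+ 2 <= n%:R * (2 * C * Q) ^+ 2.
    rewrite -[X in X%:R * _](card_ord n) -sum1_card natr_sum mulr_suml.
    apply: ler_sum => i _; rewrite mul1r -[X in X <= _]real_normK ?num_real//.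
    rewrite lerXn2r ?nnegrE//; last exact: le_trans (jac_le_jnorm f x i j) hN.
    by nneg.
  rewrite -[X in X%:R * (_ * _)](card_ord n) -sum1_card natr_sum mulr_suml.
  by apply: ler_sum => j _; rewrite mul1r.
apply: (le_trans hg); rewrite (exprMn _ (2 * C) Q).
have Q2 : 0 <= Q ^+ 2 by exact: exprn_ge0.
have -> : 2 * (n%:R * (n%:R * ((2 * C) ^+ 2 * Q ^+ 2))) = (2 * (n%:R * (n%:R * (2 * C) ^+ 2))) * Q ^+ 2.
  by rewrite !mulrA.
by rewrite ler_wpM2r// lerDr mulr_ge0.
Qed.

(** Neither function is extended to the sphere: by [hqc_proper], [defect (f x)] falls below half of
    a supposed excess [e] near the sphere, so the maximum principle runs on a slightly smaller
    ball. *)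
Lemma comparison (K : R) f g (W : 'rV[R]_n -> R) : hqc K f g ->
  (forall x, eball x -> {for x, continuous W}) -> (forall x, eball x -> 0 <= W x) ->
  (forall x, eball x -> exists2 L : R, lap W x L & L < - grad2 f x) ->
  forall x, eball x -> defect (f x) <= W x.
Proof.
move=> H cW W0 lW x0 x0B; rewrite leNgt; apply/negP => lt.
set e := defect (f x0) - W x0.
have e0 : 0 < e by rewrite /e subr_gt0.
have far x : eball x -> e / 2 <= defect (f x) -> enorm (f x) <= 1 - e / 4.
  by move=> xB h; have [_ _ _] := defect_bounds (hqc_in H xB); lra.
have r1 : 1 - e / 4 < 1 by lra.
have [d' d'0 Hd'] := hqc_proper H r1.
pose d := Num.min d' 1.
have d0 : 0 < d by rewrite lt_min d'0 ltr01.
have d1 : d <= 1 by rewrite ge_min lexx orbT.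
have Hd x : eball x -> e / 2 <= defect (f x) -> d <= defect x.
  by move=> xB h; rewrite ge_min Hd'//; exact: far.
(* On this sphere the defect is at most 2 d / 3, below the threshold [d]. *)
pose rho := 1 - d / 3.
have CB : cb 0 rho `<=` @eball R n by move=> x; rewrite /cb/eball/= subr0 /rho; lra.
have x0C : cb 0 rho x0.
  have [D0 D1 Dl Du] := defect_bounds x0B.
  have h : e / 2 <= defect (f x0) by have := W0 x0 x0B; rewrite /e; lra.
  have := Hd x0 x0B h; rewrite /cb/= subr0 /rho; lra.
have mp : forall x, cb 0 rho x -> defect (f x) - W x - e / 2 <= 0.
  apply: (max_principle (@compact_cb _ _ 0 rho)).
    apply: within_cont => x /CB xB; apply: contB; last exact: cont_cst.
    apply: contB; last exact: cW.
    apply: contB; first exact: cont_cst.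
    apply: contX; apply: (@continuous_comp _ _ _ f (fun x => enorm x)).
      exact: hqc_cont H _ xB.
    exact: enorm_continuous.
  move=> x xC; have xB := CB x xC.
  have [xr|xr] := ltP (enorm (x - 0)) rho.
    right; split; first exact: cb_interior.
    have [L lL Lg] := lW x xB.
    exists (- grad2 f x - L - 0); last by rewrite subr0 subr_gt0.
    by apply: lapB; [apply: lapB => //; exact: lap_defect H xB|exact: lap_cst].
  left; have xe : enorm x = rho.
    by move: xC xr; rewrite /cb/= subr0 => h1 h2; apply/eqP; rewrite eq_le h1 h2.
  have [D0 D1 Dl Du] := defect_bounds xB.
  have : defect (f x) < e / 2.
    rewrite ltNge; apply/negP => /(Hd x xB); move: Du; rewrite xe /rho; lra.
  by have := W0 x xB; lra.
have := mp x0 x0C; rewrite -/e; lra.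
Qed.

Lemma lap_defect_pow (b : R) x : eball x ->
  lap (fun y => defect y `^ b) x
    (b * defect x `^ b * ((b - 1) * (4 * enorm x ^+ 2) / defect x ^+ 2 - 2 * n%:R / defect x)).
Proof.
move=> xB; have [D0 _ _ _] := defect_bounds xB.
pose s0 := enorm (x - 0) ^+ 2.
have sE : 1 - s0 = defect x by rewrite /s0 subr0.
have dm (s : R) : is_derive s 1 (fun s : R => 1 - s) (0 - 1) by exact (derB (der_cst s 1) (der_id s)).
have dp (c s : R) : s < 1 -> is_derive s 1 (fun s : R => (1 - s) `^ c) (c * (1 - s) `^ (c - 1) * (0 - 1)).
  move=> s1; have s10 : 0 < 1 - s by rewrite subr_gt0.
  exact (@der_comp _ (fun t : R => t `^ c) (fun s : R => 1 - s) s _ _ (dm s) (is_derive1_powR c s10)).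
have s01 : s0 < 1 by rewrite -subr_gt0 sE.
have d1 (s : R) : `|s - s0| < defect x ->
    is_derive s 1 (fun s : R => (1 - s) `^ b) (- b * (1 - s) `^ (b - 1)).
  rewrite ltr_norml => /andP[_ h].
  apply: (der_eq (dp b s _)); first by rewrite -sE in h; lra.
  by ring.
have d2 := derZ (- b) (dp (b - 1) s0 s01).
have := lap_sqn D0 d1 d2; rewrite -/s0.
have pm (c : R) : defect x `^ (c - 1) = defect x `^ c / defect x.
  have h : defect x `^ c = defect x `^ (c - 1) * defect x.
    rewrite -[X in _ * X](powRr1 (ltW D0)) -powRD ?subrK//.
    by apply/implyP => _; rewrite gt_eqF.
  by rewrite h mulfK// gt_eqF.
rewrite sE !pm => h.
rewrite (_ : _ * _ = 4 * s0 * (- b * ((b - 1) * (defect x `^ b / defect x / defect x) * (0 - 1))) +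
  2 * n%:R * (- b * (defect x `^ b / defect x))).
  by apply: lap_ext h => y; rewrite /defect subr0.
rewrite /s0 subr0; move: (defect x `^ b) => P; field.
by rewrite gt_eqF.
Qed.

Lemma cont_defect_pow (b : R) x : eball x -> {for x, continuous (fun y => defect y `^ b)}.
Proof.
move=> xB; have [D0 _ _ _] := defect_bounds xB.
apply: (@cont_comp _ _ (fun t : R => t `^ b) defect).
  exact: is_derive_continuous (is_derive1_powR b D0).
apply: contB; first exact: cont_cst.
apply: contX; exact: enorm_continuous.
Qed.

(** The hypothesis and [grad2_bound] give grad2 <= C A^2 D^(b-2) with b = 2 al, and - Lap D^b >= 4 b
    (1 - b) D^(b-2). The factor 1 - b is why 2 al < 1 is required. *)
Lemma holder_double (hn : (1 < n)%N) (K : R) : 1 <= K -> forall (al A : R), 0 < al -> 2 * al < 1 -> 0 < A ->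
  exists2 A' : R, 0 < A' & forall f g, hqc K f g ->
  (forall x, eball x -> defect (f x) <= A * defect x `^ al) ->
  forall x, eball x -> defect (f x) <= A' * defect x `^ (2 * al).
Proof.
move=> K1 al A al0 al1 A0; have [C C0 HC] := @grad2_bound (ltnW hn) K K1.
have n2 : 2 <= n%:R :> R by rewrite ler_nat.
pose b := 2 * al.
have b0 : 0 < b by rewrite /b; lra.
have b1 : 0 < 1 - b by rewrite /b; lra.
(* The summand 1 provides the strict inequality that [comparison] asks for. *)
pose A' := (C * A ^+ 2 + 1) / (4 * b * (1 - b)).
have CA : 0 < C * A ^+ 2 by npos.
have A'0 : 0 < A' by rewrite /A'; npos; lra.
exists A' => // f g H hU.
apply: (comparison H) => x xB; have [D0 D1 Dl Du] := defect_bounds xB.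
- by apply: contM; [exact: cont_cst|exact: cont_defect_pow].
- by rewrite mulr_ge0 ?powR_ge0// ltW.
eexists; first by apply: lapZ; exact: lap_defect_pow.
rewrite -/b; set P := defect x `^ b.
have P0 : 0 < P by exact: powR_gt0.
have [_ hg] := HC f g H x xB.
have PE : P = (defect x `^ al) ^+ 2 by rewrite /P /b mulrC powRrM powR_mulrn ?powR_ge0.
have [U0 _ _ _] := defect_bounds (hqc_in H xB).
have hg2 : grad2 f x <= C * A ^+ 2 * (P / defect x ^+ 2).
  apply: (le_trans hg); rewrite -mulrA ler_pM2l//.
  rewrite expr_div_n mulrA ler_pM2r ?invr_gt0 ?exprn_gt0// PE -exprMn.
  by rewrite lerXn2r ?nnegrE ?hU// ltW// (lt_le_trans U0)// hU.
have xE : enorm x ^+ 2 = 1 - defect x by rewrite /defect; lra.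
rewrite xE; set D := defect x in D0 D1 hg2 *.
have PD : 0 < P / D ^+ 2 by npos.
have low : 4 * b * (1 - b) * (P / D ^+ 2) <=
   - (b * P * ((b - 1) * (4 * (1 - D)) / D ^+ 2 - 2 * n%:R / D)).
  have -> : - (b * P * ((b - 1) * (4 * (1 - D)) / D ^+ 2 - 2 * n%:R / D)) =
     b * (P / D ^+ 2) * ((1 - b) * 4 * (1 - D) + 2 * n%:R * D) by field; rewrite gt_eqF.
  have -> : 4 * b * (1 - b) * (P / D ^+ 2) = b * (P / D ^+ 2) * (4 * (1 - b)) by ring.
  rewrite ler_pM2l ?mulr_gt0//; nra.
have A'E : A' * (4 * b * (1 - b)) = C * A ^+ 2 + 1.
  by rewrite /A' divfK// gt_eqF//; npos.
have := ler_wpM2l (ltW A'0) low; rewrite [leLHS]mulrA A'E => h.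
rewrite ltrNr; apply: (le_lt_trans hg2); rewrite -mulrN; apply: lt_le_trans h.
by rewrite ltr_pM2r// ltrDl ltr01.
Qed.

(** Exponent 3/4 gives grad2 <= C A^2 D^(-1/2), which is mild enough for a barrier linear in D: -
    Lap (2 D - D^(3/2)) >= 2 D^(-1/2), and 2 D - D^(3/2) lies between D and 2 D. *)
Lemma holder_to_lipschitz (hn : (1 < n)%N) (K : R) : 1 <= K -> forall A : R, 0 < A ->
  exists2 A' : R, 0 < A' & forall f g, hqc K f g ->
  (forall x, eball x -> defect (f x) <= A * defect x `^ (3 / 4)) ->
  forall x, eball x -> defect (f x) <= A' * defect x.
Proof.
move=> K1 A A0; have [C C0 HC] := @grad2_bound (ltnW hn) K K1.
have n2 : 2 <= n%:R :> R by rewrite ler_nat.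
have CA : 0 < C * A ^+ 2 by npos.
pose A' := C * A ^+ 2 + 1.
have A'0 : 0 < A' by rewrite /A'; lra.
exists (2 * A'); first by lra.
move=> f g H hU x xB.
pose b : R := 3 / 2.
(* The linear term is written as a power with exponent 1, so that [lap_defect_pow] covers both
   terms. *)
suff : defect (f x) <= A' * (2 * defect x `^ 1 - defect x `^ b).
  move=> /le_trans; apply; have [D0 _ _ _] := defect_bounds xB.
  rewrite powRr1 ?(ltW D0)//; have := powR_ge0 (defect x) b.
  by move: A'0 (defect x) (_ `^ b); clear => A'0 D P; nra.
move: x xB; apply: (comparison H) => x xB; have [D0 D1 Dl Du] := defect_bounds xB.
- apply: contM; first exact: cont_cst.
  apply: contB; last exact: cont_defect_pow.
  by apply: contM; [exact: cont_cst|exact: cont_defect_pow].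
- rewrite mulr_ge0 ?(ltW A'0)// powRr1 ?(ltW D0)//.
  have : defect x `^ b <= defect x by apply: ge1r_powR; rewrite ?D0 ?D1//; rewrite /b; lra.
  by lra.
eexists.
  apply: lapZ; apply: lapB; last exact: lap_defect_pow.
  by apply: lapZ; exact: lap_defect_pow.
set P := defect x `^ b; rewrite powRr1 ?(ltW D0)//.
have P0 : 0 < P by exact: powR_gt0.
have [_ hg] := HC f g H x xB.
have [U0 _ _ _] := defect_bounds (hqc_in H xB).
have PE : P = (defect x `^ (3 / 4)) ^+ 2.
  by rewrite /P /b -powR_mulrn ?powR_ge0// -powRrM; congr (_ `^ _); field.
have PD1 : P <= defect x by apply: ge1r_powR; rewrite ?D0 ?D1//; rewrite /b; lra.
have PP : P ^+ 2 = defect x ^+ 3.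
  rewrite -!powR_mulrn ?powR_ge0 ?(ltW D0)// /P -powRrM; congr (_ `^ _).
  by rewrite /b; field.
have hg2 : grad2 f x <= C * A ^+ 2 * (P / defect x ^+ 2).
  apply: (le_trans hg); rewrite -mulrA ler_pM2l//.
  rewrite expr_div_n mulrA ler_pM2r ?invr_gt0 ?exprn_gt0// PE -exprMn.
  by rewrite lerXn2r ?nnegrE ?hU// ltW// (lt_le_trans U0)// hU.
have xE : enorm x ^+ 2 = 1 - defect x by rewrite /defect; lra.
rewrite xE; set D := defect x in D0 D1 hg2 PD1 PP *.
have PD : 0 < P / D ^+ 2 by npos.
have D2 : D ^+ 2 <= P.
  have h : D ^+ 2 * D ^+ 2 <= P * P by rewrite -!expr2 PP -exprM; apply: ler_wiXn2l => //; exact: ltW.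
  rewrite leNgt; apply/negP => lt; have D20 : 0 < D ^+ 2 by npos.
  by have := ltr_pM (ltW P0) (ltW P0) lt lt; rewrite ltNge h.
have PD1' : 1 <= P / D ^+ 2 by rewrite ler_pdivlMr ?exprn_gt0// mul1r.
have PDle : P / D <= 1 by rewrite ler_pdivrMr// mul1r.
have low : 2 * (P / D ^+ 2) <= - (2 * (1 * D * ((1 - 1) * (4 * (1 - D)) / D ^+ 2 - 2 * n%:R / D)) -
    b * P * ((b - 1) * (4 * (1 - D)) / D ^+ 2 - 2 * n%:R / D)).
  have -> : - (2 * (1 * D * ((1 - 1) * (4 * (1 - D)) / D ^+ 2 - 2 * n%:R / D)) -
    b * P * ((b - 1) * (4 * (1 - D)) / D ^+ 2 - 2 * n%:R / D)) =
    4 * n%:R + 3 * (P / D ^+ 2) - 3 * (P / D) - 3 * n%:R * (P / D).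
    by rewrite /b; field; rewrite gt_eqF.
  have PD0 : 0 <= P / D by rewrite divr_ge0 ?ltW.
  by move: PD1' PDle PD0 n2; move: (P / D ^+ 2) (P / D) (n%:R) => X Y m; clear; nra.
have := ler_wpM2l (ltW A'0) low => h.
rewrite ltrNr; apply: (le_lt_trans hg2); rewrite -mulrN; apply: lt_le_trans h.
by move: PD CA; rewrite /A'; move: (P / D ^+ 2) (C * A ^+ 2) => X Y; clear; nra.
Qed.

Theorem hqc_lipschitz (hn : (1 < n)%N) (K d : R) : 1 <= K -> 0 < d -> exists L : R,
  forall f g, hqc K f g -> d <= 1 - enorm (f 0) ->
  forall x y, eball x -> eball y -> enorm (f x - f y) <= L * enorm (x - y).
Proof.
move=> K1 d0; have [C [al [C0 al0 Hh]]] := boundary_holder hn K1 d0.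
(* The Hoelder exponent is first lowered to one of these, which is harmless since the defect is at
   most 1; then [m] doublings end exactly at 3/4. *)
pose be (m : nat) : R := 3 / 4 / 2 ^+ m.
have be0 m : 0 < be m by rewrite /be; npos.
have [m hm] : exists m, be m <= al.
  exists (Num.trunc al^-1).+1; set k := _.+1.
  have kb : al^-1 < k%:R by exact: truncnS_gt.
  have k2 : k%:R <= 2 ^+ k :> R by rewrite -natrX ler_nat ltnW// ltn_expl.
  rewrite /be ler_pdivrMr ?exprn_gt0//.
  have : 1 <= al * 2 ^+ k.
    by rewrite mulrC -ler_pdivrMr// div1r (le_trans (ltW kb)).
  by lra.
have up : exists2 A : R, 0 < A & forall f g, hqc K f g -> d <= 1 - enorm (f 0) ->
    forall x, eball x -> defect (f x) <= A * defect x `^ (be m).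
  exists (2 * C); first by npos.
  move=> f g H fd x xB; have [_ _ _ Uu] := defect_bounds (hqc_in H xB).
  have [D0 D1 _ _] := defect_bounds xB.
  have h1 := Hh f g H fd x xB.
  have h2 : C * defect x `^ al <= C * defect x `^ (be m).
    by rewrite ler_pM2l//; apply: ger_powR => //; rewrite D0 D1.
  by rewrite -mulrA; lra.
have {up} [A A0 HA] : exists2 A : R, 0 < A & forall f g, hqc K f g -> d <= 1 - enorm (f 0) ->
    forall x, eball x -> defect (f x) <= A * defect x `^ (3 / 4).
  elim: m {hm} up => [|m IH] [A A0 HA].
    by exists A => //; move: HA; rewrite /be expr0 divr1.
  apply: IH.
  have b2 : 2 * be m.+1 = be m by rewrite /be exprS; field.
  have bm : be m < 1.
    rewrite /be ltr_pdivrMr ?exprn_gt0// mul1r.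
    have : 1 <= 2 ^+ m :> R by rewrite exprn_ege1// ler1n.
    by lra.
  have [|A' A'0 HA'] := holder_double hn K1 (be0 m.+1) _ A0; first by rewrite b2.
  exists A' => // f g H fd x xB; rewrite -b2.
  by apply: (HA' f g H) => // y yB; exact: HA f g H fd y yB.
have [A' A'0 HA'] := holder_to_lipschitz hn K1 A0.
have [C' C'0 HC'] := @grad2_bound (ltnW hn) K K1.
exists (n%:R * (n%:R * (C' * A'))) => f g H fd x y xB yB.
have hj z : eball z -> jnorm f z <= C' * A'.
  move=> zB; have [h _] := HC' f g H z zB; apply: (le_trans h); rewrite ler_pM2l//.
  have [D0 _ _ _] := defect_bounds zB; rewrite ler_pdivrMr//.
  by apply: (HA' f g H) => // w wB; exact: HA f g H fd w wB.
have seg (t : R) : 0 <= t <= 1 -> eball (y + t *: (x - y)).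
  by move=> /andP[t0 t1]; rewrite eball_eb; apply: seg_in_eb => //; rewrite -eball_eb.
have := hqc_seg_le H seg (fun t ht => hj _ (seg t ht)).
by rewrite !mulrA.
Qed.

End bootstrap.

(** * Linear distortion *)

Section linear_algebra.
Context {R : realType} {n : nat}.
Implicit Types (A : 'M[R]_n) (u v : 'rV[R]_n).

Lemma enorm_mul_le A c v : (forall i j, `|A i j| <= c) -> enorm (v *m A) <= n%:R * (n%:R * c) * enorm v.
Proof.
move=> Ac; rewrite -mulrA; apply: enorm_le_coord => j; rewrite mxE.
apply: (le_trans (ler_norm_sum _ _ _)).
rewrite -[X in X%:R * c](card_ord n) -sum1_card natr_sum !mulr_suml.
apply: ler_sum => k _; rewrite normrM mul1r mulrC.
by rewrite ler_pM// coord_le_enorm.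
Qed.

(** [opnorm] is a real supremum, informative only for a bounded set; the sum of the entries bounds
    it. *)
Lemma opnorm_ub A v : enorm v <= 1 -> enorm (v *m A) <= opnorm A.
Proof.
move=> v1; apply: ub_le_sup; last by exists v.
have c0 : forall i j, `|A i j| <= \sum_i \sum_j `|A i j|.
  move=> i j; rewrite (bigD1 i)//= (bigD1 j)//= -addrA lerDl addr_ge0//.
    by apply: sumr_ge0.
  by apply: sumr_ge0 => k _; apply: sumr_ge0.
exists (n%:R * (n%:R * \sum_i \sum_j `|A i j|)) => _ [w w1 <-].
apply: (le_trans (enorm_mul_le _ c0)); rewrite -[leRHS]mulr1 ler_wpM2l// !mulr_ge0//.
by apply: sumr_ge0 => k _; apply: sumr_ge0.
Qed.

Lemma det_le (m : nat) (A : 'M[R]_m) c : (forall i j, `|A i j| <= c) -> `|\det A| <= m`!%:R * c ^+ m.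
Proof.
move=> Ac; rewrite /determinant; apply: (le_trans (ler_norm_sum _ _ _)).
rewrite -perm.card_Sn -sum1_card natr_sum mulr_suml; apply: ler_sum => s _.
rewrite mul1r normrM normrX normrN1 expr1n mul1r normr_prod.
rewrite -[X in _ ^+ X](card_ord m) -prodr_const.
by apply: ler_prod => i _; rewrite normr_ge0 Ac.
Qed.

(* By Cramer's rule [det A * v = v A adj(A)], and the entries of [adj A] are of
   order [t ^ (n - 1)]. *)
Lemma distortion_linear (hn : (0 < n)%N) A (t K : R) : 1 <= K -> 0 <= t ->
  (forall i j, `|A i j| <= t) -> t ^+ n <= K * `|\det A| ->
  forall v, t * enorm v <= K * (n%:R * (n%:R * n.-1`!%:R)) * enorm (v *m A).
Proof.
move=> K1 t0 At tK v.
have K0 : 0 <= K by lra.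
have [->|tn0] := eqVneq t 0.
  by rewrite mul0r !mulr_ge0// enorm_ge0.
have tp : 0 < t by rewrite lt_neqAle eq_sym tn0.
have adj i j : `|(\adj A) i j| <= n.-1`!%:R * t ^+ n.-1.
  rewrite mxE /cofactor normrM normrX normrN1 expr1n mul1r.
  by apply: det_le => k l; rewrite !mxE.
have e1 : `|\det A| * enorm v <= n%:R * (n%:R * (n.-1`!%:R * t ^+ n.-1)) * enorm (v *m A).
  by rewrite -enormZ -mul_mx_scalar -mul_mx_adj mulmxA; exact: enorm_mul_le.
have e2 : t ^+ n * enorm v <= K * (n%:R * (n%:R * (n.-1`!%:R * t ^+ n.-1)) * enorm (v *m A)).
  apply: (@le_trans _ _ (K * (`|\det A| * enorm v))); last by rewrite ler_wpM2l.
  by rewrite mulrA ler_wpM2r// enorm_ge0.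
rewrite -(ler_pM2l (_ : 0 < t ^+ n.-1)) ?exprn_gt0//.
rewrite [leLHS]mulrA -exprSr prednK//; apply: (le_trans e2).
by rewrite le_eqVlt; apply/orP; left; apply/eqP; ring.
Qed.

(** Take for [t] the largest row norm: it bounds all entries, and it is attained at a basis vector,
    where the hypothesis applies. Transposition preserves both the entry bound and the determinant,
    which yields the second inequality. *)
Lemma distortion_jnorm (hn : (0 < n)%N) A (K : R) : 1 <= K ->
  (forall v, enorm v <= 1 -> enorm (v *m A) ^+ n <= K * `|\det A|) ->
  forall v, (\sum_i \sum_j `|A i j|) * enorm v <=
    n%:R ^+ 2 * (K * (n%:R * (n%:R * n.-1`!%:R))) * enorm (v *m A) /\
   (\sum_i \sum_j `|A i j|) * enorm v <=
    n%:R ^+ 2 * (K * (n%:R * (n%:R * n.-1`!%:R))) * enorm (v *m A^T).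
Proof.
move=> K1 hA.
have [t [t0 At tK]] : exists t, [/\ 0 <= t, forall i j, `|A i j| <= t & t ^+ n <= K * `|\det A|].
  have i0 : 'I_n by exact: Ordinal hn.
  have row (i : 'I_n) : enorm ('e_i *m A) ^+ n <= K * `|\det A|.
    by apply: hA; rewrite enorm_delta.
  exists (\big[Num.max/0]_i enorm ('e_i *m A)); split.
  - exact: bigmax_ge_id.
  - move=> i j; apply: (@le_trans _ _ (enorm ('e_i *m A))).
      by have := coord_le_enorm ('e_i *m A) j; rewrite -rowE mxE.
    exact: le_bigmax.
  - have [i _ ->] := @eq_bigmax _ _ _ 0 i0 predT (fun i => enorm ('e_i *m A)) erefl (fun i _ => enorm_ge0 _).
    exact: row.
have sA v (B : 'M[R]_n) : t * enorm v <= K * (n%:R * (n%:R * n.-1`!%:R)) * enorm (v *m B) ->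
  (\sum_i \sum_j `|A i j|) * enorm v <=
    n%:R ^+ 2 * (K * (n%:R * (n%:R * n.-1`!%:R))) * enorm (v *m B).
  move=> h; apply: (@le_trans _ _ (n%:R ^+ 2 * (t * enorm v))); last first.
    by rewrite -[leRHS]mulrA ler_wpM2l// exprn_ge0.
  rewrite mulrA ler_wpM2r ?enorm_ge0// expr2 -mulrA.
  rewrite -[X in X%:R * (_ * _)](card_ord n) -sum1_card natr_sum mulr_suml.
  apply: ler_sum => i _; rewrite mul1r.
  rewrite -[X in X%:R * _](card_ord n) -sum1_card natr_sum mulr_suml.
  by apply: ler_sum => j _; rewrite mul1r.
move=> v; split; apply: sA; apply: (distortion_linear hn) => //.
  by move=> i j; rewrite mxE.
by rewrite det_tr.
Qed.

End linear_algebra.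

(** * Weak and classical derivatives *)

Section boxes.
Context {R : realType} {n : nat}.
Implicit Types (a b x v : 'rV[R]_n).

Definition obox a b : set 'rV[R]_n := [set x | forall i, a 0 i < x 0 i < b 0 i].
Definition cbox a b : set 'rV[R]_n := [set x | forall i, a 0 i <= x 0 i <= b 0 i].

Lemma oboxE a b : obox a b = [set x | forall i, `]a 0 i, b 0 i[%classic (x 0 i)].
Proof. by apply/seteqP; split=> x h i; have := h i; rewrite /= in_itv. Qed.

Lemma obox_sub_cbox a b : obox a b `<=` cbox a b.
Proof. by move=> x h i; have /andP[/ltW -> /ltW ->] := h i. Qed.

Lemma measurable_obox a b : measurable (obox a b).
Proof.
rewrite oboxE; apply: (@measurable_rV_box _ _ (fun i => `]a 0 i, b 0 i[%classic)) => i.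
exact: measurable_itv.
Qed.

Lemma measurable_cbox a b : measurable (cbox a b).
Proof.
rewrite (_ : cbox a b = [set x | forall i, `[a 0 i, b 0 i]%classic (x 0 i)]).
  apply: (@measurable_rV_box _ _ (fun i => `[a 0 i, b 0 i]%classic)) => i.
  exact: measurable_itv.
by apply/seteqP; split=> x h i; have := h i; rewrite /= in_itv.
Qed.

Lemma oboxI a b a' b' : obox a b `&` obox a' b' =
  obox (\row_i Num.max (a 0 i) (a' 0 i)) (\row_i Num.min (b 0 i) (b' 0 i)).
Proof.
apply/seteqP; split=> [x [h h'] i|x h].
  rewrite !mxE gt_max lt_min; have /andP[-> ->] := h i.
  by have /andP[-> ->] := h' i.
by split=> i; have := h i; rewrite !mxE gt_max lt_min => /andP[/andP[h1 h2] /andP[h3 h4]]; apply/andP.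
Qed.

Definition oboxes : set (set 'rV[R]_n) := [set A | exists a b, A = obox a b].

(** Brings the sigma-algebra, defined through tuples, into the form on which uniqueness of measures
    and Dynkin's lemma operate. *)
Lemma measurable_rV_generated : @measurable _ 'rV[R]_n = <<s oboxes >>.
Proof.
apply/seteqP; split=> A; last first.
  by apply: smallest_sub; [exact: sigma_algebra_measurable|move=> _ [a [b ->]]; exact: measurable_obox].
move=> mA.
pose tup (x : g_sigma_algebraType oboxes) : n.-tuple (measurableTypeR R) :=
  [tuple (x : 'rV[R]_n) 0 i | i < n].
have mtup : measurable_fun setT tup.
  apply/measurable_fun_tnthP => i.
  rewrite (_ : _ \o _ = (fun x : g_sigma_algebraType oboxes => (x : 'rV[R]_n) 0 i : measurableTypeR R)); last first.
    by apply/funext => x /=; rewrite tnth_mktuple.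
  apply: (measurability _ (RGenOInfty.measurableE R)).
  move=> _ [_ [c ->] <-]; rewrite setTI.
  (* An open half-space is a countable union of growing boxes, so each coordinate is measurable for
     the sigma-algebra generated by boxes. *)
  rewrite (_ : _ @^-1` _ = \bigcup_k obox (\row_j if j == i then c else - k%:R) (\row_j k%:R)).
    apply: bigcupT_measurable => k; apply: sub_sigma_algebra.
    by exists (\row_j if j == i then c else - k%:R), (\row_j k%:R).
  apply/seteqP; split=> [x|x [k _ h]]; last first.
    by have := h i; rewrite /= in_itv/= !mxE eqxx andbT => /andP[].
  rewrite /= in_itv/= andbT => cx.
  pose k := (Num.trunc (enorm (x : 'rV[R]_n))).+1.
  have xk : enorm (x : 'rV[R]_n) < k%:R by exact: truncnS_gt.
  exists k => // j.
  have := le_lt_trans (coord_le_enorm (x : 'rV[R]_n) j) xk; rewrite ltr_norml => /andP[h1 h2].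
  by rewrite !mxE h2 andbT; case: eqP => [->|].
have := mtup measurableT _ mA; rewrite setTI.
rewrite (_ : _ @^-1` _ = A)//.
apply/seteqP; split=> x; rewrite /preimage /=; rewrite (_ : row_of_tuple (tup x) = x)//;
  by apply/rowP => i; rewrite mxE tnth_mktuple.
Qed.

Lemma oboxes_setI : setI_closed oboxes.
Proof. by move=> _ _ [a [b ->]] [a' [b' ->]]; rewrite oboxI; eexists; eexists. Qed.

Lemma lebesgue_obox a b : lebesgue (obox a b) = \big[*%E/1%E]_(i < n) lebesgue_measure `]a 0 i, b 0 i[%classic.
Proof. by rewrite oboxE (@lebesgue_box R n (fun i => `]a 0 i, b 0 i[%classic)). Qed.

Lemma lebesgue_obox_lty a b : (lebesgue (obox a b) < +oo)%E.
Proof.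
rewrite lebesgue_obox ltey_eq; apply/orP; left; apply: prode_fin_num => i _.
by rewrite lebesgue_measure_itv/=; case: ifP.
Qed.

Lemma measurable_translate v : measurable_fun [set: 'rV[R]_n] (fun x => x + v).
Proof.
apply: (measurability _ measurable_rV_generated) => _ [_ [a [b ->]] <-]; rewrite setTI.
rewrite (_ : _ @^-1` _ = obox (a - v) (b - v)); first exact: measurable_obox.
by apply/seteqP; split=> x h i; have := h i; rewrite !mxE; lra.
Qed.

(** The translated measure agrees with [lebesgue] on boxes, a generating pi-system that contains an
    exhausting sequence of finite measure. *)
Lemma lebesgue_translate v (A : set 'rV[R]_n) : measurable A ->
  lebesgue ((fun x => x + v) @^-1` A) = lebesgue A.
Proof.
move=> mA.
pose g k : set 'rV[R]_n := obox (\row_i - k%:R) (\row_i k%:R).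
pose tmix := isMeasurableFun.Build _ _ _ _ _ (measurable_translate v).
pose tr : {mfun 'rV[R]_n >-> 'rV[R]_n} := HB.pack (fun x : 'rV[R]_n => x + v) tmix.
apply: (measure_unique oboxes g measurable_rV_generated oboxes_setI _ _ (pushforward lebesgue tr) lebesgue) => //.
- by move=> k; exists (\row_i - k%:R), (\row_i k%:R).
- apply/seteqP; split=> // x _; pose k := (Num.trunc (enorm x)).+1.
  have xk : enorm x < k%:R by exact: truncnS_gt.
  exists k => // j.
  by have := le_lt_trans (coord_le_enorm x j) xk; rewrite ltr_norml !mxE.
- move=> _ [a [b ->]]; rewrite -[LHS]/(lebesgue ((fun x => x + v) @^-1` obox a b)).
  rewrite (_ : _ @^-1` _ = obox (a - v) (b - v)).
    rewrite -[RHS]/(lebesgue (obox a b)) !lebesgue_obox (eq_bigr (fun i => lebesgue_measure `]a 0 i, b 0 i[%classic))// => i _.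
    rewrite !lebesgue_measure_itv/= !mxE !lte_fin ltrD2r -!EFinB.
    by rewrite opprB addrA subrK.
  by apply/seteqP; split=> x h i; have := h i; rewrite !mxE; lra.
- move=> k; rewrite -[X in (X < _)%E]/(lebesgue ((fun x => x + v) @^-1` g k)).
  rewrite (_ : _ @^-1` _ = obox ((\row_i - k%:R) - v) ((\row_i k%:R) - v)); first exact: lebesgue_obox_lty.
  by apply/seteqP; split=> x h i; have := h i; rewrite !mxE; lra.
Qed.

Lemma integral_translate v (f : 'rV[R]_n -> R) : lebesgue.-integrable setT (EFin \o f) ->
  (\int[lebesgue]_x (f (x + v))%:E = \int[lebesgue]_x (f x)%:E)%E.
Proof.
move=> fi.
pose tmix := isMeasurableFun.Build _ _ _ _ _ (measurable_translate v).
pose tr : {mfun 'rV[R]_n >-> 'rV[R]_n} := HB.pack (fun x : 'rV[R]_n => x + v) tmix.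
have mf := measurable_int _ fi.
have E (D : set 'rV[R]_n) (h : 'rV[R]_n -> \bar R) : measurable D ->
    (\int[pushforward lebesgue tr]_(x in D) h x = \int[lebesgue]_(x in D) h x)%E.
  by move=> mD; apply: eq_measure_integral => A mA _; exact: lebesgue_translate.
have fti : lebesgue.-integrable setT (EFin \o f \o (fun x => x + v)).
  apply/integrableP; split.
    exact: (measurableT_comp mf (measurable_translate v)).
  have /integrableP[_] := fi; rewrite -(E setT)//.
  rewrite (@ge0_integral_pushforward _ _ _ _ R _ (measurable_translate v) lebesgue setT (fun x => `|(EFin \o f) x|%E))//.
  by apply/measurable_EFinP/measurableT_comp => //; exact/measurable_EFinP.
transitivity (\int[pushforward lebesgue tr]_x (f x)%:E)%E; last exact: E.
exact/esym/(integral_pushforward (measurable_translate v) mf fti measurableT).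
Qed.

(* By Dynkin's lemma, since boxes form a pi-system that generates the Borel sets. *)
Lemma integral_boxes_eq0 (Q : set 'rV[R]_n) (h : 'rV[R]_n -> R) : measurable Q ->
  lebesgue.-integrable Q (EFin \o h) ->
  (forall a b, (\int[lebesgue]_(x in obox a b `&` Q) (h x)%:E = 0)%E) ->
  (\int[lebesgue]_(x in Q) (h x)%:E = 0)%E ->
  forall A, measurable A -> (\int[lebesgue]_(x in A `&` Q) (h x)%:E = 0)%E.
Proof.
move=> mQ hi hb hQ A; rewrite measurable_rV_generated.
pose P (A : set 'rV[R]_n) := (\int[lebesgue]_(x in A `&` Q) (h x)%:E = 0)%E.
apply: (@dynkin_induction _ _ oboxes P measurable_rV_generated oboxes_setI); rewrite /P.
- by rewrite setTI.
- by move=> _ [a [b ->]]; exact: hb.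
- move=> S mS hS.
  have mSQ : measurable (S `&` Q) by exact: measurableI.
  have mCQ : measurable (~` S `&` Q) by apply: measurableI => //; exact: measurableC.
  have E : Q = (S `&` Q) `|` (~` S `&` Q) by rewrite -setIUl setUv setTI.
  move: hQ; rewrite [in X in X -> _]E integral_setU//.
  + by rewrite hS add0e.
  + by rewrite -E; exact: measurable_int hi.
  + by apply/disj_setPLR => x [Sx _] [].
- move=> F mF tF hF; rewrite setI_bigcupl integral_bigcup//.
  + by rewrite eseries0// => k _ _; exact: hF.
  + by apply: trivIset_setIr.
  + by move=> k; apply: measurableI.
  + apply: integrableS hi => //; last by move=> x [k _ []].
    by apply: bigcupT_measurable => k; apply: measurableI.
Qed.

Lemma integral_boxes_ae_eq (Q : set 'rV[R]_n) (w v : 'rV[R]_n -> R) : measurable Q ->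
  lebesgue.-integrable Q (EFin \o w) -> lebesgue.-integrable Q (EFin \o v) ->
  (forall a b, (\int[lebesgue]_(x in obox a b `&` Q) (w x)%:E =
               \int[lebesgue]_(x in obox a b `&` Q) (v x)%:E)%E) ->
  (\int[lebesgue]_(x in Q) (w x)%:E = \int[lebesgue]_(x in Q) (v x)%:E)%E ->
  {ae lebesgue, forall x, Q x -> w x = v x}.
Proof.
move=> mQ wi vi hb hQ.
have sub A : measurable A -> A `<=` Q ->
  (\int[lebesgue]_(x in A) ((w \- v) x)%:E = \int[lebesgue]_(x in A) (w x)%:E - \int[lebesgue]_(x in A) (v x)%:E)%E.
  move=> mA AQ.
  rewrite (eq_integral (fun x => (w x)%:E - (v x)%:E)%E); last by move=> x _; rewrite EFinB.
  by rewrite integralB//; [apply: integrableS wi|apply: integrableS vi].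
have fin A : measurable A -> A `<=` Q -> (\int[lebesgue]_(x in A) (v x)%:E \is a fin_num)%E.
  by move=> mA AQ; apply: integrable_fin_num => //; apply: integrableS vi.
have finw A : measurable A -> A `<=` Q -> (\int[lebesgue]_(x in A) (w x)%:E \is a fin_num)%E.
  by move=> mA AQ; apply: integrable_fin_num => //; apply: integrableS wi.
have hi : lebesgue.-integrable Q (EFin \o (w \- v)).
  have := integrableB mQ wi vi; apply: eq_integrable => // x _.
have zero := integral_boxes_eq0 mQ hi _ _.
have ae : ae_eq lebesgue Q (EFin \o w) (EFin \o v).
  apply: integral_ae_eq => //; first exact: measurable_int vi.
  move=> A AQ mA; have AE : A = A `&` Q by apply/esym/setIidPl.
  have : (\int[lebesgue]_(x in A) ((w \- v) x)%:E = 0)%E.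
    rewrite AE; apply: zero => //.
    + move=> a b; have mab : measurable (obox a b `&` Q) by apply: measurableI => //; exact: measurable_obox.
      have sab : obox a b `&` Q `<=` Q by exact: subIsetr.
      by rewrite sub// hb subee// fin.
    + by rewrite sub// hQ subee// fin.
  rewrite sub// => /eqP; rewrite sube_eq ?fin ?finw// ?add0e; first by move/eqP.
by apply: filterS ae => x h Qx; have [] := h Qx.
Qed.

End boxes.

(** * Smooth bump functions on boxes *)

Section bump.
Context {R : realType}.

Definition flat (k : nat) (t : R) : R := if 0 < t then t^-1 ^+ k * expR (- t^-1) else 0.

Lemma flat_ge0 k t : 0 <= flat k t.
Proof.
by rewrite /flat; case: ifP => // t0; rewrite mulr_ge0 ?expR_ge0// exprn_ge0// invr_ge0 ltW.
Qed.

(** With s = 1 / t, use exp s >= (s / (k + 2))^(k + 2). The quadratic bound makes the derivative at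
    0 vanish in [der_flat]. *)
Lemma flat_le k : exists2 C : R, 0 < C & forall t, flat k t <= C * t ^+ 2.
Proof.
have N0 : 0 < k.+2%:R :> R by rewrite ltr0n.
exists (k.+2%:R ^+ k.+2); first exact: exprn_gt0.
move=> t; rewrite /flat; case: ifP => [t0|_]; last by rewrite mulr_ge0 ?sqr_ge0// exprn_ge0// ltW.
set s := t^-1; have s0 : 0 < s by rewrite invr_gt0.
have tE : t = s^-1 by rewrite invrK.
have h : (s / k.+2%:R) ^+ k.+2 <= expR s.
  have -> : expR s = expR (s / k.+2%:R) ^+ k.+2.
    by rewrite -expRM_natl mulrC divfK// gt_eqF.
  rewrite lerXn2r ?nnegrE ?expR_ge0// ?divr_ge0 ?ltW//.
  by have := expR_ge1Dx (s / k.+2%:R); apply: lt_le_trans; rewrite ltr_pwDl.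
rewrite expRN ler_pdivrMr ?expR_gt0// tE.
have -> : s ^+ k = k.+2%:R ^+ k.+2 * s^-1 ^+ 2 * (s / k.+2%:R) ^+ k.+2.
  have Z0 : k.+2%:R ^+ k.+2 != 0 :> R by rewrite gt_eqF ?exprn_gt0.
  rewrite expr_div_n; move: (k.+2%:R ^+ k.+2 : R) Z0 => Z Z0.
  by rewrite -(addn2 k) exprD; field; rewrite Z0 gt_eqF.
by rewrite ler_pM2l// mulr_gt0 ?exprn_gt0// invr_gt0.
Qed.

Lemma der_flat k (t : R) : is_derive t (1 : R) (flat k) (flat k.+2 t - k%:R * flat k.+1 t).
Proof.
have [t0|t0|->] := ltgtP t 0.
- rewrite /flat !(le_gtF (ltW t0)) mulr0 subrr.
  apply: (der_ext _ (der_cst t 0)).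
  have : \forall s \near t, s < 0 by exact: lt_nbhsl.
  by apply: filterS => s s0; rewrite (le_gtF (ltW s0)).
- rewrite /flat t0.
  have d1 : is_derive t 1 (fun s : R => s^-1) (- (1 / t ^+ 2)).
    exact: (derV (lt0r_neq0 t0) (der_id t)).
  have d2 : is_derive t 1 (fun s : R => s^-1 ^+ k) (k%:R * t^-1 ^+ k.-1 * - (1 / t ^+ 2)).
    exact (der_comp d1 (derXn k t^-1)).
  have d3 : is_derive t 1 (fun s : R => expR (- s^-1)) (expR (- t^-1) * - - (1 / t ^+ 2)).
    exact (der_comp (derN d1) (is_derive_expR (- t^-1))).
  have d4 := derM d2 d3.
  have d5 : is_derive t 1 (fun s : R => s^-1 ^+ k * expR (- s^-1))
      (t^-1 ^+ k.+2 * expR (- t^-1) - k%:R * (t^-1 ^+ k.+1 * expR (- t^-1))).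
    apply: (der_eq d4); move: (expR _) => E.
    rewrite opprK div1r -exprVn; move: (t^-1) => s.
    by case: k {d2 d3 d4} => [|k]; rewrite /= !exprS ?expr0; ring.
  apply: (der_ext _ d5).
  have : \forall s \near t, 0 < s by exact: lt_nbhsr.
  by apply: filterS => s ->.
- rewrite /flat ltxx mulr0 subrr; apply/is_derive_epsP => e e0.
  have [C C0 HC] := flat_le k.
  exists (e / C); first by rewrite divr_gt0.
  move=> s sd; rewrite add0r mulr0 subr0 [s *: 1]mulr1 -/(flat k s).
  have -> : (if (0 : R) < 0 then _ else 0) = 0 by rewrite ltxx.
  rewrite subr0 ger0_norm ?flat_ge0//; apply: (le_trans (HC s)).
  rewrite -[s ^+ 2]real_normK ?num_real// expr2 mulrA ler_wpM2r//.
  by rewrite mulrC -ler_pdivlMr// ltW.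
Qed.

Context {n : nat}.
Implicit Types (x : 'rV[R]_n) (a b : 'rV[R]_n).

(* Closed under partial derivatives since [(flat k)' = flat (k+2) - k flat (k+1)], hence made
   of C^oo functions. *)
Inductive flatfun : ('rV[R]_n -> R) -> Prop :=
| flatfun_cst c : flatfun (fun=> c)
| flatfun_flat k (i : 'I_n) (c d : R) : flatfun (fun x => flat k (c * x 0 i + d))
| flatfunD u v : flatfun u -> flatfun v -> flatfun (fun x => u x + v x)
| flatfunM u v : flatfun u -> flatfun v -> flatfun (fun x => u x * v x).

Lemma flatfun_cont u x : flatfun u -> {for x, continuous u}.
Proof.
elim=> [c|k i c d|{}u v _ cu _ cv|{}u v _ cu _ cv].
- exact: cont_cst.
- apply: cont_comp; first exact: is_derive_continuous (der_flat k _).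
  apply: contD; last exact: cont_cst.
  by apply: contM; [exact: cont_cst|exact: coord_cont].
- exact: contD.
- exact: contM.
Qed.

Lemma flatfun_partial u (i : 'I_n) : flatfun u ->
  exists2 u', flatfun u' & forall x, is_derive x 'e_i u (u' x).
Proof.
elim=> [c|k j c d|{}u v hu [u' fu' du] hv [v' fv' dv]|{}u v hu [u' fu' du] hv [v' fv' dv]].
- by exists (fun=> 0); [exact: flatfun_cst|move=> x; exact: is_derive_cst].
- exists (fun x => (c * (i == j)%:R) * (flat k.+2 (c * x 0 j + d) + (- k%:R) * flat k.+1 (c * x 0 j + d))).
    apply: flatfunM; first exact: flatfun_cst.
    apply: flatfunD; first exact: flatfun_flat.
    by apply: flatfunM; [exact: flatfun_cst|exact: flatfun_flat].
  move=> x; rewrite -[x in is_derive x]addr0 -(scale0r 'e_i); apply/is_derive_line.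
  have dl : is_derive (0 : R) (1 : R) (fun s : R => c * (x + s *: 'e_i) 0 j + d) (c * (i == j)%:R).
    rewrite (_ : (fun s : R => _) = (fun s => (c * x 0 j + d) + s * (c * (i == j)%:R))).
      have := derD (der_cst 0 (c * x 0 j + d)) (is_derive_mulr 0 (c * (i == j)%:R)).
      by rewrite add0r.
    by apply/funext => s; rewrite !mxE eqxx /= eq_sym; ring.
  have := der_comp dl (der_flat k (c * (x + 0 *: 'e_i) 0 j + d)).
  rewrite scale0r addr0 => h; apply: (der_eq h); by rewrite mulrC mulNr.
- exists (fun x => u' x + v' x); first exact: flatfunD.
  by move=> x; exact: is_deriveD.
- exists (fun x => u x * v' x + v x * u' x).
    by apply: flatfunD; apply: flatfunM.
  by move=> x; exact: is_deriveM.
Qed.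

Lemma flatfun_Ck k u : flatfun u -> Ck k setT u.
Proof.
elim: k u => [|k IH] u fu /=.
  by split=> //; apply: within_cont => x _; exact: flatfun_cont.
split; first by apply: within_cont => x _; exact: flatfun_cont.
move=> i; have [u' fu' du] := flatfun_partial i fu.
split; first by move=> x _; have [] := du x.
rewrite (_ : partial i u = u'); first exact: IH.
by apply/funext => x; have [_] := du x.
Qed.

(** Zero off [obox a b], between 0 and 1, and tending to 1 on the box as [m] grows: a smooth
    substitute for the indicator under dominated convergence. The products are expanded to fit
    [flatfun_flat]. *)
Definition box_bump a b (m : nat) x : R :=
  \prod_i (flat 0 (m.+1%:R * x 0 i + - (m.+1%:R * a 0 i)) * flat 0 ((- m.+1%:R) * x 0 i + m.+1%:R * b 0 i)).

Lemma flatfun_bump a b m : flatfun (box_bump a b m).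
Proof.
rewrite (_ : box_bump a b m = fun x => box_bump a b m x)// /box_bump.
elim: (index_enum _) => [|i s IH].
  rewrite (_ : (fun _ => _) = (fun=> 1)); first exact: flatfun_cst.
  by apply/funext => x; rewrite big_nil.
rewrite (_ : (fun x => \prod_(j <- i :: s) _) = (fun x =>
  (flat 0 (m.+1%:R * x 0 i + - (m.+1%:R * a 0 i)) * flat 0 ((- m.+1%:R) * x 0 i + m.+1%:R * b 0 i)) *
  \prod_(j <- s) (flat 0 (m.+1%:R * x 0 j + - (m.+1%:R * a 0 j)) * flat 0 ((- m.+1%:R) * x 0 j + m.+1%:R * b 0 j)))).
  by apply: flatfunM IH; apply: flatfunM; exact: flatfun_flat.
by apply/funext => x; rewrite big_cons.
Qed.

Lemma bump_out a b m x : ~ obox a b x -> box_bump a b m x = 0.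
Proof.
move=> nx; apply/eqP; rewrite prodf_seq_eq0; apply/hasP.
have [i hi] : exists i, ~ (a 0 i < x 0 i < b 0 i) by apply/existsNP.
exists i; first exact: mem_index_enum.
have m0 : 0 < m.+1%:R :> R by rewrite ltr0n.
rewrite /= -mulrBr mulNr [- _ + _]addrC -mulrBr /flat !pmulr_rgt0// !subr_gt0.
apply/eqP.
by case: ifP => [h1|_]; [case: ifP => [h2|]; [case: hi; rewrite h1 h2|rewrite mulr0]|rewrite mul0r].
Qed.

Lemma flat0_le1 (t : R) : flat 0 t <= 1.
Proof.
rewrite /flat; case: ifP => // t0; rewrite expr0 mul1r -expR0 ler_expR oppr_le0 invr_ge0.
exact: ltW.
Qed.

Lemma bump01 a b m x : 0 <= box_bump a b m x <= 1.
Proof.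
rewrite /box_bump; apply: (big_ind (fun y : R => 0 <= y <= 1)); first by rewrite ler01 lexx.
  by move=> y z /andP[y0 y1] /andP[z0 z1]; rewrite mulr_ge0// mulr_ile1.
by move=> i _; rewrite mulr_ge0 ?flat_ge0// mulr_ile1 ?flat_ge0 ?flat0_le1.
Qed.

Lemma cvg_flat0 (t : R) : 0 < t -> flat 0 (m.+1%:R * t) @[m --> \oo] --> (1 : R).
Proof.
move=> t0.
rewrite (_ : (fun m => _) = (fun m : nat => expR (- (m.+1%:R^-1 * t^-1)))).
  rewrite -[X in _ --> X]expR0; apply: continuous_cvg; first exact: continuous_expR.
  rewrite -[X in _ --> X]oppr0; apply: cvgN; rewrite -[X in _ --> X](mul0r t^-1); apply: cvgMl.
  exact: cvg_harmonic.
apply/funext => m; rewrite /flat mulr_gt0 ?ltr0n//.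
by rewrite expr0 mul1r invfM.
Qed.

Lemma cvg_bump a b x : obox a b x -> box_bump a b m x @[m --> \oo] --> (1 : R).
Proof.
move=> hx; rewrite /box_bump; elim: (index_enum _) => [|i s IH].
  rewrite (_ : (fun m => _) = (fun=> 1)); first exact: cvg_cst.
  by apply/funext => m; rewrite big_nil.
rewrite (_ : (fun m => _) = (fun m : nat => flat 0 (m.+1%:R * (x 0 i - a 0 i)) * flat 0 (m.+1%:R * (b 0 i - x 0 i)) *
  \prod_(j <- s) (flat 0 (m.+1%:R * x 0 j + - (m.+1%:R * a 0 j)) * flat 0 ((- m.+1%:R) * x 0 j + m.+1%:R * b 0 j)))).
  have /andP[h1 h2] := hx i.
  rewrite -[X in _ --> X]mulr1; apply: cvgM IH.
  by rewrite -[X in _ --> X]mulr1; apply: cvgM; apply: cvg_flat0; rewrite subr_gt0.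
by apply/funext => m; rewrite big_cons; congr (flat _ _ * flat _ _ * _); ring.
Qed.

End bump.

(** * Weak derivatives of functions of class C^1 *)

Section weak.
Context {R : realType} {n : nat}.
Implicit Types (a b x v : 'rV[R]_n) (Omega : set 'rV[R]_n) (u w F G : 'rV[R]_n -> R).

Lemma cboxC_near a b x : ~ cbox a b x -> exists2 r : R, 0 < r & forall y, eb x r y -> ~ cbox a b y.
Proof.
move=> /existsNP[i hi].
have [h|h] := ltP (x 0 i) (a 0 i).
  exists (a 0 i - x 0 i); first by rewrite subr_gt0.
  move=> y yx /(_ i)/andP[h1 _]; have := le_lt_trans (coord_le_enorm (y - x) i) yx.
  by rewrite !mxE ltr_norml => /andP[_]; rewrite ltrD2r ltNge h1.
have [h'|h'] := ltP (b 0 i) (x 0 i); last by case: hi; rewrite h h'.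
exists (x 0 i - b 0 i); first by rewrite subr_gt0.
move=> y yx /(_ i)/andP[_ h1]; have := le_lt_trans (coord_le_enorm (y - x) i) yx.
by rewrite !mxE ltr_norml => /andP[h2 _]; lra.
Qed.

Lemma compact_cbox a b : compact (cbox a b).
Proof.
apply: (@subclosed_compact _ _ (cb 0 (n%:R * (enorm a + enorm b)))).
- rewrite -[cbox a b]setCK; apply: open_closedC; rewrite openE => x nx.
  have [r r0 hr] := cboxC_near nx; apply/nbhs_enormP; exists r => // y; exact: hr.
- exact: compact_cb.
- move=> x xC; rewrite /cb/= subr0; apply: enorm_le_coord => i.
  have := coord_le_enorm a i; have := coord_le_enorm b i; have /andP := xC i.
  rewrite !ler_norml => -[h1 h2] /andP[h3 h4] /andP[h5 h6].
  by apply/andP; split; have := enorm_ge0 a; have := enorm_ge0 b; lra.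
Qed.

Lemma lebesgue_cbox_lty a b : (lebesgue (cbox a b) < +oo)%E.
Proof.
apply: (@le_lt_trans _ _ (lebesgue (obox (a - const_mx 1) (b + const_mx 1)))); last exact: lebesgue_obox_lty.
apply: le_measure; rewrite ?inE; [exact: measurable_cbox|exact: measurable_obox|].
by move=> x xC i; have := xC i; rewrite !mxE; lra.
Qed.

Lemma cont_measurable Omega u : open Omega -> (forall x, Omega x -> {for x, continuous u}) ->
  measurable_fun Omega u.
Proof.
move=> oO cu; apply: (measurability _ (RGenOpens.measurableE R)).
move=> _ [_ [c [d ->]] <-]; apply: open_measurable_rV; rewrite openE => x [Ox ux].
apply: filterI; first by apply: open_nbhs_nbhs.
apply: (cu x Ox); apply: open_nbhs_nbhs; split=> //; exact: itv_open.
Qed.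

Lemma cont_bounded a b F : (forall x, cbox a b x -> {for x, continuous F}) ->
  exists2 M : R, 0 <= M & forall x, cbox a b x -> `|F x| <= M.
Proof.
move=> cF; have [ne|ne] := pselect (cbox a b !=set0); last first.
  by exists 0 => // x xC; case: ne; exists x.
have cw : {within cbox a b, continuous (fun x => `|F x|)}.
  apply: within_cont => x xC; apply: (@cont_comp _ _ (fun t : R => `|t|)); last exact: cF.
  exact: norm_continuous.
have [c cC cM] := compact_EVT_max ne (@compact_cbox a b) cw.
by exists `|F c| => // x xC; apply: cM; rewrite inE.
Qed.

Lemma supp_bounded a b F : (forall x, {for x, continuous F}) ->
  (forall x, ~ cbox a b x -> F x = 0) -> exists2 M : R, 0 <= M & forall x, `|F x| <= M.
Proof.
move=> cF F0; have [M M0 HM] := @cont_bounded a b F (fun x _ => cF x).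
exists M => // x; have [/HM//|/F0 ->] := pselect (cbox a b x).
by rewrite normr0.
Qed.

Lemma cont_integrable a b F : (forall x, cbox a b x -> {for x, continuous F}) ->
  measurable_fun (cbox a b) F -> lebesgue.-integrable (cbox a b) (EFin \o F).
Proof.
move=> cF mF; have [M M0 HM] := cont_bounded cF.
apply: measurable_bounded_integrable => //; [exact: measurable_cbox|exact: lebesgue_cbox_lty|].
by exists M; split; [exact: num_real|move=> N MN x /HM h; exact: le_trans h (ltW MN)].
Qed.

Lemma patch_out (D : set 'rV[R]_n) F : (forall x, ~ D x -> F x = 0) -> (EFin \o F) \_ D = EFin \o F.
Proof.
move=> F0; apply/funext => x; rewrite patchE; case: ifP => //= /negbT; rewrite notin_setE => /F0 ->.
by [].
Qed.

Lemma integral_supp (D : set 'rV[R]_n) F : (forall x, ~ D x -> F x = 0) ->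
  (\int[lebesgue]_(x in D) (F x)%:E = \int[lebesgue]_x (F x)%:E)%E.
Proof. by move=> /patch_out h; rewrite integral_mkcond -[X in patch _ _ X]/(EFin \o F) h. Qed.

Lemma supp_integrable a b F : (forall x, {for x, continuous F}) ->
  (forall x, ~ cbox a b x -> F x = 0) -> lebesgue.-integrable setT (EFin \o F).
Proof.
move=> cF F0; rewrite -(patch_out F0); apply/(integrable_mkcond _ (measurable_cbox a b)).
apply: cont_integrable => //; apply: (@measurable_funS _ _ _ _ setT) => //.
apply: cont_measurable => //; exact: openT.
Qed.

(** [v] is a total function, uncontrolled off [Omega]; the product is still continuous everywhere
    because [psi] vanishes near each point outside the closed box. *)
Lemma contM_supp Omega a b (v psi : 'rV[R]_n -> R) : cbox a b `<=` Omega ->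
  (forall x, Omega x -> {for x, continuous v}) ->
  (forall x, {for x, continuous psi}) -> (forall x, ~ cbox a b x -> psi x = 0) ->
  forall x, {for x, continuous (fun y : 'rV[R]_n => v y * psi y)}.
Proof.
move=> CO cv cp p0 x; have [xC|xC] := pselect (cbox a b x).
  by apply: contM => //; apply/cv/CO.
have near0 : \forall y \near x, 0 = v y * psi y.
  have [r r0 hr] := cboxC_near xC.
  by apply/nbhs_enormP; exists r => // y /hr/p0 ->; rewrite mulr0.
by apply: (cont_near near0); exact: cont_cst.
Qed.

Lemma cvg_diff_quotient F x v (l : R) : is_derive x v F l ->
  (F (x + m.+1%:R^-1 *: v) - F x) * m.+1%:R @[m --> \oo] --> l.
Proof.
move=> /is_derive_epsP d; apply/cvgrPdist_le => e e0.
have [r r0 hr] := d e e0.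
have : \forall m \near \oo, `|0 - m.+1%:R^-1| < r.
  by have /cvgrPdist_lt := @cvg_harmonic R; apply.
apply: filterS => m; rewrite sub0r normrN => hm.
have m0 : 0 < m.+1%:R :> R by rewrite ltr0n.
have := hr _ hm; rewrite [X in _ <= _ * X]gtr0_norm ?invr_gt0// ler_pdivlMr// => h.
apply: le_trans h; rewrite distrC -[X in _ <= _ * X](gtr0_norm m0) -normrM.
by rewrite [X in _ <= `|X|]mulrBl [_^-1 * l * _]mulrAC mulVf ?gt_eqF// mul1r.
Qed.

(* Translation invariance kills the integral of every difference quotient. *)
Lemma integral_partial_eq0 a b F G i : (forall x, {for x, continuous F}) ->
  (forall x, {for x, continuous G}) -> (forall x, ~ cbox a b x -> F x = 0) ->
  (forall x, ~ cbox a b x -> G x = 0) -> (forall x, is_derive x 'e_i F (G x)) ->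
  (\int[lebesgue]_x (G x)%:E = 0)%E.
Proof.
move=> cF cG F0 G0 dF; have [M M0 HM] := supp_bounded cG G0.
pose t (m : nat) : R := m.+1%:R^-1.
have t0 m : 0 < t m by rewrite /t invr_gt0 ltr0n.
have t1 m : t m <= 1 by rewrite /t invf_le1 ?ltr0n// ler1n.
pose H m x := (F (x + t m *: 'e_i) - F x) * m.+1%:R.
(* The translations have length [t m <= 1], so this enlarged box supports all difference quotients
   and carries the dominating function. *)
pose C := cbox (a - const_mx 1) (b + const_mx 1).
have mC : measurable C by exact: measurable_cbox.
have cFt m x : {for x, continuous (fun y : 'rV[R]_n => F (y + t m *: 'e_i))}.
  apply: (@continuous_comp _ _ _ (fun y : 'rV[R]_n => y + t m *: 'e_i) F); last exact: cF.
  by apply: continuous_rV_enormP => e e0; exists e => // y; rewrite opprD addrACA subrr addr0.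
have F0t m x : ~ cbox (a - t m *: 'e_i) (b - t m *: 'e_i) x -> F (x + t m *: 'e_i) = 0.
  by move=> h; apply: F0 => xC; apply: h => j; have := xC j; rewrite !mxE; lra.
have HC m x : ~ C x -> H m x = 0.
  move=> nC; rewrite /H F0 ?F0 ?subr0 ?mul0r//.
    by move=> xC; apply: nC => j; have := xC j; rewrite !mxE; lra.
  move=> xC; apply: nC => j; have := xC j; have := t0 m; have := t1 m.
  by rewrite !mxE eqxx /=; case: (j == i); rewrite ?mulr1 ?mulr0; lra.
have HB m x : `|H m x| <= M.
  rewrite /H normrM (gtr0_norm (_ : 0 < m.+1%:R))// -ler_pdivlMr ?ltr0n// -/(t m).
  have := @mvt_le R (fun s => F (x + s *: 'e_i)) (fun s => G (x + s *: 'e_i)) 0 (t m) M (ltW (t0 m)).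
  rewrite scale0r addr0 subr0; apply.
  - by move=> s _; exact: is_derive_continuous (is_derive_along (dF _)).
  - by move=> s _; exact: is_derive_along (dF _).
  - by move=> s _; exact: HM.
have int0 m : (\int[lebesgue]_x (H m x)%:E = 0)%E.
  have i1 := supp_integrable cF F0; have i2 := supp_integrable (cFt m) (@F0t m).
  have -> : (fun x => (H m x)%:E) = (fun x => m.+1%:R%:E * ((F (x + t m *: 'e_i))%:E - (F x)%:E))%E.
    by apply/funext => x; rewrite -EFinB -EFinM mulrC.
  rewrite integralZl//; last exact: integrableB i2 i1.
  rewrite integralB_EFin// (integral_translate (t m *: 'e_i) i1).
  by rewrite subee ?mule0//; exact: integrable_fin_num.
have [] := @dominated_convergence _ _ R lebesgue setT measurableT (fun m => EFin \o H m) (EFin \o G)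
  ((EFin \o cst M) \_ C).
- move=> m; apply/measurable_EFinP; apply: cont_measurable; first exact: openT.
  by move=> x _; apply: contM; [apply: contB; [exact: cFt|exact: cF]|exact: cont_cst].
- by apply/measurable_EFinP; apply: cont_measurable => //; exact: openT.
- by apply: aeW => x _; apply/cvg_EFin; [exact: nearW|exact: cvg_diff_quotient].
- apply/(integrable_mkcond _ mC); apply: cont_integrable; first by move=> x _; exact: cont_cst.
  exact: measurable_cst.
- apply: aeW => x m _; rewrite patchE; case: ifP => [_|/negbT].
    by rewrite lee_fin.
  by rewrite notin_setE => /(HC m)/= ->; rewrite normr0.
move=> _ _ h.
have : (\int[lebesgue]_x (EFin \o H m) x @[m --> \oo] --> (0 : \bar R))%E.
  by rewrite (_ : (fun m => _) = cst 0%E); [exact: cvg_cst|apply/funext => m; exact: int0].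
by move/(cvg_unique (@ereal_hausdorff R)) => /(_ _ h) <-.
Qed.

Lemma flatfun_partial_out a b (phi phi' : 'rV[R]_n -> R) i : (forall x, ~ cbox a b x -> phi x = 0) ->
  (forall x, is_derive x 'e_i phi (phi' x)) -> forall x, ~ cbox a b x -> phi' x = 0.
Proof.
move=> p0 dp x nx; apply: (is_derive_unique (dp x)); apply/is_derive_epsP => e e0.
have [r r0 hr] := cboxC_near nx; exists r => // t tr.
rewrite p0 ?p0 ?mulr0 ?subr0 ?normr0//; first by rewrite mulr_ge0// ltW.
by apply: hr; rewrite /eb/= addrAC subrr add0r enormZ enorm_delta mulr1.
Qed.

Lemma bump_cbox_out a b m x : ~ cbox a b x -> box_bump a b m x = 0.
Proof. by move=> h; apply: bump_out => /obox_sub_cbox. Qed.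

Lemma test_bump Omega a b m : cbox a b `<=` Omega -> test_function Omega (box_bump a b m).
Proof.
move=> CO; split; first by move=> k; apply: flatfun_Ck; exact: flatfun_bump.
by exists (cbox a b); split=> //; [exact: compact_cbox|exact: bump_cbox_out].
Qed.

Lemma bump_limit a b w : lebesgue.-integrable (obox a b) (EFin \o w) ->
  (\int[lebesgue]_(x in obox a b) (w x * box_bump a b m x)%:E @[m --> \oo] -->
   \int[lebesgue]_(x in obox a b) (w x)%:E)%E.
Proof.
move=> wi; have mw : measurable_fun (obox a b) w by apply/measurable_EFinP; exact: measurable_int wi.
have [] := @dominated_convergence _ _ R lebesgue (obox a b) (measurable_obox a b)
  (fun m x => (w x * box_bump a b m x)%:E) (EFin \o w) (fun x => `|(w x)%:E|%E) => //.
- move=> m; apply/measurable_EFinP; apply: measurable_funM => //.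
  apply: (@measurable_funS _ _ _ _ setT) => //; apply: cont_measurable; first exact: openT.
  by move=> x _; apply: flatfun_cont; exact: flatfun_bump.
- exact/measurable_EFinP.
- apply: aeW => x xQ; apply/cvg_EFin; first exact: nearW.
  by rewrite -[X in _ --> X]mulr1; apply: cvgM; [exact: cvg_cst|exact: cvg_bump].
- exact: integrable_abse.
- apply: aeW => x m _; rewrite lee_fin normrM -[leRHS]mulr1 ler_wpM2l//.
  by have /andP[h1 h2] := bump01 a b m x; rewrite ger0_norm.
Qed.

(** Test with the bumps. The integral of the derivative of [u * phi] vanishes, so the classical
    derivative satisfies the identity that defines [w]; letting [m] grow removes the bump. *)
Lemma weak_box Omega u w i a b : open Omega -> C1on Omega u -> weak_partial Omega i u w ->
  cbox a b `<=` Omega -> lebesgue.-integrable (obox a b) (EFin \o w) ->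
  (\int[lebesgue]_(x in obox a b) (w x)%:E = \int[lebesgue]_(x in obox a b) (partial i u x)%:E)%E.
Proof.
move=> oO Cu hw CO wi; have mC := measurable_cbox a b.
have cu x : Omega x -> {for x, continuous u} by move=> /Cu[].
have cp x : Omega x -> {for x, continuous (partial i u)} by move=> /Cu[_ /(_ i)[]].
have pi : lebesgue.-integrable (obox a b) (EFin \o partial i u).
  apply: (integrableS mC); [exact: measurable_obox|exact: obox_sub_cbox|].
  apply: cont_integrable; first by move=> x /CO/cp.
  by apply: (@measurable_funS _ _ _ _ Omega) => //; [exact: open_measurable_rV|exact: cont_measurable].
suff E m : (\int[lebesgue]_(x in obox a b) (w x * box_bump a b m x)%:E =
            \int[lebesgue]_(x in obox a b) (partial i u x * box_bump a b m x)%:E)%E.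
  have h1 := bump_limit wi; have h2 := bump_limit pi.
  apply: (cvg_unique (@ereal_hausdorff R) h1).
  by rewrite (_ : (fun m => _) = (fun m => \int[lebesgue]_(x in obox a b) (partial i u x * box_bump a b m x)%:E)%E)//; apply/funext.
set phi := box_bump a b m.
have po x : ~ obox a b x -> phi x = 0 by exact: bump_out.
have p0 x : ~ cbox a b x -> phi x = 0 by exact: bump_cbox_out.
have pO x : ~ Omega x -> phi x = 0 by move=> h; apply: p0 => /CO.
have [phi' fphi' dphi] := flatfun_partial i (flatfun_bump a b m).
have p0' := flatfun_partial_out p0 dphi.
have cphi x : {for x, continuous phi} by apply: flatfun_cont; exact: flatfun_bump.
have cphi' x : {for x, continuous phi'} by apply: flatfun_cont.
have pE : partial i phi = phi' by apply/funext => x; have [_] := dphi x.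
have c1 := contM_supp CO cu cphi p0.
have c2 := contM_supp CO cu cphi' p0'.
have c3 := contM_supp CO cp cphi p0.
have i2 : lebesgue.-integrable setT (EFin \o (fun x => u x * phi' x)).
  by apply: (supp_integrable c2 (a := a) (b := b)) => x /p0' ->; rewrite mulr0.
have i3 : lebesgue.-integrable setT (EFin \o (fun x => partial i u x * phi x)).
  by apply: (supp_integrable c3 (a := a) (b := b)) => x /p0 ->; rewrite mulr0.
have Z : (\int[lebesgue]_x (u x * phi' x + partial i u x * phi x)%:E = 0)%E.
  apply: (@integral_partial_eq0 a b (fun x => u x * phi x) _ i) => //.
  - by move=> x; exact: contD.
  - by move=> x /p0 ->; rewrite mulr0.
  - by move=> x nx; rewrite p0// p0'// !mulr0 addr0.
  move=> x; have [xC|xC] := pselect (cbox a b x).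
    have [_ /(_ i)[du _]] := Cu x (CO x xC).
    rewrite (mulrC (partial i u x)).
    exact: (is_deriveM (is_derive_partial du) (dphi x)).
  rewrite p0// p0'// !mulr0 addr0; apply/is_derive_epsP => e e0.
  have [r r0 hr] := cboxC_near xC; exists r => // t tr.
  rewrite !p0 ?mulr0 ?subr0 ?normr0//; first by rewrite mulr_ge0// ltW.
  by apply: hr; rewrite /eb/= addrAC subrr add0r enormZ enorm_delta mulr1.
have := hw _ (test_bump m CO); rewrite -/phi pE.
rewrite (@integral_supp _ (fun x => u x * phi' x)); last first.
  by move=> x nx; rewrite p0' ?mulr0// => /CO.
rewrite (@integral_supp _ (fun x => w x * phi x)); last by move=> x /pO ->; rewrite mulr0.
rewrite (@integral_supp (obox a b) (fun x => w x * phi x)); last by move=> x /po ->; rewrite mulr0.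
rewrite (@integral_supp (obox a b) (fun x => partial i u x * phi x)); last by move=> x /po ->; rewrite mulr0.
move: Z; rewrite (_ : (fun x => _) = (fun x => (u x * phi' x)%:E + (partial i u x * phi x)%:E))%E; last first.
  by apply/funext => x; rewrite EFinD.
rewrite integralD_EFin// => Z hE; move: Z; rewrite hE.
move=> /eqP; rewrite addeC sube_eq ?add0e; last 2 first.
- exact: integrable_fin_num.
- by rewrite fin_num_adde_defr//; exact: integrable_fin_num.
by move=> /eqP ->.
Qed.

(** On a box of finite measure, |w| <= 1 + |w|^p. *)
Lemma Lp_loc_integrable Omega (p : nat) w a b : open Omega -> (0 < p)%N -> Lp_loc p Omega w ->
  cbox a b `<=` Omega -> lebesgue.-integrable (cbox a b) (EFin \o w).
Proof.
move=> oO p0 [mw Lw] CO; have mC := measurable_cbox a b.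
have mwC : measurable_fun (cbox a b) w.
  by apply: (@measurable_funS _ _ _ _ Omega) => //; exact: open_measurable_rV.
have i1 : lebesgue.-integrable (cbox a b) (EFin \o cst 1).
  by apply: cont_integrable; [move=> x _; exact: cont_cst|exact: measurable_cst].
have mX : measurable_fun (cbox a b) (fun x => `|w x| ^+ p).
  by apply: measurable_funX; exact: measurableT_comp.
have i2 : lebesgue.-integrable (cbox a b) (EFin \o (fun x => `|w x| ^+ p)).
  apply/integrableP; split; first exact/measurable_EFinP.
  have := Lw _ (@compact_cbox a b) CO; congr (_ < _)%E; apply: eq_integral => x _ /=.
  by rewrite normrX normr_id.
apply: le_integrable (integrableD mC i1 i2) => //; first exact/measurable_EFinP.
move=> x _; rewrite -[leRHS]/(`|1 + `|w x| ^+ p|%:E) -[leLHS]/(`|w x|%:E) lee_fin.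
rewrite [leRHS]ger0_norm; last by rewrite addr_ge0// exprn_ge0.
have [h|h] := leP `|w x| 1; first by rewrite (le_trans h)// lerDl exprn_ge0.
by rewrite -[leLHS]add0r lerD// -[leLHS]expr1 ler_weXn2l// ltW.
Qed.

Lemma weak_eq_ae Omega (p : nat) u w i a b : open Omega -> (0 < p)%N -> C1on Omega u ->
  Lp_loc p Omega w -> weak_partial Omega i u w -> cbox a b `<=` Omega ->
  {ae lebesgue, forall x, obox a b x -> w x = partial i u x}.
Proof.
move=> oO p0 Cu Lw hw CO; have mC := measurable_cbox a b; have mQ := measurable_obox a b.
have wi := Lp_loc_integrable oO p0 Lw CO.
have pi : lebesgue.-integrable (cbox a b) (EFin \o partial i u).
  have cp x : Omega x -> {for x, continuous (partial i u)} by move=> /Cu[_ /(_ i)[]].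
  apply: cont_integrable; first by move=> x /CO/cp.
  by apply: (@measurable_funS _ _ _ _ Omega) => //; [exact: open_measurable_rV|exact: cont_measurable].
have S := @obox_sub_cbox _ _ a b.
apply: integral_boxes_ae_eq => //.
- exact: integrableS wi.
- exact: integrableS pi.
- move=> c d; rewrite oboxI; apply: weak_box hw _ _ => //.
    move=> x xC; apply: CO => j; have := xC j; rewrite !mxE ge_max le_min.
    by move=> /andP[/andP[_ ->] /andP[_ ->]].
  rewrite -oboxI; apply: integrableS wi => //; last by move=> x [_ /S].
  by apply: measurableI => //; exact: measurable_obox.
- by apply: weak_box hw _ _ => //; exact: integrableS wi.
Qed.

End weak.

(** * The Lipschitz bound *)

Section assembly.
Context {R : realType} {n : nat}.
Implicit Types (x y v : 'rV[R]_n) (f g : 'rV[R]_n -> 'rV[R]_n).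

Lemma cont_prod (s : seq 'I_n) (F : 'I_n -> 'rV[R]_n -> R) x :
  (forall i, {for x, continuous (F i)}) -> {for x, continuous (fun y => \prod_(i <- s) F i y)}.
Proof.
move=> cF; elim: s => [|i s IH].
  rewrite (_ : (fun _ => _) = (fun=> 1)); first exact: cont_cst.
  by apply/funext => y; rewrite big_nil.
rewrite (_ : (fun _ => _) = (fun y => F i y * \prod_(j <- s) F j y)); first exact: contM.
by apply/funext => y; rewrite big_cons.
Qed.

Lemma cont_det (A : 'rV[R]_n -> 'M[R]_n) x : (forall i j, {for x, continuous (fun y => A y i j)}) ->
  {for x, continuous (fun y => \det (A y))}.
Proof.
move=> cA; apply: cont_sum => s; apply: contM; first exact: cont_cst.
by apply: cont_prod => i; exact: cA.
Qed.

Lemma cont_enorm_mul (A : 'rV[R]_n -> 'M[R]_n) v x :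
  (forall i j, {for x, continuous (fun y => A y i j)}) ->
  {for x, continuous (fun y => enorm (v *m A y) : R)}.
Proof.
move=> cA; apply: (@cont_comp _ _ (@Num.sqrt R)); first exact: sqrt_continuous.
apply: cont_sum => j; apply: contX.
rewrite (_ : (fun _ => _) = (fun y => \sum_k v 0 k * A y k j)); last by apply/funext => y; rewrite mxE.
by apply: cont_sum => k; apply: contM; [exact: cont_cst|exact: cA].
Qed.

(** A failure at [x] for a fixed vector [v] persists on a small box by continuity of the Jacobian;
    there [Df] and [jac f] agree almost everywhere, so the box would be a null set. Fixing [v]
    avoids proving continuity of [opnorm]. *)
Lemma qc_pointwise (K : R) f (Df : 'rV[R]_n -> 'M[R]_n) : (0 < n)%N ->
  (forall j, C1on (@eball R n) (fun x => f x 0 j)) -> W1p_loc n (@eball R n) f Df ->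
  {ae lebesgue, forall x, eball x -> opnorm (Df x) ^+ n <= K * `|\det (Df x)|} ->
  forall x v, eball x -> enorm v <= 1 -> enorm (v *m jac f x) ^+ n <= K * `|\det (jac f x)|.
Proof.
move=> hn Cf Wf aeK x v xB v1; rewrite leNgt; apply/negP => lt.
have cJ y : eball y -> forall i j, {for y, continuous (fun z => jac f z i j)}.
  move=> yB i j; rewrite (_ : (fun z => _) = partial i (fun z => f z 0 j)).
    by have [_ /(_ i)[]] := Cf j y yB.
  by apply/funext => z; rewrite mxE.
pose Phi y := enorm (v *m jac f y) ^+ n - K * `|\det (jac f y)|.
have cPhi : {for x, continuous Phi}.
  apply: contB; first by apply: contX; apply: cont_enorm_mul; exact: cJ.
  apply: contM; first exact: cont_cst.
  by apply: (@cont_comp _ _ (fun t : R => `|t|)); [exact: norm_continuous|apply: cont_det; exact: cJ].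
have Phi0 : 0 < Phi x by rewrite subr_gt0.
have [r1 r10 H1] := (continuous_enormP _ _).1 cPhi _ Phi0.
have [r2 r20 H2] : exists2 r, 0 < r & eb x r `<=` @eball R n.
  by apply/nbhs_enormP; apply: open_nbhs_nbhs; split=> //; exact: open_eball.
pose r := Num.min r1 r2; have r0 : 0 < r by rewrite lt_min r10.
have n0 : 0 < n%:R + 1 :> R by rewrite ltr_wpDl.
pose c := r / (n%:R + 1) / 2.
have c0 : 0 < c by rewrite !divr_gt0.
pose a := x - const_mx c; pose b := x + const_mx c.
have Cr : cbox a b `<=` eb x r.
  move=> y yC; apply: (box_sub_eb r0) => i; have := yC i; rewrite !mxE ltr_norml.
  have cE : r / (n%:R + 1) = c * 2 by rewrite divfK.
  by rewrite cE; lra.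
have CB : cbox a b `<=` @eball R n.
  by move=> y /Cr yr; apply: H2; apply: (lt_le_trans yr); rewrite ge_min lexx orbT.
have ae1 (ij : 'I_n * 'I_n) : {ae lebesgue, forall y, obox a b y -> Df y ij.1 ij.2 = jac f y ij.1 ij.2}.
  case: ij => i j; have [_ /(_ i)[LD wD]] := Wf j.
  have := weak_eq_ae (open_eball (n := n)) hn (Cf j) LD wD CB.
  by apply: filterS => y h yQ; rewrite mxE; exact: h.
have ae2 : {ae lebesgue, forall y, forall ij : 'I_n * 'I_n, obox a b y -> Df y ij.1 ij.2 = jac f y ij.1 ij.2}.
  exact: (@filter_forall _ _ (fun ij => [set y | obox a b y -> Df y ij.1 ij.2 = jac f y ij.1 ij.2]) _ _ ae1).
have N : lebesgue.-negligible (box x c).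
  apply: negligibleS (filterI aeK ae2).
  move=> y yQ [h1 h2].
  have yO : obox a b y by move=> i; have := yQ i; rewrite !mxE ltr_norml; lra.
  have yB : eball y by apply/CB/obox_sub_cbox.
  have E : Df y = jac f y by apply/matrixP => i j; exact: (h2 (i, j)).
  have := h1 yB; rewrite E => h3.
  have yr : enorm (y - x) < r1.
    by apply: (lt_le_trans (Cr y (obox_sub_cbox yO))); rewrite ge_min lexx.
  have := H1 y yr; rewrite ltr_norml => /andP[h4 _].
  have : Phi y <= 0.
    rewrite subr_le0; apply: le_trans h3; rewrite lerXn2r ?nnegrE ?enorm_ge0 ?opnorm_ub//.
    exact: le_trans (enorm_ge0 _) (opnorm_ub _ v1).
  by clear -h4; lra.
have : lebesgue (box x c) = 0%E by apply/negligibleP; [exact: measurable_box|].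
rewrite lebesgue_boxE ?(ltW c0)// => -[] /eqP.
by rewrite gt_eqF// exprn_gt0// mulr_gt0.
Qed.

(** The factor produced by [distortion_jnorm], with [K] raised to at least 1 as the estimates for
    [hqc] require. *)
Definition qc_const (K : R) : R := n%:R ^+ 2 * (Num.max K 1 * (n%:R * (n%:R * n.-1`!%:R))).

Lemma qc_const_ge1 K : (0 < n)%N -> 1 <= qc_const K.
Proof.
move=> hn; have n1 : 1 <= n%:R :> R by rewrite ler1n.
have f1 : 1 <= n.-1`!%:R :> R by rewrite ler1n fact_gt0.
have K1 : 1 <= Num.max K 1 by rewrite le_max lexx orbT.
rewrite /qc_const; do 2 (apply: mulr_ege1; first by rewrite ?exprn_ege1//).
by apply: mulr_ege1 => //; exact: mulr_ege1.
Qed.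

Lemma hqc_of_quasiconformal (K : R) f : (0 < n)%N -> harmonic_map (@eball R n) f ->
  quasiconformal K (@eball R n) (@eball R n) f -> exists g, hqc (qc_const K) f g.
Proof.
move=> hn hf [_ _ [[fB fi fs] cf [g [gK cg]]] [Df [Wf aeK]]]; exists g.
have hh j : harm (@eball R n) (fun x => f x 0 j) by apply: harmonic_on_harm => //; exact: open_eball.
have K1 : 1 <= Num.max K 1 by rewrite le_max lexx orbT.
have pw x : eball x -> forall v, enorm v <= 1 -> enorm (v *m jac f x) ^+ n <= Num.max K 1 * `|\det (jac f x)|.
  move=> xB v v1; apply: (le_trans (qc_pointwise hn (fun j => (hh j).1) Wf aeK xB v1)).
  by rewrite ler_wpM2r// le_max lexx.
have gB y : eball y -> eball (g y) /\ f (g y) = y.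
  by move=> yB; have [x xB <-] := fs y yB; rewrite gK.
have cont_at (h : 'rV[R]_n -> 'rV[R]_n) x : {within @eball R n, continuous h} -> eball x -> {for x, continuous h}.
  rewrite (continuous_open_subspace h open_eball) => ch xB.
  by apply: ch; rewrite inE.
split=> //.
- by move=> y /gB[].
- by move=> y /gB[].
- by move=> x; exact: cont_at.
- by move=> x; exact: cont_at.
- by move=> x v xB; have [] := distortion_jnorm hn K1 (pw x xB) v.
- by move=> x v xB; have [] := distortion_jnorm hn K1 (pw x xB) v.
Qed.

Lemma dist_sphere y : (0 < n)%N -> eball y -> dist_to y (@esphere R n) = 1 - enorm y.
Proof.
move=> hn yB.
have i0 : 'I_n by exact: Ordinal hn.
have lb z : esphere z -> 1 - enorm y <= enorm (y - z).
  by rewrite /esphere/= enormBC => <-; exact: enorm_lerB.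
have [z zS zE] : exists2 z, esphere z & enorm (y - z) = 1 - enorm y.
  have [->|y0] := eqVneq y 0.
    by exists 'e_i0; [exact: enorm_delta|rewrite sub0r enormN enorm_delta enorm0 subr0].
  have yp := enorm_gt0 y0.
  exists ((enorm y)^-1 *: y); first by rewrite /esphere/= enormZ gtr0_norm ?invr_gt0// mulVf// gt_eqF.
  rewrite -[X in X - _]scale1r -scalerBl enormZ ler0_norm; last by rewrite subr_le0 invf_ge1// ltW.
  by rewrite opprB mulrBl mulVf ?gt_eqF// mul1r.
apply/eqP; rewrite eq_le; apply/andP; split.
  rewrite -zE; apply: ge_inf; last by exists z.
  by exists (1 - enorm y) => _ [w wS <-]; exact: lb.
apply: lb_le_inf; first by exists (enorm (y - z)), z.
by move=> _ [w wS <-]; exact: lb.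
Qed.

End assembly.

Unset Implicit Arguments.

Theorem theorem2p1 (R : realType) (n : nat) (hn : (2 <= n)%N) (K d : R) :
  exists L : R, forall f : 'rV[R]_n -> 'rV[R]_n,
    harmonic_map (@eball R n) f ->
    quasiconformal K (@eball R n) (@eball R n) f ->
    dist_to (f 0) (@esphere R n) = d ->
    forall x y : 'rV[R]_n, eball x -> eball y ->
      enorm (f x - f y) <= L * enorm (x - y).
Proof.
have n0 : (0 < n)%N by exact: ltnW.
have B0 : eball (0 : 'rV[R]_n) by rewrite /eball/= enorm0.
have dE f : quasiconformal K (@eball R n) (@eball R n) f -> dist_to (f 0) (@esphere R n) = d ->
    0 < d /\ d = 1 - enorm (f 0).
  move=> [_ _ [[fB _ _] _ _] _] <-; rewrite dist_sphere//; last exact: fB.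
  by rewrite subr_gt0; split=> //; exact: (fB _ B0).
(* The distance of [f 0] to the sphere is 1 - |f 0| > 0, so for [d <= 0] there is no such [f] and
   any constant serves. *)
have [d0|d0] := ltP 0 d; last first.
  by exists 0 => f _ qf /(dE f qf)[]; rewrite ltNge d0.
have [L HL] := hqc_lipschitz hn (@qc_const_ge1 R n K n0) d0.
exists L => f hf qf /(dE f qf)[_ df]; have [g hg] := hqc_of_quasiconformal n0 hf qf.
by apply: HL hg _; rewrite df.
Qed.
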